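(* Let $\lambda$ be a nonempty partition with $\ell(\lambda)<n$ and let $P\in F_{\lambda,n}\subseteq X_\lambda$. Then $$\pi_\lambda\left(\left(I_{P,X_\lambda}^{\langle2\rangle}\right)_{\mathbf{d}}\right)\subseteq\left(I_{\mathrm S}(P)^{\langle2\rangle}\right)_\lambda=\left(\widehat T_PF_{\lambda,n}\right)^\perp.$$ Moreover, equality holds (between the first and the second space) if and only if the embedded flag variety $F_{\lambda,n}$ is consistent.
   Context: $V$ is a complex vector space of dimension $n$; $G=\mathrm{GL}(V)$. For a partition $\alpha$ with $\ell(\alpha)\le n$, $\mathbb{S}_\alpha V$ is the irreducible polynomial $G$-module of highest weight $\alpha$, and $\mathbb{S}_\alpha V^*$ is its dual. Write the conjugate partition of $\lambda$ as $\lambda'=(n_k^{d_k},\ldots,n_1^{d_1})$ with $0<n_1<\cdots<n_k<n$, $d_i\ge1$ (exactly $d_i$ columns of height $n_i$), and set $\mathbf{d}=(d_1,\ldots,d_k)$, $n_0=0$, $n_{k+1}=n$. Flag variety. $F_{\lambda,n}\subseteq\mathbb{P}(\mathbb{S}_\lambda V)$ is the unique closed $G$-orbit (the orbit of the class of a highest-weight vector); it is isomorphic to the partial flag variety of flags $W_1\subsetneq\cdots\subsetneq W_k\subsetneq V$, $\dim W_i=n_i$, embedded by $\mathcal{O}(d_1,\dots,d_k)$. $\widehat T_PF_{\lambda,n}\subseteq\mathbb{S}_\lambda V$ is the affine tangent space (Zariski tangent space to the affine cone at a nonzero representative of $P$) and $\perp$ is the annihilator in $\mathbb{S}_\lambda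 V^*$. Consistency. $F_{\lambda,n}$ is consistent if for every $i\in\{1,\dots,k\}$ with $d_i=1$ one has $\min\{n_i-n_{i-1},\,n_{i+1}-n_i\}\le1$. Slot-by-slot algebra. $X_\lambda=\prod_{i=1}^k\mathbb{P}(\bigwedge^{n_i}V)$, with $\mathbb{N}^k$-graded coordinate ring $\mathcal{R}_\lambda=\bigotimes_{i=1}^k\mathrm{Sym}^\bullet(\bigwedge^{n_i}V^* )$; thus $(\mathcal{R}_\lambda)_{\mathbf{d}}=\bigotimes_i\mathrm{Sym}^{d_i}(\bigwedge^{n_i}V^* )$. Via Plücker embeddings the flag variety is regarded as a subvariety of $X_\lambda$, and the same letter $P$ denotes the corresponding point. $\pi_\lambda:(\mathcal{R}_\lambda)_{\mathbf{d}}\to\mathbb{S}_\lambda V^*$ is a fixed nonzero $G$-equivariant surjection (the Cartan projection, unique up to scalar; dual to the inclusion of the Cartan component $\mathbb{S}_\lambda V\hookrightarrow\bigotimes_i\mathrm{Sym}^{d_i}(\bigwedge^{n_i}V)$). If $P$ is the flag $(W_i)$, its multihomogeneous ideal $I_{P,X_\lambda}\subseteq\mathcal{R}_\lambda$ is generated by the linear forms in $(\bigwedge^{n_i}W_i)^\perp\subseteq\bigwedge^{n_i}V^*$, placed in the $i$-th factor, $i=1,\dots,k$. $I_{P,X_\lambda}^{\langle2\rangle}$ is the multihomogeneous ideal of the geometric double point supported at $P$ in $X_\lambda$; it equals $I_{P,X_\lambda}^2$. Schur apolarity. Put $\mathbb{S}^\bullet V^*=\bigoplus_{\ell(\alpha)\le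 n}\mathbb{S}_\alpha V^*$; for a subspace $A$, $(A)_\alpha=A\cap\mathbb{S}_\alpha V^*$. Realize $\mathbb{S}_\alpha V$ (resp. $\mathbb{S}_\alpha V^*$) as the unique $G$-submodule of that isomorphism type in $\bigotimes_{c}\bigwedge^{\alpha'_c}V$ (resp. $\bigotimes_c\bigwedge^{\alpha'_c}V^*$). For $\mu\subseteq\lambda$ (put $\mu'_c=0$ for $c>\mu_1$), the action $*:\mathbb{S}_\mu V^*\otimes\mathbb{S}_\lambda V\to\mathbb{S}_{\lambda/\mu}V\subseteq\bigotimes_{c=1}^{\lambda_1}\bigwedge^{\lambda'_c-\mu'_c}V$ is the restriction of the tensor product over $c$ of the usual skew-symmetric contractions; if $\mu\not\subseteq\lambda$ it is zero; it is extended componentwise to $\mathbb{S}^\bullet V^*\otimes\mathbb{S}_\lambda V\to\bigoplus_{\mu\subseteq\lambda}\mathbb{S}_{\lambda/\mu}V$. With $\mathfrak{gl}(V)$ acting on $\mathbb{S}^\bullet V^*$ by differentiating the $G$-action, for $P=[p]$ the geometric Schur square is $$I_{\mathrm S}(P)^{\langle2\rangle}=\{\varphi\in\mathbb{S}^\bullet V^*\mid\varphi*p=0\text{ and }(\xi\cdot\varphi)*p=0\text{ for every }\xi\in\mathfrak{gl}(V)\}.$$ *)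

(* Defs.v *)
From HB Require Import structures.
From mathcomp Require Import all_boot all_order all_algebra.
From mathcomp Require Import complex mpoly.
Set Implicit Arguments.
Unset Strict Implicit.
Unset Printing Implicit Defensive.
Import GRing.Theory Num.Theory.
Local Open Scope ring_scope.

(* V is the space 'cV[A]_n of column vectors, with standard basis (e_i), and  *)
(* G = GL(V) is the set of invertible n x n matrices.  V^* is identified with *)
(* 'cV[A]_n by the dual basis (e_i^* ), so that g acts on it by the matrix    *)
(* (g^-1)^T.                                                                  *)

(** Partitions *)

Definition is_part (n : nat) (a : seq nat) : bool :=
  [&& sorted geq a, 0%N \notin a & (size a <= n)%N].

Record part (n : nat) := Part { part_val :> seq nat; _ : is_part n part_val }.

HB.instance Definition _ n := [isSub for @part_val n].
HB.instance Definition _ n := [Equality of part n by <:].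

Definition cols (a : seq nat) : nat := head 0%N a.

Definition conj_part (a : seq nat) : seq nat :=
  [seq count (fun r => c < r)%N a | c <- iota 0 (cols a)].

Definition col_height (a : seq nat) (c : nat) : nat := nth 0%N (conj_part a) c.

Definition part_incl (b a : seq nat) : bool :=
  all (fun i => nth 0 b i <= nth 0 a i)%N (iota 0 (size b)).

(* n_1 < ... < n_k; indices i are shifted down by one, so i : 'I_k.           *)
Definition heights (a : seq nat) : seq nat := sort leq (undup (conj_part a)).

Definition nblocks (a : seq nat) : nat := size (heights a).

Definition height (a : seq nat) (i : 'I_(nblocks a)) : nat := nth 0%N (heights a) i.

Definition mult (a : seq nat) (i : 'I_(nblocks a)) : nat :=
  count_mem (height i) (conj_part a).

(* The list bounds is n_0 = 0, n_1, ..., n_k, n_(k+1) = n.                    *)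
Definition consistent (n : nat) (a : seq nat) : Prop :=
  let bounds := 0%N :: rcons (heights a) n in
  forall i : 'I_(nblocks a), mult i = 1%N ->
    (minn (nth 0 bounds i.+1 - nth 0 bounds i)
          (nth 0 bounds i.+2 - nth 0 bounds i.+1) <= 1)%N.

(** Exterior algebra, on the basis e_S = e_(s_1) /\ ... /\ e_(s_h) for
    S = {s_1 < ... < s_h}.  The same type with basis e_S^* is used for V^*. *)

Definition ext (A : comNzRingType) (n : nat) := {ffun {set 'I_n} -> A^o}.

Section Exterior.
Variables (A : comNzRingType) (n : nat).
Implicit Types (S T U : {set 'I_n}) (x y : ext A n) (g : 'M[A]_n).

(* For disjoint S and T, e_S /\ e_T = ext_sign S T *: e_(S :|: T).            *)
Definition ext_sign S T : A :=
  (-1) ^+ #|[set st : 'I_n * 'I_n |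
              [&& st.1 \in S, st.2 \in T & (st.2 < st.1)%N]]|.

Definition ext_mul x y : ext A n :=
  [ffun U : {set 'I_n} => \sum_(S : {set 'I_n} | S \subset U)
               ext_sign S (U :\: S) * x S * y (U :\: S)].

Definition ext_one : ext A n := [ffun S : {set 'I_n} => (S == set0)%:R].

Definition ext_vec (v : 'cV[A]_n) : ext A n :=
  [ffun S : {set 'I_n} => \sum_(i | S == [set i]) v i 0].

Definition wedge (s : seq 'cV[A]_n) : ext A n :=
  foldr (fun v => ext_mul (ext_vec v)) ext_one s.

(* The image of e_S under the action of g.                                    *)
Definition ext_act_basis g S : ext A n := wedge [seq col i g | i <- enum S].

(* The coefficient of e_U in the contraction of e_T by e_S^*, i.e. in the
   transpose of left multiplication by e_S^* on the exterior algebra of V^*.  *)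
Definition contr_coef S T U : A :=
  if (S \subset T) && (U == T :\: S) then ext_sign S U else 0.

End Exterior.

(** Tensor products of m copies of the exterior algebra, on the basis
    e_(F 0) (x) ... (x) e_(F (m - 1)). *)

Definition tens (A : comNzRingType) (n m : nat) :=
  {ffun {ffun 'I_m -> {set 'I_n}} -> A^o}.

Section Tensors.
Variables (A : comNzRingType) (n : nat).

Definition pure_tens m (x : 'I_m -> ext A n) : tens A n m :=
  [ffun F : {ffun 'I_m -> {set 'I_n}} => \prod_c x c (F c)].

Definition tens_act m (g : 'M[A]_n) (t : tens A n m) : tens A n m :=
  [ffun F : {ffun 'I_m -> {set 'I_n}} =>
     \sum_(E : {ffun 'I_m -> {set 'I_n}}) t E * \prod_c ext_act_basis g (E c) (F c)].

(* Membership in the tensor product over c of the exterior powers of degree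
   a'_c.                                                                      *)
Definition tens_homog (a : seq nat) (t : tens A n (cols a)) : Prop :=
  forall F, t F != 0 -> forall c, #|F c| = col_height a c.

Definition pairing m (phi t : tens A n m) : A := \sum_F phi F * t F.

Definition pad m' m (E : {ffun 'I_m' -> {set 'I_n}}) (c : 'I_m) : {set 'I_n} :=
  oapp E set0 (insub (val c)).

(* The tensor product of the contractions of the m columns; a tensor phi with
   m' < m columns is completed by empty columns.                              *)
Definition contract m' m (phi : tens A n m') (t : tens A n m) : tens A n m :=
  [ffun U : {ffun 'I_m -> {set 'I_n}} =>
     \sum_(E : {ffun 'I_m' -> {set 'I_n}}) \sum_(F : {ffun 'I_m -> {set 'I_n}})
       phi E * t F * \prod_c contr_coef A (pad E c) (F c) (U c)].

End Tensors.

Section Dual.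
Variables (K : fieldType) (n m : nat).

Definition dual_act (g : 'M[K]_n) (phi : tens K n m) : tens K n m :=
  tens_act (invmx g)^T phi.

(* The differential of dual_act at the identity: since the inverse of 1 + t xi
   is 1 - t xi modulo t^2, it is the coefficient of t in the action of the
   matrix (1 - t xi)^T over K[t].                                             *)
Definition gl_dual_act (xi : 'M[K]_n) (phi : tens K n m) : tens K n m :=
  let g := (1%:M - 'X *: map_mx polyC xi)^T in
  [ffun F => (tens_act g [ffun E => (phi E)%:P : {poly K}^o] F : {poly K})`_1].

End Dual.

(** G-modules *)

Section Modules.
Variables (K : fieldType) (n : nat).

Section Stable.
Variables (m : nat) (act : 'M[K]_n -> tens K n m -> tens K n m).

Definition submodule (U : {vspace tens K n m}) : Prop :=
  forall g t, g \in unitmx -> t \in U -> act g t \in U.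

Definition irreducible (U : {vspace tens K n m}) : Prop :=
  [/\ submodule U, U <> 0%VS &
      forall W : {vspace tens K n m}, (W <= U)%VS -> submodule W ->
        W = 0%VS \/ W = U].

End Stable.

(* A highest weight vector, for the Borel subgroup of upper triangular
   matrices.                                                                  *)
Definition hw_vector (a : seq nat) m (v : tens K n m) : Prop :=
  v != 0 /\
  forall b : 'M[K]_n, b \in unitmx -> (forall i j : 'I_n, (j < i)%N -> b i j = 0) ->
    tens_act b v = (\prod_i b i i ^+ nth 0%N a i) *: v.

(* U is the irreducible module of highest weight a, realized in the tensor
   product over c of the exterior powers of V of degree a'_c.                 *)
Definition schur_module (a : seq nat) (U : {vspace tens K n (cols a)}) : Prop :=
  [/\ forall t, t \in U -> tens_homog t,
      irreducible (@tens_act K n (cols a)) U &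
      exists2 v, v \in U & hw_vector a v].

(* U' is isomorphic, as a G-module, to the dual of U: the map f provides a
   perfect G-invariant pairing of U' with U.                                  *)
Definition dual_modules m (U' U : {vspace tens K n m}) : Prop :=
  exists f : {linear tens K n m -> tens K n m},
    [/\ forall g phi t, g \in unitmx -> phi \in U' -> t \in U ->
          pairing (f (dual_act g phi)) (tens_act g t) = pairing (f phi) t,
        forall phi, phi \in U' ->
          (forall t, t \in U -> pairing (f phi) t = 0) -> phi = 0 &
        forall t, t \in U ->
          (forall phi, phi \in U' -> pairing (f phi) t = 0) -> t = 0].

Definition dual_schur_module (a : seq nat) (U' : {vspace tens K n (cols a)}) :
    Prop :=
  [/\ forall phi, phi \in U' -> tens_homog phi,
      irreducible (@dual_act K n (cols a)) U' &
      exists2 U : {vspace tens K n (cols a)},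
        schur_module U & dual_modules U' U].

End Modules.

(* Imported here since it shadows finset notions used above.                  *)
From mathcomp Require Import boolp classical_sets reals.
Local Open Scope classical_set_scope.

(** The flag variety *)

Section Flags.
Variables (K : fieldType) (n : nat) (a : seq nat).
Local Notation T := (tens K n (cols a)).

(* The nonzero vectors of the affine cone over the orbit of the class of a
   highest weight vector of SV, where SV is the Schur module of a.            *)
Definition flag_cone (SV : {vspace T}) : set T :=
  [set p | exists v g c, [/\ v \in SV, hw_vector a v, g \in unitmx, c != 0 &
                             p = c *: tens_act g v]].

Definition is_flag (W : 'I_(nblocks a) -> {vspace 'cV[K]_n}) : Prop :=
  (forall i, \dim (W i) = height i) /\
  (forall i j : 'I_(nblocks a), (i <= j)%N -> (W i <= W j)%VS).

(* The image in ext K n of the h-th exterior power of W.                      *)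
Definition ext_power (h : nat) (W : {vspace 'cV[K]_n}) : {vspace ext K n} :=
  (\sum_(t : h.-tuple 'I_(\dim W))
     <[wedge [seq (vbasis W)`_i | i : 'I_(\dim W) <- t]]>)%VS.

(* [p] is the image of the flag W under the product of the Pluecker embeddings
   followed by the embedding by O(d_1, ..., d_k).                             *)
Definition represents (p : T) (W : 'I_(nblocks a) -> {vspace 'cV[K]_n}) : Prop :=
  p != 0 /\
  exists2 x : 'I_(cols a) -> ext K n, p = pure_tens x &
    forall (c : 'I_(cols a)) i, col_height a c = height i ->
      x c \in ext_power (height i) (W i).

Definition coords (x : T) : 'I_#|{ffun 'I_(cols a) -> {set 'I_n}}| -> K :=
  fun i => x (enum_val i).

(* The Zariski tangent space at p of the affine cone over the flag variety.   *)
Definition tangent (SV : {vspace T}) (p : T) : set T :=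
  [set v | v \in SV /\
    forall f : {mpoly K[#|{ffun 'I_(cols a) -> {set 'I_n}}|]},
      (forall x, x = 0 \/ flag_cone SV x -> f.@[coords x] = 0) ->
      \sum_i (mderiv i f).@[coords p] * coords v i = 0].

Definition annihilator (SV' : {vspace T}) (Y : set T) : set T :=
  [set phi | phi \in SV' /\ forall v, Y v -> pairing phi v = 0].

End Flags.

(** The multigraded coordinate ring of the product of the P(/\^(n_i) V) *)

Section Ideals.
Variable B : comNzRingType.

Definition ideal_gen (Y : set B) : set B :=
  [set f | exists2 s : seq (B * B),
             (forall x, x \in s -> Y x.2) & f = \sum_(x <- s) x.1 * x.2].

Definition ideal_square (J : set B) : set B :=
  ideal_gen [set f | exists x y, [/\ J x, J y & f = x * y]].

End Ideals.

Section CoordinateRing.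
Variables (K : fieldType) (n : nat) (a : seq nat).

(* The variable (i, S) is the linear form e_S^* in the i-th factor.           *)
Definition plucker_var :=
  {x : 'I_(nblocks a) * {set 'I_n} | #|x.2| == height x.1}.

Definition coord_ring := {mpoly K[#|{: plucker_var}|]}.

Definition lin_form (i : 'I_(nblocks a)) (l : ext K n) : coord_ring :=
  \sum_(x : plucker_var | (val x).1 == i) l (val x).2 *: 'X_(enum_rank x).

Definition ring_act (g : 'M[K]_n) (f : coord_ring) : coord_ring :=
  comp_mpoly
    [tuple (let x := val (enum_val j) in
            lin_form x.1 (ext_act_basis (invmx g)^T x.2))
     | j < #|{: plucker_var}|] f.

Definition multidegree : set coord_ring :=
  [set f | forall w, w \in msupp f -> forall i,
     (\sum_(x : plucker_var | (val x).1 == i) w (enum_rank x))%N = mult i].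

Definition point_ideal (W : 'I_(nblocks a) -> {vspace 'cV[K]_n}) :
    set coord_ring :=
  ideal_gen [set f | exists i (l : ext K n),
    [/\ forall S, l S != 0 -> #|S| = height i,
        forall w, w \in ext_power (height i) (W i) -> \sum_S l S * w S = 0 &
        f = lin_form i l]].

Definition double_point_ideal (W : 'I_(nblocks a) -> {vspace 'cV[K]_n}) :
    set coord_ring :=
  ideal_square (point_ideal W).

Definition cartan_projection (SV' : {vspace tens K n (cols a)})
    (pi : coord_ring -> tens K n (cols a)) : Prop :=
  [/\ exists2 f, multidegree f & pi f != 0,
      pi @` multidegree = [set phi | phi \in SV'] &
      forall g f, g \in unitmx -> multidegree f ->
        pi (ring_act g f) = dual_act g (pi f)].

End CoordinateRing.

Arguments multidegree K n a : clear implicits.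

(** Schur apolarity *)

Section SchurApolarity.
Variables (K : fieldType) (n : nat).

Definition tens_family := forall a : part n, tens K n (cols a).

(* The family SV' consists of the modules S_a V^*.                            *)
Variable SV' : forall a : part n, {vspace tens K n (cols a)}.

Definition schur_sum : set tens_family :=
  [set phi | (forall a, phi a \in SV' a) /\
             exists s : seq (part n), forall a, a \notin s -> phi a = 0].

Definition graded_part (Y : set tens_family) (a : part n) :
    set (tens K n (cols a)) :=
  [set x | x \in SV' a /\ Y (dfwith (fun b : part n => 0) x)].

(* The component of phi * t indexed by b.                                     *)
Definition schur_star (phi : tens_family) (a : part n) (t : tens K n (cols a))
    (b : part n) : tens K n (cols a) :=
  if part_incl b a then contract (phi b) t else 0.

Definition schur_square (a : part n) (p : tens K n (cols a)) : set tens_family :=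
  [set phi | [/\ schur_sum phi,
                 forall b, schur_star phi p b = 0 &
                 forall (xi : 'M[K]_n) b,
                   schur_star (fun c => gl_dual_act xi (phi c)) p b = 0]].

End SchurApolarity.

Arguments graded_part {K n} SV' Y a.

(* Main.v *)
Require Import Defs.
From HB Require Import structures.
From mathcomp Require Import all_boot all_order all_algebra.
From mathcomp Require Import fingroup perm.
From mathcomp Require Import ring zify.
From mathcomp Require Import complex mpoly.
From mathcomp Require Import boolp.
Set Implicit Arguments.
Unset Strict Implicit.
Unset Printing Implicit Defensive.
Import GRing.Theory Num.Theory.
Local Open Scope ring_scope.

(* The module S_lambda V is spanned by the orbit of the tensor e of the initial
   segments e_0 /\ ... /\ e_(h_c - 1), one for each column c, and S_lambda V^*
   has the same coordinates as S_lambda V.  Weights identify the Cartan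
   projection: the image q_F of the Pluecker monomial of the column sets F pairs
   with v in S_lambda V as the coordinate v_F, up to one nonzero constant.

   On the orbit of e, Pluecker's exchange relations hold between any two
   columns, taken in one or in two copies of a tensor.  Linearized at e, the
   relations between two copies show that a Zariski tangent vector is a
   combination of the vectors E_ab e, which gives the equality.  The relations
   between two columns of one copy hold for the q_F.  At P = [e], q_F comes from
   the square of the ideal as soon as F differs from e in two columns; if the
   variety is consistent, the relations reduce the other q_F to these and to
   one q_F for each (a, b), on which the forms killing the E_ab e vanish.

   If consistency fails for the column of height h, a permutation of the basis
   moves two elements of [0, h) and stabilizes the other initial segments; it
   turns e into a vector killed by the image of the squared ideal, but not by
   the annihilator of the tangent space. *)

(** * Exterior algebra *)

(** Everything is read on one subspace. The dual action of g is the action of (g^-1)^T, so the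
    copies of S_lambda V^* and S_lambda V inside the same coordinate space are stable under the same
    matrices; both contain e, hence they coincide, and the coordinate pairing is nondegenerate
    there. Weights are separated by the diagonal matrices with a single entry 2, because the powers
    of 2 are distinct.

    Derivatives are taken algebraically: a curve is a tensor over K[t], its velocity is the
    coefficient of t, and a linear condition that holds for almost all values of t passes to all
    coefficients. Forms in the square of the ideal become divisible by t^2 along every curve of
    X_lambda through P; this gives the inclusion, and also the obstruction in the inconsistent case.

    Consistency enters through nesting. For a height h of multiplicity one, it says that a set S of
    size h with two elements outside [0, h) cannot both contain the previous segment and lie in the
    next one. Where nesting fails, an exchange relation with that neighbour spoils a second
    column. *)

Section FunctionSpace.
Variables (A : comNzRingType) (I : finType).
Implicit Types (x y : {ffun I -> A^o}).

Lemma ffD x y i : (x + y) i = x i + y i :> A. Proof. by rewrite ffunE. Qed.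
Lemma ffN x i : (- x) i = - x i :> A. Proof. by rewrite ffunE. Qed.
Lemma ffZ (a : A) x i : (a *: x) i = a * x i :> A. Proof. by rewrite ffunE. Qed.
Lemma ff0 i : (0 : {ffun I -> A^o}) i = 0 :> A. Proof. by rewrite ffunE. Qed.
Lemma ffsum (J : Type) (r : seq J) (P : pred J) (F : J -> {ffun I -> A^o}) i :
  (\sum_(j <- r | P j) F j) i = \sum_(j <- r | P j) (F j i : A) :> A.
Proof. by rewrite sum_ffunE. Qed.

Definition ffE := (ffD, ffN, ffZ, ff0).

End FunctionSpace.

Section ExteriorAlgebra.
Variables (A : comNzRingType) (n : nat).
Implicit Types (S T U : {set 'I_n}) (x y : ext A n) (g : 'M[A]_n)
  (u v w : 'cV[A]_n) (i j k : 'I_n).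

(** For j outside T, e_j /\ e_T is this sign times the basis vector of T with j added. *)
Definition psign j T : A := (-1) ^+ #|[set t in T | (t < j)%N]|.

Lemma psign_sqr j T : psign j T * psign j T = 1.
Proof. by rewrite /psign -exprD addnn -mul2n exprM sqrrN expr1n expr1n. Qed.

Lemma psignU j k T : k \notin T -> psign j (k |: T) = (-1) ^+ (k < j)%N * psign j T.
Proof.
move=> kT; rewrite /psign -exprD; congr (_ ^+ _).
have [kj|jk] := ltnP k j.
  rewrite (_ : [set t in k |: T | (t < j)%N] = k |: [set t in T | (t < j)%N]).
    by rewrite cardsU1 !inE (negbTE kT).
  by apply/setP => t; rewrite !inE; case: (t =P k) => [->|].
apply: eq_card => t; rewrite !inE; case: (t =P k) => [->|]//=.
by rewrite ltnNge jk (negbTE kT).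
Qed.

Lemma psign_anti j k T : j != k -> j \notin T -> k \notin T ->
  psign j (k |: T) * psign k T = - (psign k (j |: T) * psign j T).
Proof.
move=> jk jT kT; rewrite !psignU //.
have : val j != val k by [].
by rewrite neq_ltn => /orP[] lt; rewrite lt ltnNge (ltnW lt) /= expr0 expr1; ring.
Qed.

Definition lmul v : ext A n -> ext A n := ext_mul (ext_vec v).

Lemma lmulE v x U :
  lmul v x U = \sum_(j in U) psign j (U :\ j) * v j 0 * x (U :\ j).
Proof.
rewrite /lmul /ext_mul ffunE.
under eq_bigr => S SU do rewrite ffunE mulr_sumr mulr_suml.
rewrite (exchange_big_dep predT) //= [RHS]big_mkcond /=.
apply: eq_bigr => j _; case: ifP => jU; last first.
  apply: big_pred0 => S; apply/negP => /andP[SU /eqP eS].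
  by move: SU; rewrite eS sub1set jU.
rewrite (big_pred1 [set j]) => [|S]; last first.
  apply/andP/eqP => [[_ /eqP]//|->]; by rewrite eqxx sub1set jU.
congr (_ * _ * _); rewrite /ext_sign /psign; congr (_ ^+ _).
rewrite -[RHS](card_imset _ (_ : injective (pair j))) => [|? ? []//].
apply: eq_card => -[s t]; rewrite !inE /=.
apply/and3P/imsetP => [[/eqP -> /andP[tj tU] lt]|[t' ]].
  by exists t => //; rewrite !inE tj tU.
by rewrite !inE => /andP[/andP[tj tU] lt] [-> ->]; rewrite tj.
Qed.

(** Contraction by the covector with coordinates [v], normalized as the transpose of [lmul v]; hence
    the same signs. *)
Definition contr v x : ext A n :=
  [ffun U : {set 'I_n} => \sum_(j | j \notin U) psign j U * v j 0 * x (j |: U)].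

Lemma contrE v x U :
  contr v x U = \sum_(j | j \notin U) psign j U * v j 0 * x (j |: U).
Proof. by rewrite ffunE. Qed.

Lemma sum_setU1 (M : nmodType) (f : 'I_n -> {set 'I_n} -> {set 'I_n} -> M) :
  \sum_(U : {set 'I_n}) \sum_(j in U) f j (U :\ j) U =
  \sum_(U : {set 'I_n}) \sum_(j | j \notin U) f j U (j |: U).
Proof.
rewrite (exchange_big_dep predT) //= [RHS](exchange_big_dep predT) //=.
apply: eq_bigr => j _.
rewrite (reindex_onto (fun S => j |: S) (fun U => U :\ j)) /=; last first.
  by move=> U jU; rewrite setD1K.
apply: eq_big => [S|S /andP[_ /eqP ->] //].
rewrite setU11 /=; apply/eqP/idP => [<-|jS]; first by rewrite !inE eqxx.
by rewrite setU1K.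
Qed.

Lemma lmul_adjoint v x y :
  \sum_U (x U : A) * lmul v y U = \sum_U (contr v x U : A) * y U.
Proof.
under eq_bigr => U _ do rewrite lmulE mulr_sumr.
under [RHS]eq_bigr => U _ do rewrite contrE mulr_suml.
rewrite (sum_setU1 (fun j V U => (x U : A) * (psign j V * v j 0 * y V))).
by apply: eq_bigr => U _; apply: eq_bigr => j _; ring.
Qed.

Lemma lmul_lin_r v (a : A) x y : lmul v (a *: x + y) = a *: lmul v x + lmul v y.
Proof.
apply/ffunP => U; rewrite !ffE !lmulE mulr_sumr -big_split /=; apply: eq_bigr => j _.
by rewrite !ffE; ring.
Qed.

HB.instance Definition _ v := GRing.isLinear.Build A (ext A n) (ext A n) _ (lmul v)
  (fun a => lmul_lin_r v a).

Lemma contr_lin_r v (a : A) x y : contr v (a *: x + y) = a *: contr v x + contr v y.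
Proof.
apply/ffunP => U; rewrite !ffE !contrE mulr_sumr -big_split /=; apply: eq_bigr => j _.
by rewrite !ffE; ring.
Qed.

HB.instance Definition _ v := GRing.isLinear.Build A (ext A n) (ext A n) _ (contr v)
  (fun a => contr_lin_r v a).

Lemma lmul_sum_l v x : lmul v x = \sum_j v j 0 *: lmul (delta_mx j 0) x.
Proof.
apply/ffunP => U; rewrite lmulE ffsum big_mkcond /=; apply: eq_bigr => j _.
rewrite ffZ lmulE; case: ifP => jU.
  rewrite (bigD1 j) //= big1 => [|k /andP[_ /negbTE kj]]; rewrite !mxE ?eqxx ?kj /=.
    by ring.
  by ring.
rewrite big1 ?mulr0 // => k kU; rewrite mxE.
by case: eqP kU jU => [->->|]//=; rewrite mulr0 mul0r.
Qed.

Lemma lmul_lin_l u v (a : A) x : lmul (a *: u + v) x = a *: lmul u x + lmul v x.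
Proof.
apply/ffunP => U; rewrite !ffE !lmulE mulr_sumr -big_split /=.
by apply: eq_bigr => j _; rewrite !mxE; ring.
Qed.

(* Expanding on the ordered pairs (j, k), the terms of (j, k) and (k, j) cancel. *)
Lemma lmul_lmul0 v x : lmul v (lmul v x) = 0.
Proof.
apply/ffunP => U; rewrite ff0 lmulE.
pose F j k := if [&& j \in U, k \in U & j != k] then
  psign j (U :\ j) * v j 0 * (psign k (U :\ j :\ k) * v k 0 * x (U :\ j :\ k)) else 0.
have -> : \sum_(j in U) psign j (U :\ j) * v j 0 * lmul v x (U :\ j) =
    \sum_j \sum_k F j k.
  rewrite big_mkcond; apply: eq_bigr => j _; case: ifP => jU; last first.
    by rewrite big1 // => k _; rewrite /F jU.
  rewrite lmulE mulr_sumr big_mkcond; apply: eq_bigr => k _.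
  by rewrite /F jU !inE /= andbC [j == k]eq_sym.
have anti j k : F j k = - F k j.
  rewrite /F eq_sym; case: (boolP (j \in U)) => jU //=; last by rewrite andbF oppr0.
  case: (boolP (k \in U)) => kU /=; last by rewrite oppr0.
  case: (boolP (k == j)) => kj /=; first by rewrite oppr0.
  have eT : U :\ k :\ j = U :\ j :\ k by rewrite !setDDl setUC.
  have jT : j \notin U :\ j :\ k by rewrite !inE eqxx andbF.
  have kT : k \notin U :\ j :\ k by rewrite !inE eqxx.
  have e1 : U :\ j = k |: (U :\ j :\ k) by rewrite setD1K // !inE kj.
  have e2 : U :\ k = j |: (U :\ j :\ k) by rewrite -eT setD1K // !inE eq_sym kj.
  have := @psign_anti j k (U :\ j :\ k); rewrite -e1 -e2 eT eq_sym => /(_ kj jT kT) E.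
  transitivity (psign j (U :\ j) * psign k (U :\ j :\ k) *
     (v j 0 * v k 0 * x (U :\ j :\ k))); first by ring.
  by rewrite E; ring.
have F0 j : F j j = 0 by rewrite /F eqxx /= !andbF.
under eq_bigr => j _ do rewrite (bigID (fun k : 'I_n => (j < k)%N)) /=.
rewrite big_split /= [X in _ + X](exchange_big_dep predT) //= -big_split big1 // => j _ /=.
rewrite [X in _ + X](bigD1 j) ?ltnn //= F0 add0r.
rewrite [X in _ + X](eq_bigl (fun k : 'I_n => (j < k)%N)); last first.
  by move=> k; rewrite -leqNgt [in RHS]ltn_neqAle andbC eq_sym.
by rewrite -big_split big1 // => k _ /=; rewrite [F k j]anti subrr.
Qed.

Lemma lmul_anti u v x : lmul u (lmul v x) = - lmul v (lmul u x).
Proof.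
have := lmul_lmul0 (1 *: u + v) x; rewrite !lmul_lin_l !scale1r !linearD /= !lmul_lmul0.
by rewrite add0r addr0 => /eqP; rewrite addr_eq0 => /eqP.
Qed.

(** The Clifford relation. The terms where the added and the removed index agree give the scalar
    product; the others, collected in [d], occur with opposite signs on the two sides. *)
Lemma contr_lmul w u x :
  contr w (lmul u x) = (\sum_j w j 0 * u j 0) *: x - lmul u (contr w x).
Proof.
apply/ffunP => U; rewrite contrE ffD ffZ ffN lmulE.
pose d := \sum_(j | j \notin U) \sum_(k in U)
   psign k (U :\ k) * psign j (U :\ k) * (w j 0 * u k 0 * x (j |: U :\ k)).
have -> : \sum_(j | j \notin U) psign j U * w j 0 * lmul u x (j |: U) =
   (\sum_(j | j \notin U) w j 0 * u j 0) * x U - d.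
  rewrite mulr_suml -sumrB; apply: eq_bigr => j jU; rewrite lmulE.
  rewrite (big_setU1 _ jU) /= setU1K // mulrDr; congr (_ + _).
    transitivity (psign j U * psign j U * (w j 0 * u j 0 * x U)); first by ring.
    by rewrite psign_sqr mul1r.
  rewrite mulr_sumr -sumrN; apply: eq_bigr => k kU.
  have kj : k != j by apply: contraNneq jU => <-.
  have -> : (j |: U) :\ k = j |: (U :\ k).
    by apply/setP => i; rewrite !inE; case: (i =P j) => [->|]//=; rewrite 1?eq_sym ?kj ?andbT.
  rewrite psignU ?inE ?(negbTE jU) ?andbF //.
  rewrite -[in psign j U](setD1K kU) psignU ?inE ?eqxx //.
  have : val j != val k by rewrite eq_sym.
  by rewrite neq_ltn => /orP[] lt; rewrite lt ltnNge (ltnW lt) /= expr0 expr1; ring.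
have -> : \sum_(k in U) psign k (U :\ k) * u k 0 * contr w x (U :\ k) =
   (\sum_(j in U) w j 0 * u j 0) * x U + d.
  rewrite /d exchange_big /= mulr_suml -big_split; apply: eq_bigr => k kU /=.
  rewrite contrE (bigD1 k) ?inE ?eqxx //= setD1K // mulrDr; congr (_ + _).
    transitivity (psign k (U :\ k) * psign k (U :\ k) * (w k 0 * u k 0 * x U)); first by ring.
    by rewrite psign_sqr mul1r.
  rewrite mulr_sumr; apply: eq_big => [j|j _]; last by ring.
  by rewrite !inE negb_and negbK; case: (j =P k) => [->|]//=; rewrite ?kU ?andbT ?andbF.
rewrite [\sum_j _ * _](bigID (fun j => j \in U)) /=; ring.
Qed.

Definition wdg m (b : 'I_m -> 'cV[A]_n) (s : seq 'I_m) := wedge (map b s).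

Lemma wdg_cons m (b : 'I_m -> 'cV[A]_n) (i : 'I_m) s : wdg b (i :: s) = lmul (b i) (wdg b s).
Proof. by []. Qed.

(** Insertion sort: by [lmul_anti], passing each smaller index costs one sign. *)
Lemma wdg_sorted_insert m (b : 'I_m -> 'cV[A]_n) (s : seq 'I_m) (j : 'I_m) :
  sorted ltn (map val s) -> j \notin s ->
  exists t, [/\ sorted ltn (map val t), t =i j :: s &
    lmul (b j) (wdg b s) = (-1) ^+ count (fun i : 'I_m => i < j)%N s *: wdg b t].
Proof.
elim: s => [|i s IH] st js; first by exists [:: j]; rewrite scale1r.
have [ltji|leij] := ltnP j i.
  exists [:: j, i & s]; split=> //; first by rewrite /= ltji.
  rewrite (_ : count _ _ = 0%N) ?scale1r //.
  apply/eqP; rewrite -leqn0 leqNgt -has_count -all_predC.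
  apply/allP => k ks /=; rewrite -leqNgt.
  suff : (i <= k)%N by apply: leq_trans; apply: ltnW.
  move: ks; rewrite inE => /orP[/eqP->//|ks].
  move: st; rewrite /= path_sortedE; last exact: ltn_trans.
  by move=> /andP[/allP/(_ (val k)) lt _]; apply/ltnW/lt/map_f.
have ltij : (i < j)%N.
  by rewrite ltn_neqAle leij andbT; apply: contraNneq js => /val_inj->; rewrite mem_head.
have [||t [st' et e]] := IH; first by move: st => /= /path_sorted.
  by apply: contra js; rewrite inE orbC => ->.
exists (i :: t); split.
- rewrite /= path_sortedE ?st' ?andbT; last exact: ltn_trans.
  apply/allP => _ /mapP[k kt ->]; move: kt; rewrite et inE => /orP[/eqP->//|ks].
  move: st; rewrite /= path_sortedE; last exact: ltn_trans.
  by move=> /andP[/allP/(_ (val k)) lt _]; apply/lt/map_f.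
- by move=> k; rewrite !inE et inE orbCA.
- by rewrite !wdg_cons lmul_anti e linearZ /= ltij exprS -scalerA scaleN1r.
Qed.

Lemma sorted_enum m (S : {set 'I_m}) : sorted ltn (map val (enum S)).
Proof.
have -> : enum S = filter (mem S) (enum 'I_m) by rewrite enumT.
apply: (subseq_sorted ltn_trans (map_subseq _ (filter_subseq _ _))).
by rewrite val_enum_ord iota_ltn_sorted.
Qed.

Lemma wdg_setU1 m (b : 'I_m -> 'cV[A]_n) (S : {set 'I_m}) (j : 'I_m) : j \notin S ->
  lmul (b j) (wdg b (enum S)) =
  (-1) ^+ #|[set i in S | (i < j)%N]| *: wdg b (enum (j |: S)).
Proof.
move=> jS; have [|t [st et ->]] := wdg_sorted_insert b (sorted_enum S) (_ : j \notin enum S).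
  by rewrite mem_enum.
congr (_ *: wdg b _).
  congr (_ ^+ _); rewrite cardE -size_filter.
  apply/perm_size/uniq_perm => [||i]; [exact/filter_uniq/enum_uniq|exact: enum_uniq|].
  by rewrite mem_filter !mem_enum !inE andbC.
apply: (inj_map val_inj); apply: (irr_sorted_eq ltn_trans ltnn st (sorted_enum _)).
move=> i; apply/mapP/mapP => -[k kt ->]; exists k => //; move: kt;
  by rewrite mem_enum !inE et inE mem_enum.
Qed.

Lemma wdg_mem m (b : 'I_m -> 'cV[A]_n) (S : {set 'I_m}) (j : 'I_m) : j \in S ->
  lmul (b j) (wdg b (enum S)) = 0.
Proof.
move=> jS; have jD : j \notin S :\ j by rewrite !inE eqxx.
have := wdg_setU1 b jD; rewrite setD1K // => /(congr1 (lmul (b j))).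
rewrite lmul_lmul0 linearZ /= => /(congr1 (GRing.scale ((-1) ^+ #|[set i in S :\ j | (i < j)%N]|))).
by rewrite scaler0 scalerA -exprD addnn -mul2n exprM sqrrN expr1n expr1n scale1r.
Qed.

(** A repeated index makes the product vanish, which is recorded as c = 0; the cardinality is
    therefore claimed only for nonzero c. *)
Lemma wdg_any m (b : 'I_m -> 'cV[A]_n) (s : seq 'I_m) :
  exists (S : {set 'I_m}) (c : A), wdg b s = c *: wdg b (enum S) /\ (c != 0 -> #|S| = size s).
Proof.
elim: s => [|j s [S [c [e h]]]].
  exists set0, 1; rewrite scale1r; split; last by rewrite cards0.
  by rewrite (_ : enum set0 = [::]) // -(enum0 'I_m); apply: eq_enum => i; rewrite inE.
rewrite wdg_cons e linearZ /=; have [jS|jS] := boolP (j \in S).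
  by exists set0, 0; rewrite wdg_mem // scaler0 scale0r eqxx.
exists (j |: S), (c * (-1) ^+ #|[set i in S | (i < j)%N]|); rewrite wdg_setU1 // scalerA.
split=> // nz; rewrite cardsU1 jS h //.
by apply: contraNneq nz => ->; rewrite mul0r.
Qed.

Lemma ext_act_basis_setU1 g S j : j \notin S ->
  lmul (col j g) (ext_act_basis g S) = psign j S *: ext_act_basis g (j |: S).
Proof. exact: (wdg_setU1 (fun i => col i g)). Qed.

Lemma ext_act_basis_mem g S j : j \in S -> lmul (col j g) (ext_act_basis g S) = 0.
Proof. exact: (wdg_mem (fun i => col i g)). Qed.

Lemma ext_act_basis0 g : ext_act_basis g set0 = ext_one A n.
Proof.
by rewrite /ext_act_basis (_ : enum set0 = [::]) // -(enum0 'I_n); apply: eq_enum => i; rewrite inE.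
Qed.

Definition ext_act g x : ext A n := \sum_S x S *: ext_act_basis g S.

Lemma ext_act_lin g (a : A) x y : ext_act g (a *: x + y) = a *: ext_act g x + ext_act g y.
Proof.
rewrite /ext_act scaler_sumr -big_split; apply: eq_bigr => S _ /=.
by rewrite ffD ffZ scalerDl scalerA.
Qed.

HB.instance Definition _ g := GRing.isLinear.Build A (ext A n) (ext A n) _ (ext_act g)
  (fun a => ext_act_lin g a).

Definition ebas S : ext A n := [ffun T => (T == S)%:R].

Lemma ebasE x : x = \sum_S x S *: ebas S.
Proof.
apply/ffunP => T; rewrite sum_ffunE (bigD1 T) //= big1 => [|S ST]; rewrite !ffunE ?eqxx.
  by rewrite addr0 /GRing.scale /= mulr1.
by rewrite eq_sym (negbTE ST) scaler0.
Qed.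

Lemma ext_act_ebas g S : ext_act g (ebas S) = ext_act_basis g S.
Proof.
rewrite /ext_act (bigD1 S) //= big1 => [|T /negbTE TS]; rewrite ffunE ?eqxx ?TS.
  by rewrite scale1r addr0.
by rewrite scale0r.
Qed.

(** The action is multiplicative. When g v is expanded on the columns of g, a column already used in
    the image of e_S contributes zero, just as e_j /\ e_S does. *)
Lemma ext_act_lmul g v x : ext_act g (lmul v x) = lmul (g *m v) (ext_act g x).
Proof.
rewrite /ext_act.
under eq_bigr => U _ do rewrite lmulE scaler_suml.
rewrite (sum_setU1 (fun j V U => (psign j V * v j 0 * x V) *: ext_act_basis g U)).
rewrite linear_sum; apply: eq_bigr => S _ /=; rewrite linearZ /=.
have -> : lmul (g *m v) (ext_act_basis g S) =
    \sum_j v j 0 *: lmul (col j g) (ext_act_basis g S).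
  apply/ffunP => U; rewrite lmulE ffsum.
  under [RHS]eq_bigr => j _ do rewrite ffZ lmulE mulr_sumr.
  rewrite exchange_big /=; apply: eq_bigr => k _; rewrite mxE mulr_sumr mulr_suml.
  by apply: eq_bigr => j _; rewrite mxE; ring.
rewrite [in RHS](bigID (fun j => j \in S)) /= [X in _ = _ *: (X + _)]big1 ?add0r => [|j jS]; last first.
  by rewrite ext_act_basis_mem ?scaler0.
rewrite scaler_sumr; apply: eq_bigr => j jS.
by rewrite ext_act_basis_setU1 // !scalerA; congr (_ *: _); ring.
Qed.

Lemma ext_act_one g : ext_act g (ext_one A n) = ext_one A n.
Proof.
rewrite -{2}(ext_act_basis0 g) -ext_act_ebas; congr ext_act.
Qed.

Lemma ext_act_wedge g s : ext_act g (wedge s) = wedge [seq g *m v | v <- s].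
Proof.
elim: s => [|v s IH]; first exact: ext_act_one.
by rewrite [LHS]ext_act_lmul IH.
Qed.

Lemma ext_act_basisM g h S : ext_act_basis (g *m h) S = ext_act g (ext_act_basis h S).
Proof.
rewrite ext_act_wedge /ext_act_basis -map_comp; congr wedge; apply: eq_map => j /=.
by rewrite !colE mulmxA.
Qed.

Lemma lmul_delta_ebas j S : j \notin S -> lmul (delta_mx j 0) (ebas S) = psign j S *: ebas (j |: S).
Proof.
move=> jS; apply/ffunP => U; rewrite lmulE ffZ ffunE.
have [->|UjS] := eqVneq U (j |: S).
  rewrite (bigD1 j) ?setU11 //= big1 => [|k /andP[_ kj]]; rewrite mxE ?eqxx ?(negbTE kj) /=.
    by rewrite setU1K // ffunE eqxx addr0 mulr1.
  by rewrite mulr0 mul0r.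
rewrite mulr0 big1 // => k kU; rewrite mxE ffunE; case: (k =P j) => [ekj|]; last by rewrite mulr0 mul0r.
have [eUS|] := eqVneq (U :\ k) S; last by rewrite mulr0.
by move: UjS; rewrite -eUS -ekj setD1K ?eqxx.
Qed.

(* Every [e_S] is a product of vectors, up to sign. *)
Lemma ext_ind (P : ext A n -> Prop) :
  (forall (a : A) x y, P x -> P y -> P (a *: x + y)) -> P 0 -> P (ext_one A n) ->
  (forall j x, P x -> P (lmul (delta_mx j 0) x)) -> forall x, P x.
Proof.
move=> Plin P0 P1 Pl x; rewrite [x]ebasE.
have Pe S : P (ebas S).
  have [k] := ubnP #|S|; elim: k S => // k IH S ltSk; have [->|/set0Pn[j jS]] := eqVneq S set0.
    by rewrite (_ : ebas _ = ext_one A n) //; apply/ffunP => U; rewrite !ffunE.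
  have jD : j \notin S :\ j by rewrite !inE eqxx.
  rewrite -(setD1K jS) -[ebas _]scale1r -(psign_sqr j (S :\ j)) -scalerA -lmul_delta_ebas //.
  rewrite -[_ *: _]addr0; apply: Plin P0; apply: Pl; apply: IH.
  by move: ltSk; rewrite (cardsD1 j S) jS.
elim/big_rec: _ => // S y _ Py; exact: Plin.
Qed.

Lemma ext_act1 x : ext_act 1%:M x = x.
Proof.
elim/ext_ind: x => [a x y ex ey|||j x ex]; first by rewrite ext_act_lin ex ey.
- by rewrite linear0.
- exact: ext_act_one.
- by rewrite ext_act_lmul mul1mx ex.
Qed.

Lemma contr_one v : contr v (ext_one A n) = 0.
Proof.
apply/ffunP => U; rewrite contrE ff0 big1 // => j _; rewrite ffunE.
by rewrite -subset0 subUset sub1set inE mulr0.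
Qed.

(** Induction on products of vectors through the Clifford relation: the scalar products agree, since
    v paired with g e_j is g^T v paired with e_j. *)
Lemma contr_ext_act v g x : contr v (ext_act g x) = ext_act g (contr (g^T *m v) x).
Proof.
elim/ext_ind: x => [a x y ex ey|||j x ex]; first by rewrite !linearP /= ex ey.
- by rewrite !linear0.
- by rewrite ext_act_one !contr_one linear0.
- rewrite ext_act_lmul !contr_lmul ex linearB /= linearZ /= -ext_act_lmul; congr (_ *: _ - _).
  rewrite [RHS](bigD1 j) //= [X in _ = _ + X]big1 ?addr0 => [|k /negbTE kj]; last first.
    by rewrite [X in _ * X]mxE kj mulr0.
  rewrite [X in _ = _ * X]mxE eqxx mulr1 mxE.
  by apply: eq_bigr => k _; rewrite -colE !mxE mulrC.
Qed.

Definition epair x y : A := \sum_S (x S : A) * y S.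

Lemma epairC x y : epair x y = epair y x.
Proof. by apply: eq_bigr => S _; rewrite mulrC. Qed.

Lemma epair_ebas x S : epair x (ebas S) = x S.
Proof.
rewrite /epair (bigD1 S) //= big1 => [|T /negbTE TS]; rewrite ffunE ?eqxx ?TS ?mulr0 //.
by rewrite mulr1 addr0.
Qed.

Lemma epair_lin_r x (a : A) y z : epair x (a *: y + z) = a * epair x y + epair x z.
Proof.
rewrite /epair mulr_sumr -big_split; apply: eq_bigr => S _ /=; rewrite !ffE.
ring.
Qed.

Lemma epair_lin_l x (a : A) y z : epair (a *: y + z) x = a * epair y x + epair z x.
Proof. by rewrite ![epair _ x]epairC epair_lin_r. Qed.

Lemma epair_act g x y : epair x (ext_act g y) = epair (ext_act g^T x) y.
Proof.
elim/ext_ind: y x => [a y z ey ez|||j y ey] x.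
- by rewrite linearP /= !epair_lin_r ey ez.
- by rewrite linear0 /epair !big1 // => S _; rewrite ff0 mulr0.
- rewrite ext_act_one; elim/ext_ind: x => [a x y ex ey|||j x ex].
  + by rewrite linearP /= !epair_lin_l ex ey.
  + by rewrite linear0.
  + by rewrite ext_act_one.
  + rewrite ext_act_lmul ![epair (lmul _ _) _]epairC /epair !lmul_adjoint !contr_one.
    by rewrite !big1 // => S _; rewrite ff0 mul0r.
- rewrite ext_act_lmul /epair !lmul_adjoint.
  have := ey (contr (g *m delta_mx j 0) x); rewrite /epair => ->.
  by rewrite contr_ext_act trmxK.
Qed.

(** The coefficients are the minors of g with rows T and columns S. No determinant is expanded: the
    adjunction [epair_act] gives the symmetry. *)
Lemma ext_act_basis_tr g S T : ext_act_basis g^T S T = ext_act_basis g T S.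
Proof. by rewrite -!ext_act_ebas -!epair_ebas -epair_act epairC. Qed.

Lemma ext_act_basis_homog g S T : ext_act_basis g S T != 0 -> #|T| = #|S|.
Proof.
rewrite [#|S|]cardE /ext_act_basis; elim: (enum S) T => [|j s IH] T /=.
  by rewrite ffunE; have [->|_] := eqVneq T set0; rewrite ?cards0 ?eqxx.
rewrite -/(lmul _ _) lmulE => nz.
have /existsP[k /andP[kT nzk]] : [exists k in T, wedge [seq col i g | i <- s] (T :\ k) != 0].
  apply/negbNE; apply: contra nz => /existsPn h; rewrite big1 // => k kT.
  by move: (h k); rewrite kT negbK => /eqP->; rewrite mulr0.
by rewrite (cardsD1 k) kT (IH _ nzk).
Qed.

(* The bilinear (Pluecker) relations, from the invariance of
   [\sum_j contr e_j (x) lmul e_j]. *)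
Lemma plucker_equivariant g x y A0 B0 :
  \sum_j (contr (delta_mx j 0) (ext_act g x) A0 : A) * lmul (delta_mx j 0) (ext_act g y) B0 =
  \sum_S \sum_T (ext_act_basis g S A0 : A) * ext_act_basis g T B0 *
     \sum_j (contr (delta_mx j 0) x S : A) * lmul (delta_mx j 0) y T.
Proof.
have actE z U : ext_act g z U = \sum_S (ext_act_basis g S U : A) * z S.
  by rewrite /ext_act ffsum; apply: eq_bigr => S _; rewrite ffZ mulrC.
transitivity (\sum_k (ext_act g (contr (delta_mx k 0) x) A0 : A) * ext_act g (lmul (delta_mx k 0) y) B0).
  under [RHS]eq_bigr => k _ do
    rewrite ext_act_lmul (lmul_sum_l (g *m delta_mx k 0)) [X in _ * X]ffsum mulr_sumr.
  rewrite exchange_big; apply: eq_bigr => j _ /=; rewrite contr_ext_act.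
  have -> : contr (g^T *m delta_mx j 0) x = \sum_k g j k *: contr (delta_mx k 0) x.
    apply/ffunP => U; rewrite contrE ffsum.
    under [RHS]eq_bigr => k _ do rewrite ffZ contrE mulr_sumr.
    rewrite exchange_big; apply: eq_bigr => i _ /=.
    rewrite (bigD1 i) //= [X in _ + X]big1 ?addr0 => [|k ki].
      by rewrite -colE !mxE !eqxx /=; ring.
    by rewrite mxE [i == k]eq_sym (negbTE ki) /=; ring.
  rewrite linear_sum ffsum mulr_suml; apply: eq_bigr => k _ /=.
  by rewrite linearZ /= !ffZ -colE mxE; ring.
under eq_bigr => k _ do rewrite !actE mulr_suml.
rewrite exchange_big; apply: eq_bigr => S _ /=.
under eq_bigr => k _ do rewrite mulr_sumr.
rewrite exchange_big; apply: eq_bigr => T _ /=; rewrite mulr_sumr.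
by apply: eq_bigr => k _; ring.
Qed.

Lemma contr_deltaE j x U :
  contr (delta_mx j 0) x U = if j \in U then 0 else psign j U * x (j |: U).
Proof.
rewrite contrE; case: ifP => jU.
  by rewrite big1 // => k; rewrite mxE; case: eqP => [->|_ _]; rewrite ?jU // mulr0 mul0r.
rewrite (bigD1 j) ?jU //= big1 => [|k /andP[_ /negbTE kj]]; rewrite mxE ?eqxx ?kj.
  by rewrite addr0 mulr1.
by rewrite mulr0 mul0r.
Qed.

Lemma lmul_deltaE j x U :
  lmul (delta_mx j 0) x U = if j \in U then psign j (U :\ j) * x (U :\ j) else 0.
Proof.
rewrite lmulE; case: ifP => jU.
  rewrite (bigD1 j) ?jU //= big1 => [|k /andP[_ /negbTE kj]]; rewrite mxE ?eqxx ?kj.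
    by rewrite addr0 mulr1.
  by rewrite mulr0 mul0r.
by rewrite big1 // => k; rewrite mxE; case: eqP => [->|_ _]; rewrite ?jU // mulr0 mul0r.
Qed.

(** For e_S and e_T every term of the invariant sum is zero: if j is in S it is also in T, so e_j /\
    e_T = 0, and if j is not in S the contraction of e_S vanishes. Equivariance carries this to any
    matrix g. *)
Lemma plucker g S T A0 B0 : S \subset T ->
  \sum_(j in B0 :\: A0) psign j A0 * psign j (B0 :\ j) *
     (ext_act_basis g S (j |: A0) * ext_act_basis g T (B0 :\ j)) = 0.
Proof.
move=> ST; have := plucker_equivariant g (ebas S) (ebas T) A0 B0.
rewrite [X in _ = X -> _]big1 => [|U _]; last first.
  rewrite big1 // => V _; rewrite big1 ?mulr0 // => j _.
  rewrite contr_deltaE lmul_deltaE !ffunE.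
  have [|_] := boolP (j \in U); first by rewrite mul0r.
  have [|_] := boolP (j \in V); last by rewrite mulr0.
  have [eU|_] := eqVneq (j |: U) S; last by rewrite mulr0 mul0r.
  have [eV|_] := eqVneq (V :\ j) T; last by rewrite !mulr0.
  by move: ST; rewrite -eU -eV subUset sub1set !inE eqxx.
rewrite !ext_act_ebas => E; rewrite -[RHS]E [LHS]big_mkcond; apply: eq_bigr => j _.
rewrite contr_deltaE lmul_deltaE !inE; case: (j \in A0) => /=; first by rewrite mul0r.
by case: (j \in B0); rewrite ?mulr0 //; ring.
Qed.

End ExteriorAlgebra.

Lemma ext_act_basis_morph (A B : comNzRingType) (f : {rmorphism A -> B}) n (g : 'M[A]_n)
  (S T : {set 'I_n}) : ext_act_basis (map_mx f g) S T = f (ext_act_basis g S T).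
Proof.
rewrite /ext_act_basis; elim: (enum S) T => [|j s IH] T /=.
  by rewrite !ffunE rmorph_nat.
rewrite -!/(lmul _ _) !lmulE rmorph_sum; apply: eq_bigr => k _.
by rewrite IH !rmorphM /psign rmorphXn rmorphN rmorph1 !mxE.
Qed.

Section SpecialActions.
Variables (A : comNzRingType) (n : nat).
Implicit Types (S T U : {set 'I_n}) (g : 'M[A]_n).

Lemma ext_act_basis1 S : ext_act_basis 1%:M S = ebas A S.
Proof. by rewrite -ext_act_ebas ext_act1. Qed.

(** Serves diagonal matrices, with [sigma] the identity, and permutation matrices. If [sigma] merges
    two elements of S, the product is zero and nothing is claimed. *)
Lemma ext_act_basis_monomial g (sigma : 'I_n -> 'I_n) (d : 'I_n -> A) S T :
  (forall i, col i g = d i *: delta_mx (sigma i) 0) ->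
  ext_act_basis g S T != 0 -> T = sigma @: S.
Proof.
move=> hg; have -> : sigma @: S = [set x in map sigma (enum S)].
  apply/setP => x; rewrite inE; apply/imsetP/mapP => -[y yS ->]; exists y => //;
  by move: yS; rewrite mem_enum.
rewrite /ext_act_basis; elim: (enum S) T => [|j s IH] T /=.
  by rewrite ffunE; have [->|] := eqVneq T set0; rewrite ?eqxx // => _ _; apply/setP => x; rewrite !inE.
rewrite -!/(lmul _ _) hg -[_ *: _]addr0 lmul_lin_l ffD ffZ lmul_deltaE => nz.
have [sT|sT] := boolP (sigma j \in T); last first.
  move: nz; rewrite (negbTE sT) mulr0 add0r.
  by rewrite lmulE big1 ?eqxx // => k _; rewrite mxE mulr0 mul0r.
have {}IH := IH (T :\ sigma j); apply/setP => x; rewrite inE in_cons.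
have [->|xs] /= := eqVneq x (sigma j); first by rewrite sT.
have <- : x \in T :\ sigma j = (x \in map sigma s).
  rewrite IH ?inE //; apply: contraNneq nz => ->.
  rewrite sT !mulr0 add0r lmulE big1 // => k _; by rewrite mxE mulr0 mul0r.
by rewrite !inE xs.
Qed.

Lemma col_diag (d : 'rV[A]_n) i : col i (diag_mx d) = d 0 i *: delta_mx i 0.
Proof.
by apply/matrixP => j k; rewrite !mxE (ord1 k) eqxx andbT; case: eqP => [->|]; rewrite ?mulr1 ?mulr0.
Qed.

Lemma ext_act_basis_diag (d : 'rV[A]_n) S T :
  ext_act_basis (diag_mx d) S T = (T == S)%:R * \prod_(i in S) d 0 i.
Proof.
have [->|TS] := eqVneq T S; last first.
  apply/eqP; rewrite mul0r; apply: contraNT TS => nz.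
  by rewrite [T](ext_act_basis_monomial (col_diag d) nz) imset_id.
rewrite mul1r; have [k] := ubnP #|S|; elim: k S => // k IH S ltSk.
have [->|/set0Pn[j jS]] := eqVneq S set0; first by rewrite ext_act_basis0 ffunE eqxx big_set0.
have jD : j \notin S :\ j by rewrite !inE eqxx.
have := congr1 (fun x : ext A n => psign A j (S :\ j) * x S) (ext_act_basis_setU1 (diag_mx d) jD).
rewrite setD1K // ffZ mulrA psign_sqr mul1r => <-.
rewrite col_diag -[_ *: _]addr0 lmul_lin_l ffD ffZ lmul_deltaE jS.
rewrite [lmul 0 _ _]lmulE [X in _ + X]big1 ?addr0 => [|i _]; last by rewrite mxE mulr0 mul0r.
rewrite IH; last by move: ltSk; rewrite (cardsD1 j S) jS.
rewrite (big_setD1 j jS) /=.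
transitivity (psign A j (S :\ j) * psign A j (S :\ j) * (d 0 j * \prod_(i in S :\ j) d 0 i)).
  by ring.
by rewrite psign_sqr mul1r.
Qed.

(* The coefficient of [e_(a |: S :\ b)] in [E_ab e_S]. *)
Definition esign (a b : 'I_n) S : A := psign A b (S :\ b) * psign A a (S :\ b).

Lemma esign_sqr a b S : esign a b S * esign a b S = 1.
Proof.
transitivity (psign A b (S :\ b) * psign A b (S :\ b) * (psign A a (S :\ b) * psign A a (S :\ b))).
  by rewrite /esign; ring.
by rewrite !psign_sqr mulr1.
Qed.

(** Only the column b differs from that of the identity, and the product is linear in it; the
    correction in e_a vanishes when a already belongs to S. *)
Lemma ext_act_basis_transvection (t : A) (a b : 'I_n) S : a != b ->
  ext_act_basis (1%:M - t *: delta_mx a b) S =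
  if (b \in S) && (a \notin S) then ebas A S - (t * esign a b S) *: ebas A (a |: S :\ b)
  else ebas A S.
Proof.
move=> ab; set g := _ - _.
have colg i : col i g = delta_mx i 0 - (t *+ (i == b)) *: delta_mx a 0.
  apply/matrixP => j k; rewrite !mxE (ord1 k) eqxx !andbT.
  by case: (i == b); rewrite ?andbT ?andbF ?mulr1n ?mulr0n ?mul0r ?mulr0.
have gN U : b \notin U -> ext_act_basis g U = ebas A U.
  move=> bU; rewrite -ext_act_basis1 /ext_act_basis; congr wedge; apply/eq_in_map => i.
  rewrite mem_enum => iU; rewrite colg.
  have -> : (i == b) = false by apply/negbTE; apply: contraNneq bU => <-.
  by rewrite scale0r subr0; apply/matrixP => j k; rewrite !mxE (ord1 k) eqxx andbT.
have [bS|bS] /= := boolP (b \in S); last by rewrite gN.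
have bD : b \notin S :\ b by rewrite !inE eqxx.
have := congr1 (fun x : ext A n => psign A b (S :\ b) *: x) (ext_act_basis_setU1 g bD).
rewrite setD1K // scalerA psign_sqr scale1r => <-.
rewrite gN // colg eqxx mulr1n -scaleNr [X in lmul X _]addrC lmul_lin_l.
rewrite (lmul_delta_ebas _ bD) scalerDr !scalerA psign_sqr scale1r setD1K // addrC.
have [aS|aS] /= := boolP (a \in S).
  suff -> : lmul (delta_mx a 0) (ebas A (S :\ b)) = 0 by rewrite scaler0 addr0.
  apply/ffunP => U; rewrite lmul_deltaE ff0 ffunE; case: ifP => // aU.
  have [eU|] := eqVneq (U :\ a) (S :\ b); last by rewrite mulr0.
  by have := setD11 a U; rewrite eU !inE ab aS.
rewrite lmul_delta_ebas ?inE ?(negbTE aS) ?andbF // scalerA; congr (_ + _).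
by rewrite -scaleNr; congr (_ *: _); rewrite /esign; ring.
Qed.

Lemma psign_swap (a b : 'I_n) S : (b < a)%N -> b \in S -> psign A a S = - psign A a (S :\ b).
Proof.
by move=> ltba bS; rewrite -{1}(setD1K bS) psignU ?inE ?eqxx // ltba expr1 mulN1r.
Qed.

Lemma psignU_gt (a b : 'I_n) S : (b < a)%N -> a \notin S -> psign A b (a |: S) = psign A b S.
Proof. by move=> ltba aS; rewrite psignU // ltnNge ltnW //= expr0 mul1r. Qed.

End SpecialActions.

(** Each element of T outside S has to come from an off-diagonal entry, and these are multiples of
    the variable. *)
Lemma ext_act_basis_dvd (K : fieldType) n (xi : 'M[{poly K}]_n) (S T : {set 'I_n}) :
  'X^#|T :\: S| %| ext_act_basis (1%:M - 'X *: xi) S T.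
Proof.
set g := _ - _; have -> : T :\: S = T :\: [set x in enum S].
  by congr (_ :\: _); apply/setP => x; rewrite inE mem_enum.
rewrite /ext_act_basis; elim: (enum S) T => [|j s IH] T /=.
  by rewrite ffunE; have [->|_] := eqVneq T set0; rewrite ?set0D ?cards0 ?dvdp0 ?expr0 ?dvd1p.
rewrite -/(lmul _ _) lmulE; apply: (big_ind (fun p => 'X^_ %| p)); first exact: dvdp0.
  exact: dvdp_add.
move=> k kT; rewrite -mulrA; apply: dvdp_mull.
have [->|kj] := eqVneq k j.
  apply: dvdp_mull; apply: dvdp_trans (IH _); apply: dvdp_exp2l.
  apply: subset_leq_card; apply/subsetP => x; rewrite !inE negb_or.
  by case/andP=> /andP[-> ->] ->.
apply: (@dvdp_trans _ ('X * 'X^#|(T :\ k) :\: [set x in s]|)).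
  rewrite -exprS; apply: dvdp_exp2l.
  apply: (@leq_trans #|k |: ((T :\ k) :\: [set x in s])|); last by rewrite cardsU1; case: (_ \notin _).
  apply: subset_leq_card; apply/subsetP => x; rewrite !inE negb_or.
  by case/andP=> /andP[_ ->] ->; rewrite andbT; case: (x == k).
apply: dvdp_mul (IH _).
by rewrite !mxE (negbTE kj) sub0r -mulrN dvdp_mulr.
Qed.

(** * Tensors *)

Section TensorAction.
Variables (A : comNzRingType) (n m : nat).
Implicit Types (g h : 'M[A]_n) (x y t : tens A n m) (E F : {ffun 'I_m -> {set 'I_n}}).

Definition tbas F : tens A n m := [ffun E => (E == F)%:R].

Definition tcoef g E F : A := \prod_c ext_act_basis g (E c) (F c).

Lemma tens_actE g t F : tens_act g t F = \sum_E (t E : A) * tcoef g E F.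
Proof. by rewrite ffunE. Qed.

Lemma tens_act_lin g (a : A) x y :
  tens_act g (a *: x + y) = a *: tens_act g x + tens_act g y.
Proof.
apply/ffunP => F; rewrite !ffE !tens_actE mulr_sumr -big_split /=.
by apply: eq_bigr => E _; rewrite !ffE; ring.
Qed.

HB.instance Definition _ g := GRing.isLinear.Build A (tens A n m) (tens A n m) _
  (@tens_act A n m g) (fun a => tens_act_lin g a).

Lemma tens_act_tbas g E F : tens_act g (tbas E) F = tcoef g E F.
Proof.
rewrite tens_actE (bigD1 E) //= big1 => [|D /negbTE DE]; rewrite ffunE ?eqxx ?DE.
  by rewrite addr0 mul1r.
by rewrite mul0r.
Qed.

Lemma tcoef1 E F : tcoef 1%:M E F = (F == E)%:R.
Proof.
have [->|] := eqVneq F E.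
  by rewrite /tcoef big1 // => c _; rewrite ext_act_basis1 ffunE eqxx.
move/eqP/ffunP/eqfunP; rewrite negb_forall => /existsP[c ne].
by rewrite /tcoef (bigD1 c) //= ext_act_basis1 ffunE (negbTE ne) mul0r.
Qed.

Lemma tens_act1 t : tens_act 1%:M t = t.
Proof.
apply/ffunP => F; rewrite tens_actE (bigD1 F) //= big1 => [|E EF]; rewrite tcoef1.
  by rewrite eqxx addr0 mulr1.
by rewrite eq_sym (negbTE EF) mulr0.
Qed.

Lemma tcoefM g h E F : tcoef (g *m h) E F = \sum_D tcoef h E D * tcoef g D F.
Proof.
rewrite /tcoef; under [RHS]eq_bigr => D _ do rewrite -big_split /=.
rewrite -(bigA_distr_bigA (fun c (S : {set 'I_n}) =>
  ext_act_basis h (E c) S * ext_act_basis g S (F c) : A)) /=.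
by apply: eq_bigr => c _; rewrite ext_act_basisM ffsum; apply: eq_bigr => S _; rewrite ffZ.
Qed.

Lemma tens_actM g h t : tens_act (g *m h) t = tens_act g (tens_act h t).
Proof.
apply/ffunP => F; rewrite !tens_actE.
under eq_bigr => E _ do rewrite tcoefM mulr_sumr.
rewrite exchange_big; apply: eq_bigr => D _ /=; rewrite tens_actE mulr_suml.
by apply: eq_bigr => E _; rewrite mulrA.
Qed.

Lemma tcoef_tr g E F : tcoef g^T E F = tcoef g F E.
Proof. by apply: eq_bigr => c _; rewrite ext_act_basis_tr. Qed.

Lemma tcoef_homog g E F : tcoef g E F != 0 -> forall c, #|F c| = #|E c|.
Proof.
move=> nz c; apply: (@ext_act_basis_homog A n g); apply: contraNneq nz => e0.
by rewrite /tcoef (bigD1 c) //= e0 mul0r.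
Qed.

Lemma pairingE x y : pairing x y = \sum_F (x F : A) * y F.
Proof. by []. Qed.

Lemma pairingC x y : pairing x y = pairing y x.
Proof. by apply: eq_bigr => F _; rewrite mulrC. Qed.

Lemma pairing_lin x (a : A) y z : pairing x (a *: y + z) = a * pairing x y + pairing x z.
Proof.
by rewrite !pairingE mulr_sumr -big_split; apply: eq_bigr => F _ /=; rewrite !ffE; ring.
Qed.

HB.instance Definition _ x := GRing.isLinear.Build A (tens A n m) A^o _
  (@pairing A n m x) (fun a => pairing_lin x a).

Lemma pairing_lin_l x (a : A) y z : pairing (a *: y + z) x = a * pairing y x + pairing z x.
Proof. by rewrite ![pairing _ x]pairingC pairing_lin. Qed.

Lemma pairing0l x : pairing 0 x = 0.
Proof. by rewrite pairingC linear0. Qed.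

Lemma pairingZr x (a : A) y : pairing x (a *: y) = a * pairing x y.
Proof. by rewrite linearZ. Qed.

Lemma pairingZl x (a : A) y : pairing (a *: x) y = a * pairing x y.
Proof. by rewrite pairingC pairingZr pairingC. Qed.

Lemma pairing_tbas x F : pairing x (tbas F) = x F.
Proof.
rewrite pairingE (bigD1 F) //= big1 => [|E /negbTE EF]; rewrite ffunE ?eqxx ?EF.
  by rewrite addr0 mulr1.
by rewrite mulr0.
Qed.

Lemma pairing_act g x y : pairing (tens_act g x) y = pairing x (tens_act g^T y).
Proof.
rewrite !pairingE; under eq_bigr => F _ do rewrite tens_actE mulr_suml.
rewrite exchange_big; apply: eq_bigr => E _ /=; rewrite tens_actE mulr_sumr.
by apply: eq_bigr => F _; rewrite tcoef_tr; ring.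
Qed.

Definition upd F (c : 'I_m) (S : {set 'I_n}) : {ffun 'I_m -> {set 'I_n}} :=
  [ffun d => if d == c then S else F d].

Lemma updE F c S d : upd F c S d = if d == c then S else F d.
Proof. by rewrite ffunE. Qed.

Lemma upd_id F c : upd F c (F c) = F.
Proof. by apply/ffunP => d; rewrite updE; case: eqP => [->|]. Qed.

Lemma tcoef_upd g E F c S :
  tcoef g E (upd F c S) =
  ext_act_basis g (E c) S * \prod_(d | d != c) ext_act_basis g (E d) (F d).
Proof.
rewrite /tcoef (bigD1 c) //= updE eqxx; congr (_ * _).
by apply: eq_bigr => d /negbTE dc; rewrite updE dc.
Qed.

(** The factors of the columns that do not depend on j come out of the sum. [F] and [F'] index two
    copies of the tensor, so c = c' is allowed here, unlike in the one-copy version below. *)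
Lemma tcoef_plucker2 g E F F' c c' A0 B0 : E c \subset E c' ->
  \sum_(j in B0 :\: A0) psign A j A0 * psign A j (B0 :\ j) *
     (tcoef g E (upd F c (j |: A0)) * tcoef g E (upd F' c' (B0 :\ j))) = 0.
Proof.
move=> Ecc'; pose r := \prod_(d | d != c) ext_act_basis g (E d) (F d).
pose r' := \prod_(d | d != c') ext_act_basis g (E d) (F' d).
rewrite (eq_bigr (fun j => psign A j A0 * psign A j (B0 :\ j) *
     (ext_act_basis g (E c) (j |: A0) * ext_act_basis g (E c') (B0 :\ j)) * (r * r'))).
  by rewrite -mulr_suml plucker // mul0r.
by move=> j _; rewrite !tcoef_upd -/r -/r'; ring.
Qed.

Lemma tcoef_plucker1 g E F c c' A0 B0 : E c \subset E c' -> c != c' ->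
  \sum_(j in B0 :\: A0) psign A j A0 * psign A j (B0 :\ j) *
     tcoef g E (upd (upd F c (j |: A0)) c' (B0 :\ j)) = 0.
Proof.
move=> Ecc' cc'; pose r := \prod_(d | (d != c') && (d != c)) ext_act_basis g (E d) (F d).
rewrite (eq_bigr (fun j => psign A j A0 * psign A j (B0 :\ j) *
     (ext_act_basis g (E c) (j |: A0) * ext_act_basis g (E c') (B0 :\ j)) * r)).
  by rewrite -mulr_suml plucker // mul0r.
move=> j _; rewrite tcoef_upd (bigD1 c) //= updE eqxx.
rewrite (_ : \prod_(d | _ && _) _ = r); first by ring.
by apply: eq_bigr => d /andP[_ /negbTE dc]; rewrite updE dc.
Qed.

End TensorAction.

(** * Base change to K[t] and the infinitesimal action of gl(V) *)

Lemma tens_act_morph (A B : comNzRingType) (f : {rmorphism A -> B}) n m (g : 'M[A]_n)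
    (t : tens A n m) (F : {ffun 'I_m -> {set 'I_n}}) :
  tens_act (map_mx f g) [ffun E => f (t E) : B^o] F = f (tens_act g t F).
Proof.
rewrite !tens_actE rmorph_sum; apply: eq_bigr => E _; rewrite ffunE rmorphM rmorph_prod.
by congr (_ * _); apply: eq_bigr => c _; rewrite ext_act_basis_morph.
Qed.

Lemma coef1M (R : nzSemiRingType) (p q : {poly R}) : (p * q)`_1 = p`_0 * q`_1 + p`_1 * q`_0.
Proof. by rewrite coefM big_ord_recl big_ord1. Qed.

(** The Leibniz rule at t = 0. *)
Lemma coef1_prod (R : comNzRingType) (I : finType) (p : I -> {poly R}) :
  (\prod_c p c)`_1 = \sum_c (p c)`_1 * \prod_(d | d != c) (p d)`_0.
Proof.
suff H r : uniq r -> (\prod_(c <- r) p c)`_1 =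
    \sum_(c <- r) (p c)`_1 * \prod_(d <- r | d != c) (p d)`_0.
  by rewrite H // index_enum_uniq.
elim: r => [|i r IH] /=; first by rewrite !big_nil coefC.
case/andP=> ir ur; rewrite !big_cons coef1M IH // eqxx /= addrC; congr (_ * _ + _).
  rewrite [LHS](rmorph_prod (coefp 0)) /= [RHS]big_seq_cond [LHS]big_seq_cond.
  by apply: eq_bigl => d; case dr: (d \in r) => //=; apply/esym; apply: contraNneq ir => <-.
rewrite mulr_sumr [LHS]big_seq [RHS]big_seq; apply: eq_bigr => c cr.
rewrite big_cons; have -> : i != c by apply: contraNneq ir => ->.
by rewrite mulrCA.
Qed.

Section Derivative.
Variables (K : fieldType) (n m : nat).
Implicit Types (g xi : 'M[K]_n) (x y t : tens K n m) (F : {ffun 'I_m -> {set 'I_n}}).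

Definition tpoly t : tens {poly K} n m := [ffun F => (t F)%:P : {poly K}^o].

Definition tcoefp k (y : tens {poly K} n m) : tens K n m :=
  [ffun F => (y F : {poly K})`_k : K^o].

Definition gcurve xi : 'M[{poly K}]_n := 1%:M - 'X *: map_mx polyC xi.

(** Minus the action of [xi] on [t]. The sign is that of the curve 1 - t xi in the dual action,
    which makes [gl_dual_act xi] the same operator at the transpose of [xi]. *)
Definition tderiv xi t : tens K n m := tcoefp 1 (tens_act (gcurve xi) (tpoly t)).

Lemma gcurveT xi : (gcurve xi)^T = gcurve xi^T.
Proof. by rewrite /gcurve linearB linearZ /= tr_scalar_mx map_trmx. Qed.

Lemma gl_dual_actE xi t : gl_dual_act xi t = tderiv xi^T t.
Proof. by rewrite /tderiv -gcurveT; apply/ffunP => F; rewrite !ffunE. Qed.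

Lemma tens_act_tpoly g t : tens_act (map_mx polyC g) (tpoly t) = tpoly (tens_act g t).
Proof. by apply/ffunP => F; rewrite [LHS]tens_act_morph [RHS]ffunE. Qed.

Lemma tcoefp_act g k (y : tens {poly K} n m) :
  tcoefp k (tens_act (map_mx polyC g) y) = tens_act g (tcoefp k y).
Proof.
apply/ffunP => F; rewrite ffunE !tens_actE coef_sum; apply: eq_bigr => E _.
rewrite [in RHS]ffunE (_ : tcoef _ E F = (tcoef g E F)%:P) ?coefMC //.
by rewrite [RHS]rmorph_prod; apply: eq_bigr => c _; rewrite ext_act_basis_morph.
Qed.

Lemma tcoefp_tpoly t : tcoefp 0 (tpoly t) = t.
Proof. by apply/ffunP => F; rewrite !ffunE coefC. Qed.

Lemma pairing_tpoly x (y : tens {poly K} n m) k :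
  (pairing (tpoly x) y : {poly K})`_k = pairing x (tcoefp k y).
Proof.
rewrite !pairingE coef_sum; apply: eq_bigr => F _; rewrite [X in X * _]ffunE coefCM.
by rewrite [in RHS]ffunE.
Qed.

Lemma pairing_tderiv xi x y : pairing (tderiv xi^T x) y = pairing x (tderiv xi y).
Proof.
rewrite pairingC /tderiv -pairing_tpoly pairingC pairing_act gcurveT trmxK.
by rewrite pairing_tpoly.
Qed.

Lemma tderiv_lin xi (a : K) x y : tderiv xi (a *: x + y) = a *: tderiv xi x + tderiv xi y.
Proof.
have -> : tderiv xi (a *: x + y) =
    tcoefp 1 (tens_act (gcurve xi) (a%:P *: tpoly x + tpoly y)).
  congr (tcoefp 1 (tens_act _ _)); apply/ffunP => F.
  by rewrite ffD ffZ !ffunE polyCD polyCM.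
apply/ffunP => F; rewrite ffD ffZ [LHS]ffunE tens_act_lin ffD ffZ coefD coefCM.
by rewrite /tderiv [X in _ = _ * X + _]ffunE [X in _ = _ + X]ffunE.
Qed.

HB.instance Definition _ xi := GRing.isLinear.Build K (tens K n m) (tens K n m) _
  (tderiv xi) (fun a => tderiv_lin xi a).

Lemma gcurveM xi g xi' : xi *m g = g *m xi' ->
  gcurve xi *m map_mx polyC g = map_mx polyC g *m gcurve xi'.
Proof.
move=> e; rewrite /gcurve mulmxBl mulmxBr mul1mx mulmx1 -scalemxAl -scalemxAr.
by rewrite -!map_mxM e.
Qed.

Lemma tderiv_act xi g xi' t : xi *m g = g *m xi' ->
  tderiv xi (tens_act g t) = tens_act g (tderiv xi' t).
Proof.
by move=> /gcurveM e; rewrite /tderiv -tens_act_tpoly -tens_actM e tens_actM tcoefp_act.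
Qed.

Lemma tderiv_homog (H : 'I_m -> nat) xi t :
  (forall F, t F != 0 -> forall c, #|F c| = H c) ->
  forall F, tderiv xi t F != 0 -> forall c, #|F c| = H c.
Proof.
move=> ht F; rewrite ffunE tens_actE coef_sum => nz.
have [/existsP[E nzE]|/existsPn h] :=
    boolP [exists E, ((tpoly t E : {poly K}) * tcoef (gcurve xi) E F)`_1 != 0].
  move=> c; have tE : t E != 0.
    by apply: contraNneq nzE => e; rewrite ffunE e mul0r coef0.
  rewrite (@tcoef_homog _ _ _ (gcurve xi) E F); last first.
    by apply: contraNneq nzE => ->; rewrite mulr0 coef0.
  exact: ht.
by move: nz; rewrite big1 ?eqxx // => E _; have := h E; rewrite negbK => /eqP.
Qed.

End Derivative.

Lemma dvdpX2_coef (K : fieldType) (p : {poly K}) : 'X^2 %| p -> p`_0 = 0 /\ p`_1 = 0.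
Proof. by case/dvdpP => q ->; rewrite !coefMXn. Qed.

(** * Initial segments, exchanges, and the first-order orbit of the base tensor *)

Section InitialSegments.
Variable n : nat.

Definition init h : {set 'I_n} := [set i : 'I_n | (i < h)%N].

Lemma card_init h : (h <= n)%N -> #|init h| = h.
Proof.
move=> hn; rewrite -sum1_card (eq_bigl (fun i : 'I_n => (i < h)%N)) => [|i]; last by rewrite inE.
by rewrite -(big_ord_widen n (fun=> 1%N) hn) sum1_card card_ord.
Qed.

Lemma init_sub h h' : (h <= h')%N -> init h \subset init h'.
Proof. by move=> le; apply/subsetP => i; rewrite !inE => /leq_trans; apply. Qed.

Lemma eq_init h (S : {set 'I_n}) : (h <= n)%N -> #|S| = h -> (S \subset init h) -> S = init h.
Proof. by move=> hn cS sub; apply/eqP; rewrite eqEcard sub cS card_init /= ?leqnn. Qed.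

End InitialSegments.

Lemma eq_ffun_prod (R : comNzRingType) (I J : finType) (F E : {ffun I -> J}) :
  (F == E)%:R = \prod_i (F i == E i)%:R :> R.
Proof.
have [->|] := eqVneq F E; first by rewrite big1 // => i _; rewrite eqxx.
move/eqP/ffunP/eqfunP; rewrite negb_forall => /existsP[i /negbTE ne].
by rewrite (bigD1 i) //= ne mul0r.
Qed.

Section BaseTensor.
Variables (K : fieldType) (n m : nat) (H : 'I_m -> nat).
Implicit Types (xi : 'M[K]_n) (F : {ffun 'I_m -> {set 'I_n}}) (c : 'I_m) (a b : 'I_n).

Definition base : {ffun 'I_m -> {set 'I_n}} := [ffun c => init n (H c)].

Definition exch c a b := upd base c (a |: init n (H c) :\ b).

Lemma baseE c : base c = init n (H c). Proof. by rewrite ffunE. Qed.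

Definition between (a b : 'I_n) h := (b < h <= a)%N.

Lemma between_in a b h : between a b h -> (b \in init n h) && (a \notin init n h).
Proof. by rewrite !inE -leqNgt. Qed.

Lemma between_gt a b h : between a b h -> (b < a)%N.
Proof. by case/andP => lt; apply: leq_trans. Qed.

Lemma exch_col c a b : exch c a b c = a |: init n (H c) :\ b.
Proof. by rewrite updE eqxx. Qed.

Lemma exch_other c a b d : d != c -> exch c a b d = init n (H d).
Proof. by rewrite updE => /negbTE ->; rewrite baseE. Qed.

Lemma exch_inj c a b c' a' b' : between a b (H c) -> between a' b' (H c') ->
  exch c a b = exch c' a' b' -> (c, (a, b)) = (c', (a', b')).
Proof.
move=> /between_in/andP[bi ai] /between_in/andP[bi' ai'] e.
have ab : b != a by apply: contraNneq ai => <-.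
have cc' : c = c'.
  apply/eqP; apply: contraT => ne; have := congr1 (fun F => a \in F c) e.
  by rewrite exch_col exch_other // !inE eqxx /=; move: ai; rewrite inE => /negbTE->.
subst c'; have e1 x := congr1 (fun F => x \in F c) e.
move: bi ai; rewrite !inE => bi ai.
have := e1 a; rewrite !exch_col !inE eqxx (negbTE ai) /= !andbF !orbF => /esym/eqP ->.
have := e1 b; rewrite !exch_col !inE eqxx (negbTE ab) bi !andbT /=.
by move=> /esym/negbT/norP[_ /negPn/eqP ->].
Qed.

Lemma tbas_tpoly F : tpoly (tbas K F) = tbas {poly K} F.
Proof. by apply/ffunP => E; rewrite !ffunE rmorph_nat. Qed.

Lemma tderiv_tbas xi E F : tderiv xi (tbas K E) F = (tcoef (gcurve xi) E F)`_1.
Proof. by rewrite /tderiv tbas_tpoly ffunE tens_act_tbas. Qed.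

Lemma esign_poly a b (S : {set 'I_n}) : esign {poly K} a b S = (esign K a b S)%:P.
Proof. by rewrite /esign /psign polyCM !rmorphXn rmorphN rmorph1. Qed.

(** Leibniz over the columns: E_ab moves one column at a time, the others staying initial segments.
    The minus sign is that of the curve 1 - t xi. *)
Lemma tderiv_exch a b F : (b < a)%N ->
  tderiv (delta_mx a b) (tbas K base) F =
  - \sum_(c | between a b (H c)) esign K a b (init n (H c)) * (F == exch c a b)%:R.
Proof.
move=> ltba; rewrite tderiv_tbas coef1_prod -sumrN [RHS]big_mkcond /=.
have ab : a != b by apply: contraTneq ltba => ->; rewrite ltnn.
have ext c S : ext_act_basis (gcurve (delta_mx a b)) (base c) S =
   if between a b (H c)
   then (S == init n (H c))%:R - 'X * (esign K a b (init n (H c)) *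
          (S == a |: init n (H c) :\ b)%:R)%:P
   else (S == init n (H c))%:R :> {poly K}.
  rewrite /gcurve map_delta_mx ext_act_basis_transvection // baseE.
  rewrite (_ : between a b (H c) = (b \in init n (H c)) && (a \notin init n (H c))); last first.
    by rewrite !inE -leqNgt.
  case: ifP => _; last by rewrite ffunE.
  by rewrite [in RHS]polyCM polyC_natr -esign_poly ffD ffN ffZ !ffunE mulrA.
apply: eq_bigr => c _; rewrite ext; case: ifP => bc; last first.
  by rewrite -polyC_natr coefC /= mul0r.
rewrite -polyC_natr coefB coefC coefXM coefC /= sub0r mulNr; congr (- _).
rewrite -mulrA; congr (_ * _).
rewrite (eq_ffun_prod _ F) [RHS](bigD1 c) //= exch_col; congr (_ * _).
apply: eq_bigr => d dc; rewrite exch_other // ext; case: ifP => _.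
  by rewrite -polyC_natr coefB coefC coefXM subr0.
by rewrite -polyC_natr coefC.
Qed.

(** A column with two new elements is reached only at order t^2. *)
Lemma tderiv_far xi F c :
  (1 < #|F c :\: init n (H c)|)%N -> tderiv xi (tbas K base) F = 0.
Proof.
move=> far; rewrite tderiv_tbas; apply: (proj2 (@dvdpX2_coef _ _ _)).
rewrite /tcoef (bigD1 c) //=; apply: dvdp_mulr; apply: dvdp_trans (ext_act_basis_dvd _ _ _).
by apply: dvdp_exp2l; rewrite baseE.
Qed.

Lemma pairing_tderiv_exch (x : tens K n m) a b : (b < a)%N ->
  pairing x (tderiv (delta_mx a b) (tbas K base)) =
  - \sum_(c | between a b (H c)) esign K a b (init n (H c)) * x (exch c a b).
Proof.
move=> ltba; have -> : tderiv (delta_mx a b) (tbas K base) =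
    - \sum_(c | between a b (H c)) esign K a b (init n (H c)) *: tbas K (exch c a b).
  apply/ffunP => F; rewrite tderiv_exch // ffN ffsum; congr (- _).
  by apply: eq_bigr => c _; rewrite ffZ ffunE.
rewrite linearN linear_sum; congr (- _); apply: eq_bigr => c _.
by rewrite linearZ /= pairing_tbas.
Qed.

(* A subspace [Q] of the target of [q] plays the role of [0]; both the Zariski
   tangent space and the double point ideal yield such a [q]. *)
Lemma sum_exchange (M : lmodType K) (Q : M -> Prop) (q : {ffun 'I_m -> {set 'I_n}} -> M)
    (x : tens K n m) :
  Q 0 -> (forall (t : K) u v, Q u -> Q v -> Q (t *: u + v)) ->
  x base = 0 ->
  (forall a b, (b < a)%N ->
     \sum_(c | between a b (H c)) esign K a b (init n (H c)) * x (exch c a b) = 0) ->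
  (forall F, F != base ->
     (forall c a b, between a b (H c) -> F != exch c a b) -> Q (q F)) ->
  (forall c c' a b, (H c <= H c')%N -> between a b (H c) -> between a b (H c') ->
     Q (esign K a b (init n (H c)) *: q (exch c a b)
        - esign K a b (init n (H c')) *: q (exch c' a b))) ->
  Q (\sum_F x F *: q F).
Proof.
move=> Q0 Qlin x0 xab h1 h2.
have QD u v : Q u -> Q v -> Q (u + v) by move=> Qu Qv; rewrite -[u]scale1r; apply: Qlin.
have QZ (t : K) u : Q u -> Q (t *: u) by move=> Qu; rewrite -[_ *: _]addr0; apply: Qlin.
pose T := [set t : 'I_m * ('I_n * 'I_n) | between t.2.1 t.2.2 (H t.1)].
pose ex (t : 'I_m * ('I_n * 'I_n)) := exch t.1 t.2.1 t.2.2.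
rewrite (bigID (fun F => F \in ex @: T)) /=; apply: (QD); last first.
  apply: (big_ind Q Q0 QD) => F FT; have [->|Fb] := eqVneq F base; first by rewrite x0 scale0r.
  apply/QZ/h1 => // c a b bt; apply: contraNneq FT => ->.
  by apply/imsetP; exists (c, (a, b)); rewrite ?inE.
rewrite big_imset => [|[c [a b]] [c' [a' b']]] /=; last first.
  by rewrite !inE => bt bt'; apply: exch_inj.
rewrite (partition_big snd predT) //=; apply: (big_ind Q Q0 QD) => -[a b] _.
rewrite (reindex_onto (fun c => (c, (a, b))) fst) => [|[c ab] /andP[_ /eqP /= ->] //].
rewrite (eq_bigl (fun c => between a b (H c))) => [|c]; last by rewrite inE !eqxx !andbT.
pose w c := esign K a b (init n (H c)) *: q (exch c a b).
pose y c := esign K a b (init n (H c)) * x (exch c a b).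
rewrite (eq_bigr (fun c => y c *: w c)) => [|c _]; last first.
  by rewrite /y /w scalerA mulrAC esign_sqr mul1r.
case: (pickP (fun c => between a b (H c))) => [c0 bc0|e]; last by rewrite big_pred0.
(* For fixed (a, b) the coefficients [y c] add up to zero, so the fixed vector [w c0] can be
   subtracted from every [w c]; the differences lie in Q by [h2], up to sign. *)
have -> : \sum_(c | between a b (H c)) y c *: w c =
    \sum_(c | between a b (H c)) y c *: (w c - w c0).
  rewrite -[RHS]addr0 -[X in _ = _ + X](scale0r (w c0)) -(xab _ _ (between_gt bc0)).
  rewrite scaler_suml -big_split; apply: eq_bigr => c _ /=.
  by rewrite -scalerDr subrK.
apply: (big_ind Q Q0 QD) => c bc; apply: (QZ).
have [le|/ltnW le] := leqP (H c) (H c0); first exact: h2.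
by rewrite -opprB -scaleN1r; apply/QZ/h2.
Qed.

End BaseTensor.

(** * Partitions and Schur modules *)

(** The count is the c-th part of the conjugate partition: the box (i, c) of the diagram is tested
    by columns on the left and by rows on the right. *)
Lemma lt_count_sorted (a : seq nat) i c : sorted geq a ->
  (i < count (fun r => c < r) a)%N = (c < nth 0 a i)%N.
Proof.
elim: a i => [|r a IH] i /= sa; first by rewrite nth_nil !ltn0.
have [cr|rc] := ltnP c r; first by case: i => [|i]; rewrite ?cr // add1n ltnS IH ?(path_sorted sa).
have ar : all (fun s => s <= c)%N a.
  move: sa; rewrite (path_sortedE (rev_trans leq_trans)) => /andP[/allP ar _].
  by apply/allP => s /ar /leq_trans; apply.
rewrite (_ : count _ a = 0%N); last first.
  apply/eqP; rewrite -leqn0 leqNgt -has_count -all_predC.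
  by apply: sub_all ar => s /=; rewrite -leqNgt.
rewrite ltn0; apply/esym/negbTE; rewrite -leqNgt; case: i => [|i] //=.
by have [lt|ge] := ltnP i (size a); [exact/(allP ar)/mem_nth | rewrite nth_default].
Qed.

Section Weights.
Variables (n m : nat).
Implicit Types (F : {ffun 'I_m -> {set 'I_n}}).

(** The exponent of the i-th torus coordinate in the weight of the basis tensor of F. *)
Definition wt F (i : 'I_n) := #|[set c | i \in F c]|.

Lemma sum_wt F r : (\sum_(i : 'I_n | i < r) wt F i = \sum_c #|F c :&: init n r|)%N.
Proof.
rewrite (eq_bigr (fun i => \sum_(c | i \in F c) 1)%N) => [|i _]; last first.
  by rewrite /wt -sum1_card; apply: eq_bigl => c; rewrite inE.
rewrite (exchange_big_dep predT) //=; apply: eq_bigr => c _.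
by rewrite sum1_card; apply: eq_card => i; rewrite !inE andbC.
Qed.

(** For given column sizes, initial segments have the most elements below any r. Equal weights give
    equal totals over the columns, hence equality in each column; r = H c then determines the column
    c. *)
Lemma wt_base (H : 'I_m -> nat) F : (forall c, H c <= n)%N ->
  (forall c, #|F c| = H c) -> (forall i, wt F i = wt (base n H) i) -> F = base n H.
Proof.
move=> Hn cF wF; have le r c : (#|F c :&: init n r| <= #|base n H c :&: init n r|)%N.
  rewrite baseE; have [Hr|rH] := leqP (H c) r.
    by rewrite (setIidPl (init_sub n Hr)) card_init // -(cF c) subset_leq_card // subsetIl.
  by rewrite (setIidPr (init_sub n (ltnW rH))) subset_leq_card // subsetIr.
apply/ffunP => c; set r := H c.
have : (\sum_c #|F c :&: init n r| = \sum_c #|base n H c :&: init n r|)%N.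
  by rewrite -!sum_wt; apply: eq_bigr.
rewrite (bigD1 c) //= [in RHS](bigD1 c) //= => e.
have : (\sum_(d < m | d != c) #|F d :&: init n r| <=
         \sum_(d < m | d != c) #|base n H d :&: init n r|)%N by apply: leq_sum.
move: e.
rewrite baseE setIid card_init ?Hn // -/r /=.
set x := (\sum_(_ | _) _)%N; set y := (\sum_(_ | _) _)%N => e le_xy.
have {}e : (#|F c :&: init n r| = r)%N.
  apply/eqP; rewrite eqn_leq; apply/andP; split.
    by apply: (@leq_trans #|F c|); [rewrite subset_leq_card ?subsetIl | rewrite cF].
  by rewrite -(leq_add2r x) e leq_add2l.
have e1 : F c :&: init n r = F c by apply/eqP; rewrite eqEcard subsetIl e (cF c) leqnn.
by apply: eq_init; rewrite ?Hn // -e1 subsetIr.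
Qed.

End Weights.

Section Columns.
Variables (n : nat) (a : part n).

Definition colh (c : 'I_(cols a)) : nat := col_height a c.

Lemma part_sorted : sorted geq a. Proof. by case: a => s /= /and3P[]. Qed.

Lemma part_size : (size a <= n)%N. Proof. by case: a => s /= /and3P[]. Qed.

Lemma colhE (c : 'I_(cols a)) : colh c = count (fun r => c < r)%N a.
Proof. by rewrite /colh /col_height (nth_map 0%N) ?size_iota // nth_iota. Qed.

Lemma colh_le_size c : (colh c <= size a)%N. Proof. by rewrite colhE count_size. Qed.

Lemma colh_le c : (colh c <= n)%N.
Proof. exact: leq_trans (colh_le_size c) part_size. Qed.

Lemma wt_base_part i : wt (base n colh) i = nth 0%N a i.
Proof.
have ai : (nth 0 a i <= cols a)%N.
  have [lt|ge] := ltnP i (size a); last by rewrite nth_default.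
  by rewrite /cols -nth0; case: (val i) lt => // j lt; apply: (sorted_leq_nth
     (rev_trans leq_trans) leqnn 0%N part_sorted); rewrite ?inE // (leq_trans _ lt).
rewrite -[RHS](card_init ai); apply: eq_card => c.
by rewrite !inE baseE inE colhE lt_count_sorted // part_sorted.
Qed.

End Columns.

(** A subspace of largest dimension inside P contains every vector of P, since otherwise it could be
    enlarged. This turns linear conditions into spaces to which irreducibility applies. *)
Lemma vspace_of_pred (K : fieldType) (vT : vectType K) (P : vT -> Prop) :
  P 0 -> (forall (a : K) u v, P u -> P v -> P (a *: u + v)) ->
  exists U : {vspace vT}, forall v, v \in U <-> P v.
Proof.
move=> P0 Plin; pose Pd d := `[< exists U : {vspace vT}, \dim U = d /\ forall v, v \in U -> P v >].
have exPd : exists d, Pd d.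
  exists 0%N; apply/asboolP; exists 0%VS; split=> [|v]; first exact: dimv0.
  by rewrite memv0 => /eqP ->.
have ubPd d : Pd d -> (d <= \dim {:vT})%N.
  by move=> /asboolP[U [<- _]]; apply/dimvS/subvf.
case: (ex_maxnP exPd ubPd) => d /asboolP[U [dU UP]] maxd; exists U => v; split=> [/UP//|Pv].
have: (\dim (U + <[v]>)%VS <= \dim U)%N.
  rewrite dU; apply: maxd; apply/asboolP; exists (U + <[v]>)%VS; split=> // w.
  case/memv_addP=> u uU [_ /vlineP[t ->] ->]; rewrite addrC; apply: Plin => //; exact: UP.
rewrite (geq_leqif (dimv_leqif_sup (addvSl U <[v]>))) => le.
by apply: (subvP le); apply: (subvP (addvSr U _)); apply: memv_line.
Qed.

Section Torus.
Variables (K : numFieldType) (n : nat).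
Implicit Types (i : 'I_n) (s : K).

Definition torus i s : 'M[K]_n := diag_mx (\row_j (if j == i then s else 1)).

Lemma torus_unit i s : s != 0 -> torus i s \in unitmx.
Proof.
move=> s0; rewrite unitmxE det_diag unitfE; apply/prodf_neq0 => j _.
by rewrite mxE; case: ifP => _; rewrite ?oner_eq0.
Qed.

Lemma torus_tr i s : (torus i s)^T = torus i s.
Proof. by rewrite tr_diag_mx. Qed.

Lemma torus_inv i s : s != 0 -> invmx (torus i s) = torus i s^-1.
Proof.
move=> s0; apply: (can_inj (mulKmx (torus_unit i s0))); rewrite mulmxV ?torus_unit //.
rewrite mulmx_diag -diag_const_mx; congr diag_mx; apply/rowP => j.
by rewrite !mxE; case: ifP => _; rewrite ?mulfV ?mulr1.
Qed.

Lemma ext_act_basis_torus i s (S T : {set 'I_n}) :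
  ext_act_basis (torus i s) S T = (T == S)%:R * s ^+ (i \in S).
Proof.
rewrite ext_act_basis_diag; congr (_ * _); have [iS|iS] := boolP (i \in S).
  rewrite (bigD1 i) //= mxE eqxx big1 ?mulr1 // => j /andP[_ /negbTE ji]; by rewrite mxE ji.
by rewrite big1 // => j jS; rewrite mxE; case: eqP jS iS => // -> ->.
Qed.

Lemma tcoef_torus m i s (E F : {ffun 'I_m -> {set 'I_n}}) :
  tcoef (torus i s) E F = (F == E)%:R * s ^+ wt E i.
Proof.
rewrite (eq_ffun_prod _ F E) (_ : s ^+ wt E i = \prod_c s ^+ (i \in E c)).
  by rewrite -big_split; apply: eq_bigr => c _; rewrite ext_act_basis_torus.
rewrite -expr_sum; congr (_ ^+ _); rewrite /wt -sum1_card big_mkcond; apply: eq_bigr => c _.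
by rewrite inE; case: (i \in E c).
Qed.

Lemma tens_act_torus m i s (t : tens K n m) F :
  tens_act (torus i s) t F = s ^+ wt F i * t F.
Proof.
rewrite tens_actE (bigD1 F) //= big1 => [|E EF]; rewrite tcoef_torus.
  by rewrite eqxx addr0 mul1r mulrC.
by rewrite eq_sym (negbTE EF) mul0r mulr0.
Qed.

(** The eigenvalues of [torus i 2] therefore determine the i-th weight. *)
Lemma exp2_inj : injective (fun k : nat => 2 ^+ k : K).
Proof.
have le k l : (k <= l)%N -> 2 ^+ k = 2 ^+ l :> K -> k = l.
  move=> kl /eqP; rewrite -(subnKC kl) exprD -[X in X == _]mulr1.
  rewrite (inj_eq (mulfI _)) ?expf_neq0 ?pnatr_eq0 //.
  case: (l - k)%N => [|d]; first by rewrite addn0.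
  rewrite -natrX (eqr_nat K 1) => /eqP e; by have := ltn_expl d.+1 (isT : (1 < 2)%N); rewrite -e.
by move=> k l /= e; case: (leqP k l) => [kl|/ltnW lk]; [exact: le | apply/esym/le].
Qed.

End Torus.

Section SchurModules.
Variables (K : numFieldType) (n : nat) (a : part n).
Local Notation T := (tens K n (cols a)).
Local Notation H := (@colh n a).
Local Notation e0 := (tbas K (base n H)).

(** Diagonal matrices lie in the Borel subgroup, and [torus i 2] reads off the i-th weight: only an
    index of weight a can occur in v, and [wt_base] leaves a single one. *)
Lemma hw_vector_base (v : T) : tens_homog v -> hw_vector a v ->
  v = v (base n H) *: e0 /\ v (base n H) != 0.
Proof.
move=> hom [v0 hw].
have vF F : v F != 0 -> F = base n H.
  move=> nz; apply: wt_base => [c|c|i]; [exact: colh_le|exact: hom|].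
  have := hw (torus i 2) (torus_unit i _); rewrite pnatr_eq0 => /(_ isT) h.
  have {}h : tens_act (torus i 2) v = 2 ^+ nth 0%N a i *: v.
    rewrite h => [|j k kj]; last by rewrite !mxE (_ : j == k = false) // -val_eqE /= gtn_eqF.
    congr (_ *: _); rewrite (bigD1 i) //= big1 => [|j /negbTE ji].
      by rewrite !mxE !eqxx mulr1n mulr1.
    by rewrite !mxE eqxx ji mulr1n expr1n.
  have /(congr1 (fun t : T => t F)) := h; rewrite tens_act_torus ffZ => /(mulIf nz) /exp2_inj ->.
  by rewrite wt_base_part.
have ve : v = v (base n H) *: e0.
  apply/ffunP => F; rewrite ffZ ffunE; have [->|Fb] := eqVneq F (base n H); first by rewrite mulr1.
  by rewrite mulr0; apply/eqP; apply: contraNT Fb => /vF ->.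
by split=> //; apply: contraNneq v0 => e; rewrite ve e scale0r.
Qed.

Variables (SV : {vspace T}) (hSV : schur_module SV).

Lemma sv_homog t : t \in SV -> forall F, t F != 0 -> forall c, #|F c| = H c.
Proof. by case: hSV => h _ _ /h. Qed.

Lemma sv_act g t : g \in unitmx -> t \in SV -> tens_act g t \in SV.
Proof. by case: hSV => _ [h _ _] _; apply: h. Qed.

Lemma sv_irr (W : {vspace T}) : (W <= SV)%VS -> submodule (@tens_act K n (cols a)) W ->
  W <> 0%VS -> W = SV.
Proof. by case: hSV => _ [_ _ h] _ le sub nz; case: (h W le sub). Qed.

Lemma base_sv : e0 \in SV.
Proof.
case: hSV => hom _ [v vSV hw]; have [ve nz] := hw_vector_base (hom _ vSV) hw.
by rewrite -[e0]scale1r -(mulVf nz) -scalerA -ve memvZ.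
Qed.

Lemma e0_neq0 : e0 != 0.
Proof.
by apply/eqP => /(congr1 (fun t : T => t (base n H))); rewrite !ffunE eqxx => /eqP; rewrite oner_eq0.
Qed.

(** The vectors whose whole orbit satisfies Q form a submodule; it contains e, so irreducibility
    makes it all of SV. Q itself need only be linear. *)
Lemma orbit_ind (Q : T -> Prop) : Q 0 -> (forall (t : K) u v, Q u -> Q v -> Q (t *: u + v)) ->
  (forall g, g \in unitmx -> Q (tens_act g e0)) -> forall v, v \in SV -> Q v.
Proof.
move=> Q0 Qlin Qg.
have [W hW] : exists W : {vspace T}, forall v, v \in W <->
    (v \in SV /\ forall g, g \in unitmx -> Q (tens_act g v)).
  apply: vspace_of_pred => [|t u v [uS uQ] [vS vQ]].
    by split=> [|g _]; rewrite ?mem0v ?linear0.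
  by split=> [|g gu]; rewrite ?memvD ?memvZ // linearP; apply: Qlin; [exact: uQ|exact: vQ].
have WS : W = SV.
  apply: sv_irr => [|g t gu /hW[tS tQ]|W0].
  - by apply/subvP => v /hW[].
  - by apply/hW; split=> [|h hu]; [exact: sv_act | rewrite -tens_actM; apply: tQ; rewrite unitmx_mul hu].
  - have /hW : e0 \in SV /\ forall g, g \in unitmx -> Q (tens_act g e0) by split; [exact: base_sv|].
    by rewrite W0 memv0 (negbTE e0_neq0).
move=> v; rewrite -WS => /hW[_ /(_ 1%:M (unitmx1 _ _))]; by rewrite tens_act1.
Qed.

(** The radical is a submodule, as transposes of invertible matrices are invertible, and it misses
    e, which pairs with itself to 1. *)
Lemma sv_nondeg x : x \in SV -> (forall v, v \in SV -> pairing x v = 0) -> x = 0.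
Proof.
move=> xS xv; have [W hW] : exists W : {vspace T}, forall v, v \in W <->
    (v \in SV /\ forall u, u \in SV -> pairing v u = 0).
  apply: vspace_of_pred => [|t u v [uS uQ] [vS vQ]].
    by split=> [|u _]; rewrite ?mem0v ?pairing0l.
  split=> [|w wS]; rewrite ?memvD ?memvZ //.
  by rewrite pairing_lin_l uQ // vQ // mulr0 addr0.
have subW : submodule (@tens_act K n (cols a)) W.
  move=> g t gu /hW[tS tQ]; apply/hW; split=> [|u uS]; first exact: sv_act.
  by rewrite pairing_act; apply/tQ/sv_act => //; rewrite unitmx_tr.
have leW : (W <= SV)%VS by apply/subvP => v /hW[].
case: (eqVneq W 0%VS) => [W0|/eqP W0].
  by have /hW : x \in SV /\ forall v, v \in SV -> pairing x v = 0 by []; rewrite W0 memv0 => /eqP.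
have : e0 \in W by rewrite (sv_irr leW subW W0) base_sv.
case/hW => _ /(_ _ base_sv); rewrite pairing_tbas ffunE eqxx => /eqP; by rewrite oner_eq0.
Qed.

(** An equality of subspaces, not just an isomorphism. The perfect pairing gives a vector of SV' not
    orthogonal to e; its component of weight a is a nonzero multiple of e. Since (g^-1)^T runs over
    all of GL, the intersection with SV is a submodule of both, and it contains e. *)
Lemma dual_schurE (SV' : {vspace T}) : dual_schur_module SV' -> SV' = SV.
Proof.
case=> hom' [sub' nz' irr'] [U hU [f [inv nd1 nd2]]].
have eU : e0 \in U.
  case: hU => hom _ [v vU hw]; have [ve nz] := hw_vector_base (hom _ vU) hw.
  by rewrite -[e0]scale1r -(mulVf nz) -scalerA -ve memvZ.
have [phi0 [phi0S phi0e]] : exists phi, phi \in SV' /\ pairing (f phi) e0 != 0.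
  apply: contrapT => h; case/eqP: e0_neq0; apply: nd2 => // phi phiS.
  by apply/eqP; apply: contraT => nz; case: h; exists phi.
(* Killing the weights k <> a_i one at a time leaves a multiple of e0. *)
have kill (L : seq ('I_n * nat)) : all (fun ik : 'I_n * nat => ik.2 != nth 0%N a ik.1) L ->
    exists phi, [/\ phi \in SV', pairing (f phi) e0 != 0 &
      forall F ik, ik \in L -> wt F ik.1 = ik.2 -> phi F = 0].
  elim: L => [|[i k] L IH] /=; first by exists phi0.
  case/andP=> ki /IH[phi [phiS phie phi0L]].
  have two : (2 : K) != 0 by rewrite pnatr_eq0.
  have gu : invmx (torus i (2 : K)) \in unitmx by rewrite unitmx_inv torus_unit.
  have dE : dual_act (invmx (torus i (2 : K))) phi = tens_act (torus i (2 : K)) phi.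
    by rewrite /dual_act invmxK torus_tr.
  (* This operator annihilates the coordinates of i-th weight k and, by invariance of the pairing,
     multiplies the pairing with e by 2^(a_i) - 2^k, which is not zero. *)
  exists (tens_act (torus i (2 : K)) phi - 2 ^+ k *: phi); split.
  - by rewrite memvB ?memvZ // -dE; apply: sub'.
  - have := inv _ _ _ gu phiS eU; rewrite dE torus_inv // => e.
    have te : tens_act (torus i (2^-1 : K)) e0 = (2 ^- nth 0%N a i) *: e0.
      apply/ffunP => F; rewrite tens_act_torus ffZ !ffunE; have [->|] := eqVneq F (base n H).
        by rewrite wt_base_part exprVn.
      by rewrite !mulr0.
    have {}e : pairing (f (tens_act (torus i (2 : K)) phi)) e0 = 2 ^+ nth 0%N a i * pairing (f phi) e0.
      by rewrite -e te pairingZr mulrA mulfV ?mul1r // expf_neq0.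
    rewrite addrC -scaleNr linearP /= pairing_lin_l e -mulrDl mulf_neq0 // addrC subr_eq0.
    by apply: contraNneq ki => /exp2_inj ->.
  - move=> F ik; rewrite inE ffD ffN ffZ tens_act_torus => /orP[/eqP -> /= ->|ikL wF].
      by rewrite subrr.
    by rewrite (phi0L F ik ikL wF) !mulr0 subrr.
(* A weight counts columns, so it is at most [cols a]; the list exhausts the possible pairs. *)
pose L := [seq (i, k) | i <- enum 'I_n, k <- iota 0 (cols a).+1].
have [|phi [phiS phie phiL]] := kill (filter (fun ik : 'I_n * nat => ik.2 != nth 0%N a ik.1) L).
  exact: filter_all.
have phiE : phi = phi (base n H) *: e0.
  apply/ffunP => F; rewrite ffZ ffunE; have [->|Fb] := eqVneq F (base n H); first by rewrite mulr1.
  rewrite mulr0; apply/eqP; apply: contraNT Fb => nz; apply/eqP/wt_base => [c|c|i].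
  - exact: colh_le.
  - exact: hom' nz c.
  - rewrite wt_base_part; apply/eqP; apply: contraNT nz => ne; apply/eqP.
    apply: (phiL F (i, wt F i)) => //; rewrite mem_filter ne.
    apply: allpairs_f; first exact: mem_enum.
    by rewrite mem_iota /= add0n ltnS -[X in (_ <= X)%N](card_ord (cols a)) max_card.
have eS' : e0 \in SV'.
  have nz : phi (base n H) != 0.
    apply: contraNneq phie => z; by rewrite phiE z scale0r linear0 pairing0l.
  by rewrite -[e0]scale1r -(mulVf nz) -scalerA -phiE memvZ.
have sub1 g t : g \in unitmx -> t \in SV' -> tens_act g t \in SV'.
  move=> gu tS; have := sub' (invmx g)^T t; rewrite /dual_act -trmx_inv invmxK trmxK.
  by apply; rewrite ?unitmx_tr ?unitmx_inv.
have capn0 : (SV' :&: SV)%VS <> 0%VS.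
  by move=> c0; have := e0_neq0; rewrite -memv0 -c0 memv_cap eS' base_sv.
have cap1 : (SV' :&: SV)%VS = SV.
  apply: sv_irr capn0; first exact: capvSr.
  move=> g t gu; rewrite !memv_cap => /andP[t1 t2].
  by rewrite sub1 // sv_act.
case: (irr' (SV' :&: SV)%VS); rewrite ?capvSl //; last by rewrite cap1 => ->.
move=> g t gu; rewrite !memv_cap => /andP[t1 t2]; apply/andP; split; first exact: sub'.
by apply: sv_act => //; rewrite unitmx_tr unitmx_inv.
Qed.


End SchurModules.

(** * Tangent space *)

(** The product d p would have more integer roots than its degree allows. In the applications d is
    mostly the determinant of a curve of matrices. *)
Lemma poly_zero_of_values (K : numFieldType) (d p : {poly K}) : d != 0 ->
  (forall s, d.[s] != 0 -> p.[s] = 0) -> p = 0.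
Proof.
move=> d0 h; apply/eqP; apply: contraT => p0.
have dp0 : d * p != 0 by rewrite mulf_neq0.
suff : (size [seq k%:R : K | k <- iota 0 (size (d * p)%R)] < size (d * p)%R)%N.
  by rewrite size_map size_iota ltnn.
apply: max_poly_roots => //.
  apply/allP => _ /mapP[k _ ->]; rewrite /root hornerM mulf_eq0.
  by have [//|/h ->] := eqVneq d.[k%:R] 0; rewrite eqxx orbT.
by rewrite map_inj_uniq ?iota_uniq // => k l /eqP; rewrite eqr_nat => /eqP.
Qed.

Lemma mpoly_ring_ind (R : comNzRingType) N (P : {mpoly R[N]} -> Prop) :
  (forall c, P c%:MP) -> (forall i, P 'X_i) ->
  (forall f g, P f -> P g -> P (f + g)) -> (forall f g, P f -> P g -> P (f * g)) ->
  forall f, P f.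
Proof.
move=> Pc PX PD PM f; rewrite [f]mpolyE.
apply: (big_ind P _ PD) => [|w _]; first by rewrite -(mpolyC0 N R); apply: Pc.
rewrite -mul_mpolyC; apply: (PM _ _ (Pc _)); rewrite mpolyXE_id.
apply: (big_ind P _ PM) => [|i _]; first exact: (Pc 1).
elim: (w i) => [|k IH]; first by rewrite expr0; apply: (Pc 1).
by rewrite exprS; apply: PM.
Qed.

Section DirectionalDerivative.
Variables (K : fieldType) (N : nat).
Implicit Types (f g : {mpoly K[N]}) (p v : 'I_N -> K) (y : 'I_N -> {poly K}).

Definition mdir p v f : K := \sum_i (mderiv i f).@[p] * v i.

Lemma mdirC p v c : mdir p v c%:MP = 0.
Proof. by rewrite /mdir big1 // => i _; rewrite mderivC meval0 mul0r. Qed.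

Lemma mdirX p v i : mdir p v 'X_i = v i.
Proof.
rewrite /mdir (bigD1 i) //= big1 => [|j ji]; rewrite mderivX mnm1E ?eqxx.
  by rewrite addr0 -{1}[U_(i)%MM]add0m addmK mpolyX0 scale1r meval1 mul1r.
by rewrite eq_sym (negbTE ji) scale0r meval0 mul0r.
Qed.

Lemma mdirD p v f g : mdir p v (f + g) = mdir p v f + mdir p v g.
Proof.
by rewrite /mdir -big_split; apply: eq_bigr => i _ /=; rewrite mderivD mevalD mulrDl.
Qed.

Lemma mdirM p v f g : mdir p v (f * g) = f.@[p] * mdir p v g + mdir p v f * g.@[p].
Proof.
rewrite /mdir mulr_sumr mulr_suml -big_split; apply: eq_bigr => i _ /=.
by rewrite mderivM mevalD !mevalM; ring.
Qed.

Lemma mmap_poly_coef f y :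
  (mmap polyC y f)`_0 = f.@[fun i => (y i)`_0] /\
  (mmap polyC y f)`_1 = mdir (fun i => (y i)`_0) (fun i => (y i)`_1) f.
Proof.
elim/mpoly_ring_ind: f => [c|i|f g [f0 f1] [g0 g1]|f g [f0 f1] [g0 g1]].
- by rewrite mmapC !coefC mevalC mdirC.
- by rewrite mmapX mmap1U mevalXU mdirX.
- by rewrite rmorphD !coefD f0 f1 g0 g1 mevalD mdirD.
- by rewrite rmorphM /= coef0M coef1M f0 f1 g0 g1 mevalM mdirM.
Qed.

(** Together with [mmap_poly_coef], this links vanishing of f at the points of a curve to its
    differential along the velocity. *)
Lemma mmap_poly_horner f y s : (mmap polyC y f).[s] = f.@[fun i => (y i).[s]].
Proof.
elim/mpoly_ring_ind: f => [c|i|f g ef eg|f g ef eg].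
- by rewrite mmapC hornerC mevalC.
- by rewrite mmapX mmap1U mevalXU.
- by rewrite rmorphD hornerD ef eg mevalD.
- by rewrite rmorphM /= hornerM ef eg mevalM.
Qed.

End DirectionalDerivative.

Section Curves.
Variables (K : numFieldType) (n m : nat).
Implicit Types (y : tens {poly K} n m) (xi : 'M[K]_n) (t : tens K n m).

Definition tev s y : tens K n m := [ffun F => (y F : {poly K}).[s] : K^o].

Lemma tev_curve s xi t :
  tev s (tens_act (gcurve xi) (tpoly t)) = tens_act (1%:M - s *: xi) t.
Proof.
apply/ffunP => F; rewrite ffunE -/(horner_eval s _) -(@tens_act_morph _ _ (horner_eval s)).
have -> : map_mx (horner_eval s) (gcurve xi) = 1%:M - s *: xi.
  apply/matrixP => i j; rewrite !mxE /= /horner_eval hornerD hornerN hornerMn hornerC.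
  by rewrite hornerM hornerX hornerC.
by congr (tens_act _ _ F); apply/ffunP => E; rewrite !ffunE /= /horner_eval hornerC.
Qed.

Lemma det_gcurve xi : \det (gcurve xi) != 0.
Proof.
apply/eqP => /(congr1 (horner_eval 0)); rewrite -det_map_mx.
have -> : map_mx (horner_eval 0) (gcurve xi) = 1%:M.
  apply/matrixP => i j; rewrite !mxE /= /horner_eval hornerD hornerN hornerMn hornerC.
  by rewrite hornerM hornerX mul0r subr0.
by rewrite det1 /horner_eval horner0 => /eqP; rewrite oner_eq0.
Qed.

Lemma gcurve_unit xi s : (\det (gcurve xi)).[s] != 0 -> 1%:M - s *: xi \in unitmx.
Proof.
rewrite unitmxE unitfE -/(horner_eval s _) -det_map_mx; congr (\det _ != _).
apply/matrixP => i j; rewrite !mxE /= /horner_eval hornerD hornerN hornerMn hornerC.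
by rewrite hornerM hornerX hornerC.
Qed.

(** The part of the curve off W, cut out by a projection, is polynomial in s and vanishes for almost
    all s, so each of its coefficients is zero. *)
Lemma curve_coef_mem (W : {vspace tens K n m}) y (d : {poly K}) : d != 0 ->
  (forall s, d.[s] != 0 -> tev s y \in W) -> forall k, tcoefp k y \in W.
Proof.
move=> d0 h; pose N := \max_F size (y F : {poly K}).
have sN F : (size (y F : {poly K}) <= N)%N by apply: leq_bigmax.
pose u k := tcoefp k y - projv W (tcoefp k y).
have tevE s : tev s y = \sum_(k < N) s ^+ k *: tcoefp k y.
  apply/ffunP => F; rewrite ffsum ffunE (horner_coef_wide _ (sN F)).
  by apply: eq_bigr => k _; rewrite ffZ ffunE mulrC.
have u0 k F : (k < N)%N -> u k F = 0.
  move=> kN; suff : \poly_(k < N) (u k F : K) = 0.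
    by move=> /(congr1 (fun p : {poly K} => p`_k)); rewrite coef_poly kN coef0.
  apply: poly_zero_of_values d0 _ => s /h tW.
  transitivity ((tev s y - projv W (tev s y)) F : K); last by rewrite projv_id // subrr ffunE.
  rewrite tevE linear_sum -sumrB ffsum horner_poly; apply: eq_bigr => k' _.
  by rewrite linearZ /= -scalerBr ffZ mulrC.
move=> k; have [kN|Nk] := ltnP k N.
  suff /eqP : u k = 0 by rewrite subr_eq0 => /eqP ->; apply: memv_proj.
  by apply/ffunP => F; rewrite u0 // ffunE.
rewrite (_ : tcoefp k y = 0) ?mem0v //; apply/ffunP => F; rewrite !ffunE.
by rewrite nth_default // (leq_trans (sN F)).
Qed.

End Curves.

(** * Pluecker relations linearized at the base tensor *)

Section ExchangeRelations.
Variables (K : fieldType) (n m : nat) (H : 'I_m -> nat).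
Local Notation base := (base n H).
Local Notation exch := (exch H).
Local Notation init := (init n).
Implicit Types (A B S : {set 'I_n}) (c : 'I_m).

Lemma upd_base_init c : upd base c (init (H c)) = base.
Proof. by rewrite -baseE upd_id. Qed.

Lemma tbas_upd_neq F c S : S != init (H c) -> tbas K base (upd F c S) = 0 :> K.
Proof.
move=> ne; rewrite ffunE; case: eqP => // /ffunP/(_ c); rewrite updE eqxx baseE => e.
by rewrite e eqxx in ne.
Qed.

Lemma tbas_upd_base c S : tbas K base (upd base c S) = (S == init (H c))%:R :> K.
Proof.
have [->|ne] := eqVneq S (init (H c)); last exact: tbas_upd_neq.
by rewrite upd_base_init ffunE eqxx.
Qed.

Lemma not_init_ex c S : (H c <= n)%N -> #|S| = H c -> S != init (H c) ->
  exists2 i, i \in init (H c) & i \notin S.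
Proof.
move=> Hn cS ne; have /subsetPn[i ii iS] : ~~ (init (H c) \subset S).
  by apply: contra ne => sub; rewrite eq_sym eqEcard sub cS card_init /=.
by exists i.
Qed.

Lemma setU1_neq_init (j : 'I_n) A h : (h <= j)%N -> (j |: A) != init h.
Proof.
by move=> hj; apply: contraTneq (setU11 j A) => ->; rewrite inE -leqNgt.
Qed.

Lemma setU1D1 (a b : 'I_n) A : b != a -> (a |: A) :\ b = a |: A :\ b.
Proof.
move=> ba; apply/setP => x; rewrite !inE.
by case: (x =P a) => [->|] //=; rewrite eq_sym ba.
Qed.

(** The left factors are the Pluecker signs of the terms j = a and j = b, the only ones that matter
    in an exchange between columns of heights h and h'. A common sign k turns them into the
    coefficients of E_ab on the two columns, with opposite signs. *)
Lemma esign_exchange (a b : 'I_n) h h' : between a b h -> between a b h' ->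
  exists k : K,
    k * (psign K a (init h :\ b) * psign K a (init h')) = esign K a b (init h) /\
    k * (psign K b (init h :\ b) * psign K b (a |: init h' :\ b)) = - esign K a b (init h').
Proof.
move=> bt bt'; have ltba := between_gt bt; case/andP: (between_in bt) => bi ai.
case/andP: (between_in bt') => bi' ai'.
have ba : b != a by apply: contraTneq ltba => ->; rewrite ltnn.
exists (- (psign K b (init h :\ b) * psign K a (init h' :\ b))).
rewrite (psign_swap _ ltba bi') psignU_gt ?inE ?(negbTE ai') ?andbF //; last first.
  by move: ai'; rewrite inE => /negbTE ->; rewrite andbF.
split; rewrite /esign.
  transitivity (psign K a (init h' :\ b) * psign K a (init h' :\ b) *
    (psign K b (init h :\ b) * psign K a (init h :\ b))); first by ring.
  by rewrite psign_sqr mul1r.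
transitivity (- (psign K b (init h :\ b) * psign K b (init h :\ b) *
    (psign K b (init h' :\ b) * psign K a (init h' :\ b)))); first by ring.
by rewrite psign_sqr mul1r.
Qed.

Variable v : tens K n m.
Hypothesis v_homog : forall F, v F != 0 -> forall c, #|F c| = H c.
Hypothesis H_le : forall c, (H c <= n)%N.
(** The differential at e, in the direction v, of the quadratic relations between two copies of a
    tensor. *)
Hypothesis v_rel : forall F F' c c' A B, (H c <= H c')%N ->
  \sum_(j in B :\: A) psign K j A * psign K j (B :\ j) *
    (tbas K base (upd F c (j |: A)) * v (upd F' c' (B :\ j)) +
     v (upd F c (j |: A)) * tbas K base (upd F' c' (B :\ j))) = 0.

Lemma tangent_far F : F != base ->
  (forall c a b, between a b (H c) -> F != exch c a b) -> v F = 0.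
Proof.
move=> Fb Fex; apply/eqP; apply: contraT => nz; have hF := v_homog nz.
have [c cF] : exists c, F c != init (H c).
  apply/existsP; rewrite -negb_forall; apply: contra Fb => /forallP h.
  by apply/eqP/ffunP => c; rewrite baseE; apply/eqP/h.
have [i ii iF] := not_init_ex (H_le c) (hF c) cF.
(* The first copy is e with column c opened at i, the second is F with i added. The term j = i
   yields v F; another j would need F to be an exchange for its surviving factor at e to be
   nonzero. *)
have := v_rel base F (init (H c) :\ i) (i |: F c) (leqnn (H c)).
rewrite (bigD1 i) /=; last by rewrite !inE eqxx.
rewrite big1 => [|j /andP[jBA ji]].
  rewrite addr0 setD1K // setU1K // upd_id tbas_upd_base eqxx upd_base_init.
  rewrite (_ : tbas K base F = 0 :> K); last by rewrite ffunE (negbTE Fb).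
  by rewrite mulr0 addr0 mul1r /psign => /eqP; rewrite !mulf_eq0 !signr_eq0 (negbTE nz).
move: jBA; rewrite !inE ji (negbTE ji) /= -leqNgt => /andP[Hj jF].
rewrite tbas_upd_neq ?setU1_neq_init // mul0r add0r.
suff -> : tbas K base (upd F c ((i |: F c) :\ j)) = 0 :> K by rewrite !mulr0.
rewrite ffunE; case: eqP => // e; exfalso; have := Fex c j i; rewrite /between Hj andbT.
move: (ii); rewrite inE => -> /(_ isT)/eqP; apply.
apply/ffunP => d; have [->|dc] := eqVneq d c; last first.
  by rewrite exch_other // -baseE -e updE (negbTE dc).
rewrite exch_col; move/ffunP/(_ c): e; rewrite updE eqxx baseE => <-.
apply/setP => x; rewrite !inE; have [->|xj] := eqVneq x j; first by rewrite jF.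
by have [->|] /= := eqVneq x i; first by rewrite (negbTE iF).
Qed.

(** With b removed from column c and a added to column c', only j = a and j = b contribute: any
    other j lies beyond H c, and a stays in the other column, so neither factor at e survives. *)
Lemma tangent_near c c' a b : (H c <= H c')%N -> between a b (H c) -> between a b (H c') ->
  esign K a b (init (H c)) * v (exch c a b) - esign K a b (init (H c')) * v (exch c' a b) = 0.
Proof.
move=> le bt bt'; have [k [k1 k2]] := esign_exchange bt bt'.
have ltba := between_gt bt; case/andP: (between_in bt) => bi ai.
case/andP: (between_in bt') => bi' ai'.
have ba : b != a by apply: contraTneq ltba => ->; rewrite ltnn.
have := v_rel base base (init (H c) :\ b) (a |: init (H c')) le.
rewrite (bigD1 a) /=; last by move: ai; rewrite !inE eqxx => /negbTE ->; rewrite andbF.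
rewrite (bigD1 b) /=; last by rewrite in_setD setD11 in_setU1 bi' orbT ba.
rewrite big1 => [|j /andP[/andP[jBA ja] jb]].
  have [Ha Ha'] : (H c <= a)%N /\ (H c' <= a)%N by split; [case/andP: bt|case/andP: bt'].
  rewrite !tbas_upd_base (setD1K bi) eqxx (negbTE (setU1_neq_init _ Ha)) (setU1K ai').
  rewrite eqxx !(setU1D1 _ ba) (negbTE (setU1_neq_init _ Ha')).
  rewrite mul0r add0r mulr1 mul1r mulr0 !addr0 => e.
  have := congr1 (fun t => k * t) e.
  by rewrite /= mulr0 mulrDr (mulrA k) k1 (mulrA k) k2 mulNr.
move: jBA; rewrite !inE (negbTE ja) (negbTE jb) /= -leqNgt => /andP[Hj jc'].
rewrite tbas_upd_neq ?setU1_neq_init // mul0r add0r tbas_upd_base.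
rewrite (@setU1D1 a j) // (negbTE (setU1_neq_init _ _)) ?mulr0 //; by case/andP: bt'.
Qed.

End ExchangeRelations.

Section TangentSpace.
Variables (K : numFieldType) (n : nat) (a : part n).
Local Notation T := (tens K n (cols a)).
Local Notation H := (@colh n a).
Local Notation e0 := (tbas K (base n H)).
Variables (SV : {vspace T}) (hSV : schur_module SV).

Lemma flag_coneP (y : T) : flag_cone SV y <->
  exists g c, [/\ g \in unitmx, c != 0 & y = c *: tens_act g e0].
Proof.
have [hom _ [v0 v0S hw0]] := hSV; split=> [[v [g [c [vS hw gu c0 ->]]]]|[g [c [gu c0 ->]]]].
  have [] := hw_vector_base (hom _ vS) hw; set t := v _ => ve nz.
  exists g, (c * t); split=> //; first by rewrite mulf_neq0.
  by rewrite ve linearZ /= scalerA.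
have [] := hw_vector_base (hom _ v0S) hw0; set t := v0 _ => ve nz.
exists v0, g, (c / t); split=> //; first by rewrite mulf_neq0 ?invr_eq0.
by rewrite ve linearZ /= scalerA mulfVK.
Qed.

Lemma flag_cone_sv y : flag_cone SV y -> y \in SV.
Proof.
by case/flag_coneP => g [c [gu c0 ->]]; rewrite memvZ // sv_act // base_sv.
Qed.

(** An equation of the cone vanishes along the curve for almost all s, hence identically in K[t];
    its coefficient of t is the differential applied to the velocity. *)
Lemma tangent_curve (y : tens {poly K} n (cols a)) (d : {poly K}) : d != 0 ->
  (forall s, d.[s] != 0 -> tev s y = 0 \/ flag_cone SV (tev s y)) ->
  tangent SV (tcoefp 0 y) (tcoefp 1 y).
Proof.
move=> d0 h; split=> [|f f0].
  apply: (curve_coef_mem d0) => s /h[->|/flag_cone_sv //]; exact: mem0v.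
have P0 : mmap polyC (fun i => y (enum_val i) : {poly K}) f = 0.
  apply: (poly_zero_of_values d0) => s /h /f0; rewrite mmap_poly_horner => e.
  rewrite -[RHS]e; apply: meval_eq => i; by rewrite /coords ffunE.
have [_ /esym] := mmap_poly_coef f (fun i => y (enum_val i) : {poly K}).
rewrite P0 coef0 => e; rewrite -[RHS]e; apply: eq_bigr => i _; congr (_ * _).
  by apply: meval_eq => j; rewrite /coords ffunE.
by rewrite /coords ffunE.
Qed.

Lemma tangent_self p : flag_cone SV p -> tangent SV p p.
Proof.
move=> hp; pose y : tens {poly K} n (cols a) := [ffun F => (p F)%:P * (1 + 'X) : {poly K}^o].
have y0 : tcoefp 0 y = p.
  by apply/ffunP => F; rewrite !ffunE coefCM coefD coef1 coefX addr0 mulr1.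
have y1 : tcoefp 1 y = p.
  by apply/ffunP => F; rewrite !ffunE coefCM coefD coef1 coefX add0r mulr1.
rewrite -{1}y0 -{1}y1; apply: (@tangent_curve y 1); first exact: oner_neq0.
move=> s _; have -> : tev s y = (1 + s) *: p.
  by apply/ffunP => F; rewrite ffZ !ffunE hornerM hornerC hornerD hornerX hornerC mulrC.
have [->|s0] := eqVneq (1 + s) 0; [by left; rewrite scale0r | right].
case/flag_coneP: hp => g [c [gu c0 ->]]; apply/flag_coneP.
by exists g, ((1 + s) * c); rewrite scalerA mulf_neq0.
Qed.

Lemma tangent_tderiv p xi : flag_cone SV p -> tangent SV p (tderiv xi p).
Proof.
move=> hp; have y0 : tcoefp 0 (tens_act (gcurve xi) (tpoly p)) = p.
  apply/ffunP => F; rewrite ffunE -horner_coef0.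
  have := tev_curve 0 xi p; rewrite scale0r subr0 tens_act1 => /ffunP/(_ F) <-.
  by rewrite [RHS]ffunE.
rewrite -{1}y0; apply: (tangent_curve (det_gcurve xi)) => s /gcurve_unit us; right.
rewrite tev_curve; case/flag_coneP: hp => g [c [gu c0 ->]]; apply/flag_coneP.
exists ((1%:M - s *: xi) *m g), c; rewrite unitmx_mul us gu c0.
by rewrite tens_actM linearZ.
Qed.

Variables (p : T) (g0 : 'M[K]_n) (c0 : K).
Hypotheses (g0u : g0 \in unitmx) (c0n0 : c0 != 0) (pE : p = c0 *: tens_act g0 e0).

Lemma pullback_base x : pairing x p = 0 -> tens_act g0^T x (base n H) = 0.
Proof.
rewrite pE pairingZr => /eqP; rewrite mulf_eq0 (negbTE c0n0) /= -pairing_tbas pairing_act trmxK.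
by move/eqP.
Qed.

Lemma pairing_tderiv_pullback x xi :
  c0 * pairing (tens_act g0^T x) (tderiv xi e0) =
  pairing x (tderiv (g0 *m xi *m invmx g0) p).
Proof.
rewrite pairing_act trmxK pE linearZ /= pairingZr (@tderiv_act _ _ _ _ _ xi) //.
by rewrite mulmxKV.
Qed.

Lemma pullback_exch x : (forall xi, pairing x (tderiv xi p) = 0) -> forall a' b' : 'I_n, (b' < a')%N ->
  \sum_(c | between a' b' (H c)) esign K a' b' (init n (H c)) * tens_act g0^T x (exch H c a' b') = 0.
Proof.
move=> h a' b' lt; have := pairing_tderiv_pullback x (delta_mx a' b').
rewrite h pairing_tderiv_exch // => /eqP; rewrite mulf_eq0 (negbTE c0n0) oppr_eq0.
by move/eqP.
Qed.

(** The inclusion that needs equations of the cone. Everything is pulled back to e by [g0]; the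
    quadrics provide the hypothesis [v_rel] for v', and [sum_exchange] is applied to the coordinates
    of v' with Q the condition of being 0. *)
Lemma tangent_perp x v : pairing x p = 0 -> (forall xi, pairing x (tderiv xi p) = 0) ->
  tangent SV p v -> pairing x v = 0.
Proof.
move=> xp xd [vS vt]; pose v' := tens_act (invmx g0) v.
have v'S : v' \in SV by apply: sv_act; rewrite // unitmx_inv.
have vE : v = tens_act g0 v' by rewrite /v' -tens_actM mulmxV // tens_act1.
rewrite vE -[g0]trmxK -pairing_act pairingE.
have p' : tens_act (invmx g0) p = c0 *: e0.
  by rewrite pE linearZ /= -tens_actM mulVmx // tens_act1.
have rel F F' c c' A B : (H c <= H c')%N ->
  \sum_(j in B :\: A) psign K j A * psign K j (B :\ j) *
    (e0 (upd F c (j |: A)) * v' (upd F' c' (B :\ j)) +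
     v' (upd F c (j |: A)) * e0 (upd F' c' (B :\ j))) = 0.
  move=> le; pose N := #|{ffun 'I_(cols a) -> {set 'I_n}}|.
  (* The F-th coordinate after pulling back by [g0], as a linear polynomial in the original
     coordinates. *)
  pose Y F : {mpoly K[N]} := \sum_E (tcoef (invmx g0) E F)%:MP * 'X_(enum_rank E).
  have YE x' F1 : (Y F1).@[coords x'] = tens_act (invmx g0) x' F1.
    rewrite /Y raddf_sum tens_actE; apply: eq_bigr => E _ /=.
    by rewrite mevalM mevalC mevalXU /coords enum_rankK mulrC.
  have YD F1 : mdir (coords p) (coords v) (Y F1) = v' F1.
    rewrite /Y /v' tens_actE; elim/big_rec2: _ => [|E u y _ <-]; first exact: (mdirC _ _ 0).
    rewrite mdirD mdirM mdirC mdirX mul0r addr0 mevalC /coords enum_rankK; congr (_ + _).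
    by rewrite mulrC.
  pose f := \sum_(j in B :\: A) (psign K j A * psign K j (B :\ j))%:MP *
     (Y (upd F c (j |: A)) * Y (upd F' c' (B :\ j))).
  have f0 x' : x' = 0 \/ flag_cone SV x' -> f.@[coords x'] = 0.
    rewrite /f raddf_sum /=; under eq_bigr => j _ do rewrite !mevalM mevalC !YE.
    case=> [->|/flag_coneP[g [c1 [gu c10 ->]]]].
      by rewrite big1 // => j _; rewrite linear0 !ffunE !mulr0.
    have := tcoef_plucker2 (invmx g0 *m g) F F' A B (E := base n H) (c := c) (c' := c') _.
    rewrite !baseE => /(_ (init_sub n le)) e.
    transitivity (c1 * c1 * 0); last by rewrite mulr0.
    rewrite -[X in _ = _ * X]e mulr_sumr; apply: eq_bigr => j _.
    by rewrite linearZ /= !ffZ -tens_actM !tens_act_tbas; ring.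
  have := vt f f0; rewrite -/(mdir _ _ _).
  have -> : mdir (coords p) (coords v) f = c0 * \sum_(j in B :\: A)
     psign K j A * psign K j (B :\ j) *
    (e0 (upd F c (j |: A)) * v' (upd F' c' (B :\ j)) +
     v' (upd F c (j |: A)) * e0 (upd F' c' (B :\ j))).
    rewrite /f mulr_sumr; elim/big_rec2: _ => [|j u y _ <-]; first exact: (mdirC _ _ 0).
    rewrite mdirD mdirM mdirC mul0r addr0 mevalC mdirM !YD !YE p' !ffZ; congr (_ + _); ring.
  by move/eqP; rewrite mulf_eq0 (negbTE c0n0) => /eqP.
apply: (@sum_exchange _ _ _ H K^o (fun t => t = 0) v' (tens_act g0^T x)) => //.
- by move=> t u w -> ->; rewrite scaler0 addr0.
- exact: pullback_base.
- exact: pullback_exch.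
- by move=> F Fb Fex; apply: (tangent_far (sv_homog hSV v'S) (@colh_le n a) rel Fb Fex).
- by move=> c c' a' b' le bt bt'; apply: (tangent_near rel le bt bt').
Qed.

End TangentSpace.

(** * Cartan projection *)

Section Blocks.
Variables (n : nat) (a : part n).
Local Notation H := (@colh n a).

Lemma conj_partE : conj_part a = [seq H c | c <- enum 'I_(cols a)].
Proof.
rewrite (_ : map H _ = map (fun c => count (fun r => c < r)%N a) (map val (enum 'I_(cols a)))).
  by rewrite val_enum_ord.
by rewrite -map_comp; apply: eq_map => c; rewrite colhE.
Qed.

Lemma mem_heights h : (h \in heights a) = (h \in conj_part a).
Proof. by rewrite /heights mem_sort mem_undup. Qed.

Lemma colh_heights c : H c \in heights a.
Proof. by rewrite mem_heights conj_partE map_f // mem_enum. Qed.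

Lemma blk_subproof c : (index (H c) (heights a) < nblocks a)%N.
Proof. by rewrite index_mem colh_heights. Qed.

Definition blk (c : 'I_(cols a)) : 'I_(nblocks a) := Ordinal (blk_subproof c).

Lemma height_blk c : height (blk c) = H c.
Proof. by rewrite /height nth_index ?colh_heights. Qed.

Lemma heights_uniq : uniq (heights a).
Proof. by rewrite sort_uniq undup_uniq. Qed.

Lemma height_inj : injective (@height a).
Proof.
by move=> i j /eqP; rewrite /height nth_uniq ?heights_uniq // => /eqP/val_inj.
Qed.

Lemma eq_blk c i : (blk c == i) = (H c == height i).
Proof. by rewrite -height_blk (inj_eq height_inj). Qed.

Lemma card_blk i : #|[pred c | blk c == i]| = mult i.
Proof.
rewrite /mult conj_partE count_map cardE size_filter -enumT.
by apply: eq_count => c; rewrite /= -eq_blk.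
Qed.

Lemma height_ex i : exists c, blk c = i.
Proof.
have : height i \in conj_part a by rewrite -mem_heights mem_nth.
by rewrite conj_partE => /mapP[c _ e]; exists c; apply/eqP; rewrite eq_blk e.
Qed.

Lemma height_lt (i j : 'I_(nblocks a)) : (i < j)%N -> (@height a i < @height a j)%N.
Proof.
move=> ij; rewrite /height; have srt : sorted ltn (heights a).
  by rewrite ltn_sorted_uniq_leq heights_uniq sort_sorted //; apply: leq_total.
by apply: (sorted_ltn_nth ltn_trans 0%N srt); rewrite ?inE ?ltn_ord.
Qed.

End Blocks.

Section CoordinateRing.
Variables (K : numFieldType) (n : nat) (a : part n).
Local Notation T := (tens K n (cols a)).
Local Notation H := (@colh n a).
Local Notation e0 := (tbas K (base n H)).
Local Notation R := (coord_ring K n a).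
Local Notation blk := (@blk n a).
Local Notation NV := #|{: plucker_var n a}|.

Lemma lin_form_sum i (l : ext K n) :
  lin_form i l = \sum_S l S *: lin_form i (ebas K S) :> R.
Proof.
rewrite /lin_form; under [RHS]eq_bigr => S _ do rewrite scaler_sumr.
rewrite exchange_big; apply: eq_bigr => x _ /=.
rewrite (bigD1 (val x).2) //= big1 => [|S /negbTE ne]; rewrite ffunE ?eqxx.
  by rewrite scale1r addr0.
by rewrite eq_sym ne scale0r scaler0.
Qed.

(** Indexed by columns although the ring is graded by blocks: permuting F within a block gives the
    same monomial, and sets of the wrong size give 0. *)
Definition pmono (F : {ffun 'I_(cols a) -> {set 'I_n}}) : R :=
  \prod_c lin_form (blk c) (ebas K (F c)).

Lemma lin_form_homog0 (i : 'I_(nblocks a)) (S : {set 'I_n}) : #|S| != height i -> lin_form i (ebas K S) = 0 :> R.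
Proof.
move=> ne; rewrite /lin_form big1 // => x /eqP xi; rewrite ffunE.
case: eqP => [e|]; last by rewrite scale0r.
by case/eqP: ne; rewrite -e -xi (eqP (valP x)).
Qed.

Lemma lin_form_var (x : plucker_var n a) i : (val x).1 = i ->
  lin_form i (ebas K (val x).2) = 'X_(enum_rank x) :> R.
Proof.
move=> xi; rewrite /lin_form (bigD1 x) ?xi //= ffunE eqxx scale1r big1 ?addr0 //.
move=> y /andP[/eqP yi ne]; rewrite ffunE; case: eqP => [e|]; last by rewrite scale0r.
by case/eqP: ne; apply: val_inj; rewrite [val y]surjective_pairing [val x]surjective_pairing xi yi e.
Qed.

Lemma prod_lin_form (x : 'I_(cols a) -> ext K n) :
  \prod_c lin_form (blk c) (x c) = \sum_(F : {ffun 'I_(cols a) -> {set 'I_n}}) (\prod_c x c (F c) : K) *: pmono F :> R.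
Proof.
under eq_bigr => c _ do rewrite lin_form_sum.
rewrite bigA_distr_bigA; apply: eq_bigr => F _ /=.
by rewrite scaler_prod.
Qed.

Definition hasdeg (D : 'I_(nblocks a) -> nat) (f : R) := forall w, w \in msupp f ->
  forall i, (\sum_(x : plucker_var n a | (val x).1 == i) w (enum_rank x))%N = D i.

Lemma hasdeg_lin D (t : K) f g : hasdeg D f -> hasdeg D g -> hasdeg D (t *: f + g).
Proof.
move=> hf hg w /msuppD_le; rewrite mem_cat => /orP[/msuppZ_le|]; [exact: hf | exact: hg].
Qed.

Lemma hasdeg0 D : hasdeg D 0.
Proof. by move=> w; rewrite msupp0. Qed.

Lemma hasdegM D D' f g : hasdeg D f -> hasdeg D' g -> hasdeg (fun i => D i + D' i)%N (f * g).
Proof.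
move=> hf hg w /msuppM_le/allpairsP[[u v] /= [uf vg ->]] i.
rewrite -(hf u uf i) -(hg v vg i) -big_split; apply: eq_bigr => x _ /=.
by rewrite mnmDE.
Qed.

Lemma hasdeg_form i l : hasdeg (fun j => (i == j) : nat) (lin_form i l).
Proof.
rewrite /lin_form; apply: (big_ind (hasdeg _)); first exact: hasdeg0.
  by move=> f g hf hg; rewrite -[f]scale1r; apply: hasdeg_lin.
move=> x /eqP xi w /msuppZ_le; rewrite msuppX inE => /eqP -> j.
have [<-|ne] := eqVneq i j.
  rewrite (bigD1 x) ?xi //= mnm1E eqxx big1 // => y /andP[_ yx].
  by rewrite mnm1E (inj_eq enum_rank_inj) eq_sym (negbTE yx).
rewrite big1 // => y /eqP yj; rewrite mnm1E (inj_eq enum_rank_inj).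
by case: eqP => // e; move: ne; rewrite -xi -yj e eqxx.
Qed.

Lemma multidegree_prod (x : 'I_(cols a) -> ext K n) :
  multidegree K n a (\prod_c lin_form (blk c) (x c)).
Proof.
suff h r : hasdeg (fun i => count (fun c => blk c == i) r) (\prod_(c <- r) lin_form (blk c) (x c)).
  move=> w /h h' i; rewrite h' -card_blk cardE size_filter -enumT.
  by rewrite -deprecated_filter_index_enum ?filter_predT.
elim: r => [|c r IH].
  rewrite big_nil => w; rewrite msupp1 inE => /eqP -> i.
  by rewrite big1 // => y _; rewrite mnm0E.
by rewrite big_cons; apply: hasdegM IH; apply: hasdeg_form.
Qed.

Lemma multidegree_lin (t : K) f g : multidegree K n a f -> multidegree K n a g ->
  multidegree K n a (t *: f + g).
Proof. exact: (@hasdeg_lin (@mult a)). Qed.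

Lemma multidegree_pmono F : multidegree K n a (pmono F).
Proof. exact: multidegree_prod. Qed.

Lemma multidegree_span f : multidegree K n a f ->
  exists al : {ffun 'I_(cols a) -> {set 'I_n}} -> K, f = \sum_F al F *: pmono F.
Proof.
(* C is the set of columns still to be filled: for c in C some variable of its block is left in w,
   and it is assigned to c. *)
move=> hf; have mono (C : {set 'I_(cols a)}) (w : 'X_{1.. NV}) :
    (forall i, \sum_(x : plucker_var n a | (val x).1 == i) w (enum_rank x) =
       #|[set c in C | blk c == i]|)%N ->
    exists F : {ffun 'I_(cols a) -> {set 'I_n}},
      'X_[w] = \prod_(c in C) lin_form (blk c) (ebas K (F c)) :> R.
  have [k] := ubnP #|C|; elim: k C w => // k IH C w ltCk hw.
  have [C0|/set0Pn[c cC]] := eqVneq C set0.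
    exists [ffun=> set0]; rewrite C0 big_set0 (_ : w = 0%MM) ?mpolyX0 //.
    apply/mnmP => j; rewrite mnm0E -(enum_valK j); move: (hw (val (enum_val j)).1).
    rewrite C0 (_ : [set c in set0 | _] = set0) ?cards0; last by apply/setP => c; rewrite !inE.
    by move/eqP; rewrite sum_nat_eq0 => /forallP/(_ (enum_val j)); rewrite eqxx => /eqP.
  have [x /andP[/eqP xc wx]] : exists x : plucker_var n a,
      ((val x).1 == blk c) && (0 < w (enum_rank x))%N.
    apply/existsP; apply: contraT => /existsPn h.
    have := hw (blk c); rewrite big1 => [/esym/eqP|x xc].
      by rewrite cards_eq0 => /eqP/setP/(_ c); rewrite !inE cC eqxx.
    by have := h x; rewrite xc /= lt0n negbK => /eqP.
  pose w' := (w - U_(enum_rank x))%MM.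
  have wE : w = (w' + U_(enum_rank x))%MM.
    rewrite submK //; apply/mnm_lepP => j; rewrite mnm1E.
    by case: eqP => [<-|].
  have [||F hF] := IH (C :\ c) w'.
  - by move: ltCk; rewrite (cardsD1 c C) cC.
  - move=> i; have := hw i; rewrite wE.
    under eq_bigr => y _ do rewrite mnmDE mnm1E (inj_eq enum_rank_inj).
    rewrite big_split /=.
    have -> : (\sum_(y : plucker_var n a | (val y).1 == i) (x == y) = (blk c == i))%N.
      rewrite -xc; have [e|ne] := eqVneq (val x).1 i.
        rewrite (bigD1 x) ?e //= eqxx big1 // => y /andP[_ yx].
        by rewrite eq_sym (negbTE yx).
      by rewrite big1 // => y /eqP yi; case: eqP => // e; rewrite e yi eqxx in ne.
    rewrite (cardsD1 c [set d in C | blk d == i]) !inE cC /= addnC => /addnI ->.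
    by apply: eq_card => d; rewrite !inE andbA.
  exists (upd F c (val x).2); rewrite (big_setD1 c cC) /= updE eqxx lin_form_var // wE mpolyXD hF mulrC.
  congr (_ * _); apply: eq_bigr => d; rewrite !inE updE => /andP[/negbTE -> _] //.
pose P f := exists al : {ffun 'I_(cols a) -> {set 'I_n}} -> K, f = \sum_F al F *: pmono F.
have PD f1 f2 : P f1 -> P f2 -> P (f1 + f2).
  case=> [al1 ->] [al2 ->]; exists (fun F => al1 F + al2 F); rewrite -big_split.
  by apply: eq_bigr => F _ /=; rewrite scalerDl.
rewrite -/(P f) [f]mpolyE big_seq; apply: (big_ind P _ PD) => [|w wf].
  by exists (fun=> 0); rewrite big1 // => F _; rewrite scale0r.
have [i|F ->] := mono setT w.
  by rewrite (hf w wf i) -card_blk; apply: eq_card => c; rewrite !inE.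
exists (fun G => if G == F then f@_w else 0); rewrite [in RHS](bigD1 F) //= eqxx [X in _ = _ + X]big1 ?addr0.
  by congr (_ *: _); apply: eq_bigl => c; rewrite inE.
by move=> G /negbTE ->; rewrite scale0r.
Qed.

End CoordinateRing.

Section CartanProjection.
Variables (K : numFieldType) (n : nat) (a : part n).
Local Notation T := (tens K n (cols a)).
Local Notation H := (@colh n a).
Local Notation base := (base n H).
Local Notation e0 := (tbas K base).
Local Notation R := (coord_ring K n a).
Local Notation blk := (@blk n a).
Implicit Types F : {ffun 'I_(cols a) -> {set 'I_n}}.

Lemma ring_act_pmono (g : 'M[K]_n) F : (forall c, #|F c| = H c) ->
  ring_act g (pmono K F : R) = \prod_c lin_form (blk c) (ext_act_basis (invmx g)^T (F c)).
Proof.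
move=> hF; rewrite /ring_act /pmono rmorph_prod; apply: eq_bigr => c _ /=.
have xP : #|(blk c, F c).2| == height (blk c, F c).1 by rewrite height_blk hF.
rewrite (@lin_form_var K n a (Sub (blk c, F c) xP)) ?SubK //.
by rewrite comp_mpolyXU -tnth_nth tnth_mktuple enum_rankK SubK.
Qed.

Lemma ring_act_pmono_sum (g : 'M[K]_n) F : (forall c, #|F c| = H c) ->
  ring_act g (pmono K F : R) = \sum_E tcoef (invmx g)^T F E *: pmono K E.
Proof. by move=> hF; rewrite ring_act_pmono // prod_lin_form. Qed.

Lemma pmono_homog0 F c : #|F c| != H c -> pmono K F = 0 :> R.
Proof.
by move=> ne; rewrite /pmono (bigD1 c) //= lin_form_homog0 ?mul0r // height_blk.
Qed.

Lemma pmonoP F : (forall c, #|F c| = H c) \/ pmono K F = 0 :> R.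
Proof.
have [/forallP h|] := boolP [forall c, #|F c| == H c]; first by left=> c; apply/eqP.
by rewrite negb_forall => /existsP[c] ne; right; apply: pmono_homog0 ne.
Qed.

Variables (SV : {vspace T}) (hSV : schur_module SV).
Variable pi : {linear R -> T}.
Hypothesis hpi : cartan_projection SV pi.

Lemma pi_mem f : multidegree K n a f -> pi f \in SV.
Proof.
case: hpi => _ e _ hf; have /= E := congr1 (fun S => S (pi f)) e.
by move: E; rewrite /classical_sets.mkset => <-; exists f.
Qed.

Lemma pi_surj phi : phi \in SV -> exists2 f, multidegree K n a f & pi f = phi.
Proof.
case: hpi => _ e _ hphi; have /= E := congr1 (fun S => S phi) e.
have : (phi \in SV) : Prop by [].
by move: E; rewrite /classical_sets.mkset => <- [f hf ef]; exists f.
Qed.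

Lemma pi_equiv g f : g \in unitmx -> multidegree K n a f ->
  pi (ring_act g f) = dual_act g (pi f).
Proof. by case: hpi => _ _; apply. Qed.

(** The scale of [pi], which equivariance leaves free. *)
Definition kappa : K := pi (pmono K base) base.

(** The monomial of F has the weight of F, so by equivariance its image has a nonzero coordinate at
    [base] only if F has the weight of [base]; then [wt_base] applies. *)
Lemma pi_pmono_base F : pi (pmono K F) base = kappa * (F == base)%:R.
Proof.
have [->|Fb] := eqVneq F base; first by rewrite mulr1.
rewrite mulr0; have [hF|->] := pmonoP F; last by rewrite linear0 ff0.
apply/eqP; apply: contraNT Fb => nz; apply/eqP.
apply: (@wt_base n (cols a) H) => [c|c|i]; [exact: colh_le|exact: hF|].
have two : (2 : K) != 0 by rewrite pnatr_eq0.
have gu : invmx (torus i (2 : K)) \in unitmx by rewrite unitmx_inv torus_unit.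
have := congr1 (fun t : T => t base) (pi_equiv gu (@multidegree_pmono K n a F)).
rewrite /dual_act invmxK torus_tr tens_act_torus ring_act_pmono_sum // invmxK torus_tr.
rewrite (bigD1 F) //= big1 => [|E EF]; last first.
  by rewrite tcoef_torus (negbTE EF) mul0r scale0r.
rewrite addr0 tcoef_torus eqxx mul1r linearZ /= ffZ => /(mulIf nz) /exp2_inj.
by [].
Qed.

(** Moved to the left, g acts on the monomial; the coordinate at [base] then picks the coefficient
    of the monomial of [base], which is the F-th coordinate of g e. *)
Lemma pairing_pi_orbit F g : g \in unitmx ->
  pairing (pi (pmono K F)) (tens_act g e0) = kappa * tens_act g e0 F.
Proof.
move=> gu; have [/forallP hF|] := boolP [forall c, #|F c| == H c]; last first.
  rewrite negb_forall => /existsP[c ne]; rewrite (pmono_homog0 ne) linear0 pairing0l.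
  rewrite tens_act_tbas; apply/esym/eqP; rewrite mulf_eq0; apply/orP; right.
  apply: contraT => /tcoef_homog/(_ c) e; move: ne.
  by rewrite e baseE card_init ?colh_le // eqxx.
have {}hF c : #|F c| = H c by apply/eqP.
have dE : dual_act (invmx g) (pi (pmono K F)) = tens_act g^T (pi (pmono K F)).
  by rewrite /dual_act invmxK.
rewrite -[g in LHS]trmxK -pairing_act pairing_tbas -dE -pi_equiv ?unitmx_inv //; last first.
  exact: multidegree_pmono.
rewrite ring_act_pmono_sum // invmxK linear_sum ffsum.
under eq_bigr => E _ do rewrite linearZ /= ffZ pi_pmono_base.
rewrite (bigD1 base) //= big1 => [|E /negbTE ->]; last by rewrite !mulr0.
by rewrite eqxx addr0 mulr1 mulrC tcoef_tr tens_act_tbas.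
Qed.

Lemma pairing_pi F v : v \in SV -> pairing (pi (pmono K F)) v = kappa * v F.
Proof.
move: v; apply: (orbit_ind hSV) => [|t u v eu ev|g gu].
- by rewrite linear0 ff0 mulr0.
- by rewrite pairing_lin eu ev ffD ffZ; ring.
- exact: pairing_pi_orbit.
Qed.

(** Otherwise all images would have coordinate 0 at [base], but e is an image. *)
Lemma kappa_neq0 : kappa != 0.
Proof.
have [f /multidegree_span[al ->] e] := pi_surj (base_sv hSV).
have := congr1 (fun t : T => t base) e; rewrite linear_sum ffsum ffunE eqxx.
apply: contra_eqN => /eqP k0; rewrite big1 1?eq_sym ?oner_eq0 // => F _.
by rewrite linearZ /= ffZ pi_pmono_base k0 mul0r mulr0.
Qed.

(** The vector of SV that represents the coordinate form v -> v_F under the pairing. *)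
Definition qvec F : T := kappa^-1 *: pi (pmono K F).

Lemma qvec_sv F : qvec F \in SV.
Proof. by rewrite memvZ // pi_mem //; apply: multidegree_pmono. Qed.

Lemma pairing_qvec F v : v \in SV -> pairing (qvec F) v = v F.
Proof.
by move=> vS; rewrite pairingZl pairing_pi // mulrA mulVf ?kappa_neq0 // mul1r.
Qed.

Lemma sv_qvec x : x \in SV -> x = \sum_F x F *: qvec F.
Proof.
move=> xS; apply/eqP; rewrite -subr_eq0; apply/eqP; apply: (sv_nondeg hSV).
  by rewrite memvB // memv_suml // => F _; rewrite memvZ // qvec_sv.
move=> v vS; rewrite -scaleN1r addrC pairing_lin_l mulN1r; apply/eqP.
rewrite addrC subr_eq0; apply/eqP; rewrite [RHS]pairingC linear_sum pairingE.
apply: eq_bigr => F _; by rewrite linearZ /= pairingC pairing_qvec.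
Qed.

Lemma qvec_plucker F c c' (A B : {set 'I_n}) : (H c <= H c')%N -> c != c' ->
  \sum_(j in B :\: A) (psign K j A * psign K j (B :\ j)) *:
     qvec (upd (upd F c (j |: A)) c' (B :\ j)) = 0.
Proof.
move=> le cc'; apply: (sv_nondeg hSV) => [|v].
  by rewrite memv_suml // => j _; rewrite memvZ // qvec_sv.
move: v; apply: (orbit_ind hSV) => [|t u v eu ev|g gu].
- by rewrite linear0.
- by rewrite pairing_lin eu ev mulr0 addr0.
- have := @tcoef_plucker1 K n _ g base F c c' A B _ cc'; rewrite !baseE init_sub // => /(_ isT) e.
  rewrite pairingC linear_sum -[RHS]e; apply: eq_bigr => j _.
  by rewrite linearZ /= pairingC pairing_qvec ?sv_act ?base_sv // tens_act_tbas.
Qed.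

End CartanProjection.

(** * Double point ideal *)

Lemma ext_power_line (K : fieldType) n (V : {vspace 'cV[K]_n}) :
  exists w, forall y, y \in ext_power (\dim V) V -> exists t, y = t *: w.
Proof.
exists (wdg (fun i : 'I_(\dim V) => (vbasis V)`_i) (enum setT)) => y yV; apply/vlineP.
suff /subvP : (ext_power (\dim V) V <=
    <[wdg (fun i : 'I_(\dim V) => (vbasis V)`_i) (enum setT)]>)%VS by apply.
apply/subv_sumP => t _; rewrite -memvE.
have [S [c []]] := wdg_any (fun i : 'I_(\dim V) => (vbasis V)`_i : 'cV[K]_n) t.
rewrite /wdg => -> hS; have [->|/hS cS] := eqVneq c 0; first by rewrite scale0r mem0v.
suff -> : S = setT by rewrite memvZ // memv_line.
by apply/eqP; rewrite eqEcard subsetT cS size_tuple cardsT card_ord /=.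
Qed.

Section PointIdeal.
Variables (K : numFieldType) (n : nat) (a : part n).
Local Notation T := (tens K n (cols a)).
Local Notation H := (@colh n a).
Local Notation base := (base n H).
Local Notation e0 := (tbas K base).
Local Notation R := (coord_ring K n a).
Local Notation blk := (@blk n a).
Implicit Types F : {ffun 'I_(cols a) -> {set 'I_n}}.

Variables (p : T) (g0 : 'M[K]_n) (c0 : K).
Hypotheses (g0u : g0 \in unitmx) (c0n0 : c0 != 0) (pE : p = c0 *: tens_act g0 e0).
Variable W : 'I_(nblocks a) -> {vspace 'cV[K]_n}.
Hypotheses (hW : is_flag W) (hpW : represents p W).

Definition pl (g : 'M[K]_n) (i : 'I_(nblocks a)) := ext_act_basis g (init n (height i)).

(** p is a pure tensor in two ways, from the flag and from the orbit. Freezing the other columns at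
    a nonzero coordinate of p shows that the factors in column c are proportional. *)
Lemma pl_in_ext_power i : pl g0 i \in ext_power (height i) (W i).
Proof.
have [c <-] := height_ex i; case: hpW => p0 [x px hx].
have [F pF] : exists F, p F != 0.
  apply/existsP; apply: contraNT p0 => /existsPn h; apply/eqP/ffunP => F.
  by rewrite ff0; apply/eqP; rewrite -[_ == _]negbK h.
pose r := \prod_(d | d != c) (x d (F d) : K).
pose r' := \prod_(d | d != c) (ext_act_basis g0 (base d) (F d) : K).
have e1 S : p (upd F c S) = x c S * r.
  rewrite px ffunE (bigD1 c) //= updE eqxx; congr (_ * _).
  by apply: eq_bigr => d /negbTE dc; rewrite updE dc.
have e2 S : p (upd F c S) = c0 * r' * pl g0 (blk c) S.
  rewrite pE ffZ tens_act_tbas tcoef_upd baseE /pl height_blk -mulrA; congr (_ * _).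
  by rewrite mulrC.
have nz : c0 * r' != 0.
  by apply: contraNneq pF => z; rewrite -(upd_id F c) e2 z mul0r.
have -> : pl g0 (blk c) = (r / (c0 * r')) *: x c.
  apply/ffunP => S; rewrite ffZ mulrAC [r * _]mulrC -e1 e2.
  by rewrite mulrAC mulfV ?mul1r.
by rewrite memvZ // hx // height_blk.
Qed.

Lemma pl_neq0 i : pl g0 i != 0.
Proof.
apply/eqP => /(congr1 (ext_act (invmx g0))).
rewrite linear0 /pl -ext_act_basisM mulVmx // ext_act_basis1 => /ffunP/(_ (init n (height i))).
by rewrite !ffunE eqxx => /eqP; rewrite oner_eq0.
Qed.

Lemma ext_power_pl i w : w \in ext_power (height i) (W i) -> exists t, w = t *: pl g0 i.
Proof.
case: hW => dW _; have [v] := ext_power_line (W i); rewrite dW => hv.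
have [s es] := hv _ (pl_in_ext_power i) => /hv[t ->].
have s0 : s != 0 by apply: contraNneq (pl_neq0 i) => s0; rewrite es s0 scale0r.
by exists (t / s); rewrite es scalerA mulfVK.
Qed.

(** The translated covector pairs with g0 e_[0,h) as e_S^* does with e_[0,h), hence to zero. *)
Lemma point_ideal_form c (S : {set 'I_n}) : #|S| = H c -> S != init n (H c) ->
  point_ideal W (lin_form (blk c) (ext_act_basis (invmx g0)^T S) : R).
Proof.
move=> cS ne; set f := lin_form _ _; exists [:: (1, f)]; last by rewrite big_seq1 mul1r.
move=> x; rewrite inE => /eqP -> /=; exists (blk c), (ext_act_basis (invmx g0)^T S); split=> //.
  by move=> U /ext_act_basis_homog ->; rewrite height_blk.
move=> w /ext_power_pl[t ->].
transitivity (t * epair (ext_act (invmx g0)^T (ebas K S)) (pl g0 (blk c))).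
  rewrite ext_act_ebas /epair mulr_sumr; apply: eq_bigr => U _; rewrite ffZ; ring.
rewrite -epair_act /pl -ext_act_basisM mulVmx // ext_act_basis1 epair_ebas height_blk ffunE.
by rewrite eq_sym (negbTE ne) mulr0.
Qed.

Lemma double_point_pmono F c c' : (forall d, #|F d| = H d) -> c != c' ->
  F c != init n (H c) -> F c' != init n (H c') ->
  double_point_ideal W (ring_act g0 (pmono K F : R)).
Proof.
move=> hF cc' Fc Fc'; rewrite ring_act_pmono // (bigD1 c) //= (bigD1 c') 1?eq_sym //=.
set l := lin_form _ _; set l' := lin_form _ _; set r := \prod_(_ | _) _.
exists [:: (r, l * l')]; last by rewrite big_seq1 /= mulrA mulrC.
move=> x; rewrite inE => /eqP -> /=; exists l, l'; split=> //; exact: point_ideal_form.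
Qed.

(** The value of f at a K[t]-point of the product of exterior powers. The components of Z need not
    be decomposable: the curve lives in X_lambda and may leave the flag variety. *)
Definition ev (Z : 'I_(nblocks a) -> ext {poly K} n) (f : R) : {poly K} :=
  mmap polyC (fun j => let x := val (enum_val j) in Z x.1 x.2) f.

Lemma evM Z f g : ev Z (f * g) = ev Z f * ev Z g.
Proof. by rewrite /ev rmorphM. Qed.

Lemma ev_sum Z (I : Type) (r : seq I) (P : pred I) (f : I -> R) :
  ev Z (\sum_(i <- r | P i) f i) = \sum_(i <- r | P i) ev Z (f i).
Proof. by rewrite /ev raddf_sum. Qed.

Section Evaluation.
Variable Z : 'I_(nblocks a) -> ext {poly K} n.
Hypothesis Z_homog : forall i S, Z i S != 0 -> #|S| = height i.

Lemma ev_form i l : ev Z (lin_form i l) = \sum_S (l S : K)%:P * (Z i S : {poly K}).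
Proof.
rewrite lin_form_sum /ev raddf_sum; apply: eq_bigr => S _ /=.
rewrite mmapZ; congr (_ * _).
have [/eqP hS|hS] := boolP (#|S| == height i); last first.
  rewrite lin_form_homog0 // mmap0; apply/esym/eqP; apply: contraNT hS => /Z_homog ->.
  by rewrite eqxx.
have xP : #|(i, S).2| == height (i, S).1 by rewrite hS.
rewrite (@lin_form_var K n a (Sub (i, S) xP)) ?SubK //.
by rewrite mmapX mmap1U enum_rankK SubK.
Qed.

Lemma ev_pmono F : ev Z (pmono K F) = \prod_c Z (blk c) (F c).
Proof.
rewrite /pmono /ev rmorph_prod; apply: eq_bigr => c _; rewrite [LHS](ev_form (blk c)).
rewrite (bigD1 (F c)) //= big1 => [|S /negbTE ne]; rewrite ffunE ?eqxx.
  by rewrite mul1r addr0.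
by rewrite ne mul0r.
Qed.

Hypothesis Z0 : forall i, [ffun S => (Z i S : {poly K})`_0 : K^o] \in ext_power (height i) (W i).

(** By [Z0] the constant term of the curve lies on the Pluecker lines of P, where the generators
    vanish. *)
Lemma ev_point_ideal f : point_ideal W f -> 'X %| ev Z f.
Proof.
case=> s hs ->; rewrite ev_sum big_seq; apply: (big_ind (fun q => 'X %| q)).
- exact: dvdp0.
- exact: dvdp_add.
move=> x /hs[i [l [_ lW ->]]]; rewrite evM; apply: dvdp_mull.
rewrite ev_form -['X]subr0 -polyC0 dvdp_XsubCl /root horner_coef0 coef_sum -[X in _ == X](lW _ (Z0 i)).
by apply/eqP; apply: eq_bigr => S _; rewrite coefCM ffunE.
Qed.

Lemma ev_double_point_ideal f : double_point_ideal W f -> 'X^2 %| ev Z f.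
Proof.
case=> s hs ->; rewrite ev_sum big_seq; apply: (big_ind (fun q => 'X^2 %| q)).
- exact: dvdp0.
- exact: dvdp_add.
move=> x /hs[y [z [yI zI ->]]]; rewrite !evM; apply: dvdp_mull.
rewrite expr2; apply: dvdp_mul; exact: ev_point_ideal.
Qed.

Variables (SV : {vspace T}) (hSV : schur_module SV).
Variable pi : {linear R -> T}.
Hypothesis hpi : cartan_projection SV pi.

(** Up to [kappa], pairing with [pi f] is evaluation of f on a product of one exterior vector per
    column. Only the coefficient that is paired is required to lie in SV. *)
Lemma pairing_pi_ev f k (Y : tens {poly K} n (cols a)) : multidegree K n a f ->
  (forall F, Y F = ev Z (pmono K F)) -> tcoefp k Y \in SV ->
  pairing (pi f) (tcoefp k Y) = kappa pi * (ev Z f)`_k.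
Proof.
move=> /multidegree_span[al ->] YE YS.
rewrite pairingC linear_sum linear_sum /= ev_sum coef_sum mulr_sumr.
apply: eq_bigr => F _; rewrite linearZ /= pairingZr pairingC (pairing_pi hSV hpi) //.
rewrite {1}/ev mmapZ -/(ev Z _) coefCM -YE ffunE; ring.
Qed.

End Evaluation.
End PointIdeal.

(** * Contraction between tensors of one shape, and the Schur square *)

Section Contraction.
Variables (K : fieldType) (n m : nat).
Implicit Types (x t : tens K n m) (U : {ffun 'I_m -> {set 'I_n}}).

Lemma pad_id U c : pad (m := m) U c = U c.
Proof. by rewrite /pad valK. Qed.

(** For sets of equal size in each column, a contraction is nonzero only if they coincide, and it
    then leaves the empty set; so the Schur action collapses to the pairing. *)
Lemma contract_homog (H : 'I_m -> nat) x t U :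
  (forall F, x F != 0 -> forall c, #|F c| = H c) ->
  (forall F, t F != 0 -> forall c, #|F c| = H c) ->
  contract x t U = (U == [ffun=> set0])%:R * pairing x t.
Proof.
move=> hx ht; rewrite ffunE pairingE mulr_sumr; apply: eq_bigr => E _.
have [xE|xE] := eqVneq (x E) 0.
  by rewrite xE mul0r mulr0 big1 // => F _; rewrite !mul0r.
have coef F c : t F != 0 -> contr_coef K (pad (m := m) E c) (F c) (U c) =
    ((F c == E c) && (U c == set0))%:R.
  move=> /ht tF; rewrite pad_id /contr_coef.
  have [sub|nsub] /= := boolP (E c \subset F c); last first.
    by case: eqP nsub => // ->; rewrite subxx.
  have -> : F c = E c by apply/esym/eqP; rewrite eqEcard sub (hx E xE) tF leqnn.
  rewrite eqxx setDv; case: eqP => // ->.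
  rewrite /ext_sign (_ : [set _ | _] = set0) ?cards0 //.
  by apply/setP => st; rewrite !inE andbF.
rewrite (bigD1 E) //= [X in _ + X]big1 ?addr0 => [|F FE].
  have [tE|tE] := eqVneq (t E) 0; first by rewrite tE !mulr0 mul0r.
  under eq_bigr => c _ do rewrite coef // eqxx /=.
  rewrite mulrC; congr (_ * _); rewrite eq_ffun_prod; apply: eq_bigr => c _.
  by rewrite ffunE.
have [tF|tF] := eqVneq (t F) 0; first by rewrite tF mulr0 mul0r.
move/eqP/ffunP/eqfunP: FE; rewrite negb_forall => /existsP[c /negbTE ne].
by rewrite (bigD1 c) //= coef // ne mul0r mulr0.
Qed.

Lemma contract_eq0 (H : 'I_m -> nat) x t :
  (forall F, x F != 0 -> forall c, #|F c| = H c) ->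
  (forall F, t F != 0 -> forall c, #|F c| = H c) ->
  contract x t = 0 <-> pairing x t = 0.
Proof.
move=> hx ht; split=> [/ffunP/(_ [ffun=> set0])|e].
  by rewrite (contract_homog _ hx ht) eqxx mul1r ffunE.
by apply/ffunP => U; rewrite (contract_homog _ hx ht) e mulr0 ffunE.
Qed.

Lemma contract0 m' t : contract (0 : tens K n m') t = 0.
Proof.
apply/ffunP => U; rewrite ffunE ffunE big1 // => E _; rewrite big1 // => F _.
by rewrite ffunE !mul0r.
Qed.

End Contraction.

Section SchurSquare.
Variables (K : numFieldType) (n : nat) (a : part n).
Local Notation T := (tens K n (cols a)).
Local Notation H := (@colh n a).
Variables (SV : {vspace T}) (hSV : schur_module SV).
Variable SV' : forall b : part n, {vspace tens K n (cols b)}.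
Hypothesis SV'E : SV' a = SV.

Lemma part_incl_refl (b : seq nat) : part_incl b b.
Proof. by apply/allP => i _; apply: leqnn. Qed.

(** The family is zero outside [a], so only that component imposes a condition; there the derivative
    is moved from x to p by adjunction. *)
Lemma graded_schur_squareP (p x : T) : p \in SV ->
  graded_part SV' (schur_square SV' p) a x <->
  [/\ x \in SV, pairing x p = 0 & forall xi, pairing x (tderiv xi p) = 0].
Proof.
move=> pS; pose phi : tens_family K n := dfwith (fun b : part n => 0 : tens K n (cols b)) x.
have phia : phi a = x by rewrite /phi dfwith_in.
have phib b : b != a -> phi b = 0 by move=> ne; rewrite /phi dfwith_out // eq_sym.
rewrite /graded_part /classical_sets.mkset SV'E -/phi; split.
  move=> [xS [_ h1 h2]]; split=> // [|xi].
    have := h1 a; rewrite /schur_star part_incl_refl phia.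
    by move/(contract_eq0 (sv_homog hSV xS) (sv_homog hSV pS)).
  have := h2 xi a; rewrite /schur_star part_incl_refl phia gl_dual_actE.
  move/(contract_eq0 (tderiv_homog (sv_homog hSV xS)) (sv_homog hSV pS)).
  by rewrite pairing_tderiv.
move=> [xS h1 h2]; split=> //; split.
- split=> [b|]; last by exists [:: a] => b; rewrite inE => /phib.
  by have [->|/phib ->] := eqVneq b a; rewrite ?mem0v // phia SV'E.
- move=> b; rewrite /schur_star; case: ifP => // _.
  have [->|/phib ->] := eqVneq b a; last exact: contract0.
  by rewrite phia; apply/(contract_eq0 (sv_homog hSV xS) (sv_homog hSV pS)).
- move=> xi b; rewrite /schur_star; case: ifP => // _; rewrite gl_dual_actE.
  have [->|/phib ->] := eqVneq b a; last by rewrite linear0 contract0.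
  rewrite phia; apply/(contract_eq0 (tderiv_homog (sv_homog hSV xS)) (sv_homog hSV pS)).
  by rewrite pairing_tderiv.
Qed.

End SchurSquare.

(** * Consistency *)

Section Consistency.
Variables (n : nat) (a : part n).
Local Notation H := (@colh n a).

Lemma card_initD h h' : (h <= h')%N -> (h' <= n)%N -> #|init n h' :\: init n h| = (h' - h)%N.
Proof.
move=> le le'; have lehn := leq_trans le le'.
by rewrite cardsD (setIidPr (init_sub n le)) !card_init.
Qed.

Lemma card_setD_sym (S U : {set 'I_n}) : #|S| = #|U| -> #|S :\: U| = #|U :\: S|.
Proof. by move=> e; rewrite !cardsD e setIC. Qed.

Definition bounds := 0%N :: rcons (heights a) n.

Lemma bounds_mid (i : 'I_(nblocks a)) : nth 0%N bounds i.+1 = height i.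
Proof. by rewrite /= nth_rcons ltn_ord. Qed.

Lemma bounds_low (i j : 'I_(nblocks a)) : i = j.+1 :> nat -> nth 0%N bounds i = height j.
Proof. by move=> ->; rewrite /= nth_rcons ltn_ord. Qed.

Lemma bounds_up (i j : 'I_(nblocks a)) : j = i.+1 :> nat -> nth 0%N bounds i.+2 = height j.
Proof. by move=> e; rewrite /= -e nth_rcons ltn_ord. Qed.

Lemma bounds_last (i : 'I_(nblocks a)) : i.+1 = nblocks a -> nth 0%N bounds i.+2 = n.
Proof. by move=> e; rewrite /= nth_rcons e ltnn eqxx. Qed.

(** With multiplicity at least two, another column of the same height serves. Otherwise an adjacent
    gap is at most 1, and if S were nested with that neighbour, at most one element of S could lie
    outside its segment. *)
Lemma consistent_column c (S : {set 'I_n}) : consistent n a -> #|S| = H c ->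
  (1 < #|S :\: init n (H c)|)%N ->
  exists2 c', c' != c &
    (H c <= H c')%N /\ ~~ (S \subset init n (H c')) \/
    (H c' < H c)%N /\ ~~ (init n (H c') \subset S).
Proof.
move=> cons cS far; set i := blk c.
have [c' /andP[c'c /eqP e]|uniqc] := pickP (fun c' => (c' != c) && (blk c' == i)).
  exists c' => //; left; have -> : H c' = H c by rewrite -!height_blk e.
  by split=> //; rewrite -setD_eq0 -cards_eq0 -lt0n ltnW.
have multi : mult i = 1%N.
  rewrite -card_blk -(card1 c); apply: eq_card => d; rewrite !inE.
  by have := uniqc d; case: (d =P c) => [-> _|_ /= ->]; rewrite ?eqxx.
have := cons i multi; rewrite -/bounds bounds_mid height_blk geq_min => /orP[].
  (* For the lowest block the bound below is 0: S has at most one element, against [far]. *)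
  case: (posnP i) => i0.
    rewrite i0 /= subn0 => Hc1; have := leq_ltn_trans Hc1 far.
    by rewrite ltnNge -cS subset_leq_card // subsetDl.
  have lt : (i.-1 < nblocks a)%N by apply: leq_ltn_trans (leq_pred _) (ltn_ord i).
  have [c' ec'] := height_ex (Ordinal lt).
  have ij : i = (Ordinal lt).+1 :> nat by rewrite /= prednK.
  rewrite (bounds_low ij) -ec' height_blk => gap.
  have ltH : (H c' < H c)%N.
    by rewrite -!height_blk ec'; apply: height_lt; change (i.-1 < i)%N; rewrite prednK.
  exists c'; first by apply: contraTneq ltH => ->; rewrite ltnn.
  right; split=> //; apply: contraL far => sub; rewrite -leqNgt.
  rewrite card_setD_sym ?card_init ?colh_le //.
  by apply: leq_trans gap; rewrite -card_initD ?colh_le ?(ltnW ltH) // subset_leq_card // setDS.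
(* For the highest block the bound above is n: at most one element lies outside the segment, against
   [far]. *)
have [e|ne] := eqVneq i.+1 (nblocks a).
  rewrite (bounds_last e) => gap; have := leq_ltn_trans gap far.
  rewrite ltnNge -[X in (_ <= X - _)%N](card_ord n) -cardsT -{2}(card_init (colh_le c)).
  by rewrite -cardsDS ?subsetT // subset_leq_card // setSD // subsetT.
have lt : (i.+1 < nblocks a)%N by rewrite ltn_neqAle ne ltn_ord.
have [c' ec'] := height_ex (Ordinal lt).
rewrite (@bounds_up i (Ordinal lt)) // -ec' height_blk => gap.
have ltH : (H c < H c')%N by rewrite -!height_blk ec'; apply: height_lt.
exists c'; first by apply: contraTneq ltH => ->; rewrite ltnn.
left; split; first exact: ltnW.
apply: contraL far => sub; rewrite -leqNgt; apply: leq_trans gap.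
by rewrite -card_initD ?colh_le ?(ltnW ltH) // subset_leq_card // setSD.
Qed.

(** As the sizes agree, as many elements leave the segment as enter: with none S is the segment,
    with one it is an exchange. *)
Lemma not_exchange_far c (S : {set 'I_n}) : #|S| = H c -> S != init n (H c) ->
  (forall x b, between x b (H c) -> S != x |: init n (H c) :\ b) ->
  (1 < #|S :\: init n (H c)|)%N.
Proof.
move=> cS ne nex; rewrite ltnNge; apply/negP => le1.
have cI := card_init (colh_le c).
have c1 : #|S :\: init n (H c)| = 1%N.
  apply/eqP; rewrite eqn_leq le1 lt0n cards_eq0 setD_eq0.
  by apply: contra ne => sub; apply/eqP/eq_init => //; apply: colh_le.
have /eqP/cards1P[x ex] := c1.
have /cards1P[b eb] : #|init n (H c) :\: S| == 1%N.
  by rewrite -card_setD_sym ?c1 // cI.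
have xS : x \in S :\: init n (H c) by rewrite ex set11.
have bS : b \in init n (H c) :\: S by rewrite eb set11.
have bt : between x b (H c).
  by move: xS bS; rewrite /between !inE -leqNgt => /andP[-> _] /andP[_ ->].
case/eqP: (nex x b bt); apply/setP => y.
have := congr1 (fun U : {set 'I_n} => y \in U) ex.
have := congr1 (fun U : {set 'I_n} => y \in U) eb.
rewrite /= !inE => <- <-; rewrite negb_and negbK.
by case: (y \in S); case: (y < H c)%N.
Qed.

End Consistency.

(** * Image of the double point ideal, and equality under consistency *)

Section DoublePoint.
Variables (K : numFieldType) (n : nat) (a : part n).
Local Notation T := (tens K n (cols a)).
Local Notation H := (@colh n a).
Local Notation base := (base n H).
Local Notation init := (init n).
Local Notation e0 := (tbas K base).
Local Notation R := (coord_ring K n a).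
Local Notation blk := (@blk n a).
Implicit Types F : {ffun 'I_(cols a) -> {set 'I_n}}.

Variables (SV : {vspace T}) (hSV : schur_module SV).
Variable pi : {linear R -> T}.
Hypothesis hpi : cartan_projection SV pi.
Variables (p : T) (g0 : 'M[K]_n) (c0 : K).
Hypotheses (g0u : g0 \in unitmx) (c0n0 : c0 != 0) (pE : p = c0 *: tens_act g0 e0).
Variable W : 'I_(nblocks a) -> {vspace 'cV[K]_n}.
Hypotheses (hW : is_flag W) (hpW : represents p W).

Lemma height_le (i : 'I_(nblocks a)) : (height i <= n)%N.
Proof. by have [c <-] := height_ex i; rewrite height_blk colh_le. Qed.

Lemma sv_curve t xi k : t \in SV -> tcoefp k (tens_act (gcurve xi) (tpoly t)) \in SV.
Proof.
move=> tS; apply: (curve_coef_mem (det_gcurve xi)) => s /gcurve_unit us.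
by rewrite tev_curve sv_act.
Qed.

(** The curve Z is the translate of the flag by 1 - t xi. Up to [c0], its tensor has p as constant
    term and the derivative of p as coefficient of t, while f vanishes to order two along it. *)
Lemma double_point_kills_tangent f : multidegree K n a f -> double_point_ideal W f ->
  pairing (pi f) p = 0 /\ forall xi, pairing (pi f) (tderiv xi p) = 0.
Proof.
move=> mf If.
have kill xi k : (k < 2)%N ->
    pairing (pi f) (tcoefp k (tens_act (gcurve xi) (tpoly (tens_act g0 e0)))) = 0.
  move=> k2; set G := gcurve xi *m map_mx polyC g0.
  pose Z (i : 'I_(nblocks a)) := ext_act_basis G (init (height i)).
  have Zh i S : Z i S != 0 -> #|S| = height i.
    by move/ext_act_basis_homog ->; rewrite card_init // height_le.
  have Z0 i : [ffun S => (Z i S : {poly K})`_0 : K^o] \in ext_power (height i) (W i).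
    rewrite (_ : [ffun _ => _] = pl g0 i); first exact: (pl_in_ext_power pE hpW).
    apply/ffunP => S; rewrite ffunE /pl /Z -[LHS]/(coefp 0 _) -(@ext_act_basis_morph _ _ (coefp 0)).
    congr (ext_act_basis _ _ S); rewrite map_mxM /= -map_mx_comp.
    rewrite (_ : map_mx (coefp 0) (gcurve xi) = 1%:M) ?mul1mx.
      by apply/matrixP => x y; rewrite !mxE /= coefC.
    apply/matrixP => x y; rewrite !mxE /= coefB coefMn coefC coefXM /= subr0.
    by [].
  rewrite (@pairing_pi_ev K n a Z SV hSV pi hpi _ _ _ mf) ?sv_curve ?sv_act ?base_sv //.
    have /dvdpX2_coef[e1 e2] := ev_double_point_ideal Zh Z0 If.
    by case: k k2 => [|[|]] // _; rewrite ?e1 ?e2 mulr0.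
  move=> F; rewrite ev_pmono // -tens_act_tpoly -tens_actM tbas_tpoly tens_act_tbas.
  by apply: eq_bigr => c _; rewrite /Z height_blk baseE.
rewrite pE; split.
  rewrite pairingZr; have := kill 0 0%N isT.
  rewrite (_ : tcoefp 0 _ = tens_act g0 e0) => [->|]; first by rewrite mulr0.
  rewrite /gcurve (_ : map_mx polyC 0 = 0); last by apply/matrixP => i j; rewrite !mxE.
  by rewrite scaler0 subr0 tens_act1 tcoefp_tpoly.
by move=> xi; rewrite linearZ /= pairingZr [pairing _ _](kill xi 1%N isT) mulr0.
Qed.

Lemma ideal_gen_lin (B : comNzRingType) (Y : B -> Prop) (t x y : B) :
  ideal_gen Y x -> ideal_gen Y y -> ideal_gen Y (t * x + y).
Proof.
case=> s hs -> [s' hs' ->]; exists ([seq (t * u.1, u.2) | u <- s] ++ s').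
  by move=> u; rewrite mem_cat => /orP[/mapP[v vs ->]|]; [exact: (hs v vs) | exact: hs'].
rewrite big_cat big_map mulr_sumr; congr (_ + _).
by apply: eq_bigr => u _; rewrite mulrA.
Qed.

Definition pi_double x := exists f, [/\ double_point_ideal W f, multidegree K n a f & pi f = x].

Lemma pi_double_lin (t : K) u v : pi_double u -> pi_double v -> pi_double (t *: u + v).
Proof.
case=> f [f1 f2 <-] [g [g1 g2 <-]]; exists (t *: f + g); split; last by rewrite linearP.
  by rewrite -mul_mpolyC; apply: ideal_gen_lin.
exact: multidegree_lin.
Qed.

Lemma pi_double0 : pi_double 0.
Proof.
exists 0; split; last by rewrite linear0.
  by exists [::] => //; rewrite big_nil.
exact: (@hasdeg0 K n a (@mult a)).
Qed.

Lemma pi_doubleZ (t : K) u : pi_double u -> pi_double (t *: u).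
Proof. by move=> Qu; rewrite -[_ *: _]addr0; apply: pi_double_lin pi_double0. Qed.

Lemma pi_doubleD u v : pi_double u -> pi_double v -> pi_double (u + v).
Proof. by move=> Qu Qv; rewrite -[u]scale1r; apply: pi_double_lin. Qed.

Lemma pi_double_sum (I : finType) (P : pred I) (k : I -> K) (q : I -> T) :
  (forall i, P i -> pi_double (q i)) -> pi_double (\sum_(i | P i) k i *: q i).
Proof.
move=> h; apply: (big_ind _ pi_double0 pi_doubleD) => i Pi; exact/pi_doubleZ/h.
Qed.

Lemma pi_double_solve (I : finType) (P : pred I) (k : I -> K) (q : I -> T) i0 :
  P i0 -> k i0 != 0 -> \sum_(i | P i) k i *: q i = 0 ->
  (forall i, P i -> i != i0 -> pi_double (q i)) -> pi_double (q i0).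
Proof.
move=> Pi0 k0 e h.
have -> : q i0 = - (k i0)^-1 *: \sum_(i | P i && (i != i0)) k i *: q i.
  move: e; rewrite (bigD1 i0) //= => /eqP; rewrite addr_eq0 => /eqP e.
  by rewrite scaleNr -scalerN -e scalerA mulVf // scale1r.
by apply/pi_doubleZ/pi_double_sum => i /andP[Pi ne]; apply: h.
Qed.

Definition qact F : T := tens_act (invmx g0)^T (qvec pi F).

Lemma qact_far F c c' : c != c' -> F c != init (H c) -> F c' != init (H c') ->
  pi_double (qact F).
Proof.
move=> cc' Fc Fc'; rewrite /qact /qvec.
have [hF|->] := @pmonoP K n a F; last by rewrite linear0 scaler0 linear0; apply: pi_double0.
exists ((kappa pi)^-1 *: ring_act g0 (pmono K F)); split.
- rewrite -[_ *: _]addr0 -mul_mpolyC; apply: ideal_gen_lin.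
    by apply: (double_point_pmono g0u pE hW hpW hF cc').
  by exists [::] => //; rewrite big_nil.
- rewrite -[_ *: _]addr0; apply: multidegree_lin; last exact: (@hasdeg0 K n a (@mult a)).
  by rewrite ring_act_pmono //; apply: multidegree_prod.
- rewrite linearZ /= (pi_equiv hpi) //; last exact: multidegree_pmono.
  by rewrite linearZ.
Qed.

Lemma qact_plucker F c c' (A B : {set 'I_n}) : (H c <= H c')%N -> c != c' ->
  \sum_(j in B :\: A) (psign K j A * psign K j (B :\ j)) *:
     qact (upd (upd F c (j |: A)) c' (B :\ j)) = 0.
Proof.
move=> le cc'; transitivity (tens_act (invmx g0)^T 0 : T); last by rewrite linear0.
rewrite -[X in tens_act _ X](qvec_plucker hSV hpi F A B le cc') linear_sum; apply: eq_bigr => j _.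
by rewrite linearZ.
Qed.

Lemma psign2_neq0 j (A B : {set 'I_n}) : psign K j A * psign K j B != 0.
Proof. by rewrite mulf_neq0 // signr_eq0. Qed.

(** Of the two elements of S outside the segment, one survives the removal of i. *)
Lemma far_neq_init (S U : {set 'I_n}) i h : (1 < #|S :\: init h|)%N ->
  S :\ i \subset U -> U != init h.
Proof.
move=> far /subsetP sub; apply: contraTneq far => e; rewrite -leqNgt.
apply: (@leq_trans #|[set i]|); last by rewrite cards1.
apply: subset_leq_card; apply/subsetP => x; rewrite in_setD in_set1 -e => /andP[xU xS].
by apply: contraNT xU => xi; apply: sub; rewrite !inE xi.
Qed.

(** The relation of [tangent_near], now inside one copy: the remaining terms do not vanish, but both
    columns c and c' are wrong in them, so they come from the squared ideal. *)
Lemma qact_near c c' x b : (H c <= H c')%N -> between x b (H c) -> between x b (H c') ->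
  pi_double (esign K x b (init (H c)) *: qact (exch H c x b)
    - esign K x b (init (H c')) *: qact (exch H c' x b)).
Proof.
move=> le bt bt'; have [->|cc'] := eqVneq c c'; first by rewrite subrr; apply: pi_double0.
have [k [k1 k2]] := esign_exchange K bt bt'.
have ltba := between_gt bt; case/andP: (between_in bt) => bi ai.
case/andP: (between_in bt') => bi' ai'.
have ba : b != x by apply: contraTneq ltba => ->; rewrite ltnn.
have := qact_plucker base (init (H c) :\ b) (x |: init (H c')) le cc'.
rewrite (bigD1 x) /=; last by move: ai; rewrite !inE eqxx => /negbTE ->; rewrite andbF.
rewrite (bigD1 b) /=; last by rewrite in_setD setD11 in_setU1 bi' orbT ba.
rewrite (setU1K ai') (setD1K bi) (setU1D1 _ ba).
rewrite (_ : upd (upd base c (x |: init (H c) :\ b)) c' _ = exch H c x b); last first.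
  apply/ffunP => d; rewrite !updE !baseE; case: (d =P c') => // ->.
  by rewrite eq_sym (negbTE cc').
rewrite (_ : upd (upd base c (init (H c))) c' _ = exch H c' x b); last by rewrite upd_base_init.
set r := \sum_(_ | _) _ => e.
have Qr : pi_double r.
  apply: pi_double_sum => j /andP[/andP[jBA jx] jb].
  move: jBA; rewrite !inE (negbTE jx) (negbTE jb) /= -leqNgt => /andP[Hj jc'].
  apply: (qact_far cc'); rewrite !updE ?eqxx ?(negbTE cc') ?setU1_neq_init //.
  rewrite (@setU1D1 _ x j) // setU1_neq_init //; by case/andP: bt'.
rewrite -k1 -scaleNr -k2 -scalerA -[X in _ + X]scalerA -scalerDr; apply: pi_doubleZ.
by move/eqP: e; rewrite addrA addr_eq0 => /eqP ->; rewrite -scaleN1r; apply: pi_doubleZ.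
Qed.

Hypothesis cons : consistent n a.

Lemma qact_not_exchange F : F != base ->
  (forall c x b, between x b (H c) -> F != exch H c x b) -> pi_double (qact F).
Proof.
move=> Fb nex; have [hF|F0] := @pmonoP K n a F; last first.
  by rewrite /qact /qvec F0 linear0 scaler0 linear0; apply: pi_double0.
have [c cF] : exists c, F c != init (H c).
  apply/existsP; rewrite -negb_forall; apply: contra Fb => /forallP h.
  by apply/eqP/ffunP => c; rewrite baseE; apply/eqP/h.
have [/existsP[c' /andP[cc' c'F]]|/existsPn other] :=
    boolP [exists c', (c != c') && (F c' != init (H c'))]; first exact: qact_far cc' cF c'F.
have FE : F = upd base c (F c).
  apply/ffunP => d; rewrite updE baseE; have [->//|dc] := eqVneq d c.
  by apply/eqP; have := other d; rewrite eq_sym dc negbK.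
have far : (1 < #|F c :\: init (H c)|)%N.
  apply: not_exchange_far => // x b bt; apply: contraNneq (nex c x b bt) => e.
  by rewrite FE e.
move: (F c) (hF c) cF far FE => S cS cF far ->.
have [c' c'c [[le /subsetPn[i iS ii]]|[lt /subsetPn[i ii iS]]]] := consistent_column cons cS far.
  (* The term j = i is the one to be solved for. In every other term column c' has received i from
     outside its segment, and column c has lost only i, so it is still wrong. *)
  rewrite eq_sym in c'c; have := qact_plucker base (S :\ i) (i |: init (H c')) le c'c.
  move/(@pi_double_solve _ _ _ _ i); rewrite setU1K // setD1K //.
  rewrite (_ : upd (upd base c S) c' _ = upd base c S); last first.
    apply/ffunP => d; rewrite !updE !baseE; case: (d =P c') => // ->.
    by rewrite eq_sym (negbTE c'c).
  apply=> [||j jBA ji]; first by rewrite !inE eqxx.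
    exact: psign2_neq0.
  apply: (qact_far c'c); rewrite !updE ?eqxx ?(negbTE c'c).
    by apply: (far_neq_init far (i := i)); apply: subsetUr.
  by apply: contraNneq ii => <-; rewrite !inE eqxx eq_sym ji.
(* Here the shorter column c' comes first: in every term other than j = i it lacks i, while column c
   keeps all of S except j. *)
have := qact_plucker base (init (H c') :\ i) (i |: S) (ltnW lt) c'c.
move/(@pi_double_solve _ _ _ _ i); rewrite setU1K // setD1K // upd_base_init.
apply=> [||j jBA ji]; first by rewrite !inE eqxx.
  exact: psign2_neq0.
move: jBA; rewrite !inE (negbTE ji) /= => jBA.
apply: (qact_far c'c); rewrite !updE ?eqxx ?(negbTE c'c).
  by apply: contraTneq ii => <-; rewrite !inE eqxx eq_sym (negbTE ji).
by apply: (far_neq_init far (i := j)); apply/setSD/subsetUr.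
Qed.

Lemma consistent_pi_double x : x \in SV -> pairing x p = 0 ->
  (forall xi, pairing x (tderiv xi p) = 0) -> pi_double x.
Proof.
move=> xS xp xd; set x' := tens_act g0^T x.
have x'S : x' \in SV by apply: sv_act; rewrite // unitmx_tr.
have -> : x = \sum_F x' F *: qact F.
  transitivity (tens_act (invmx g0)^T x').
    by rewrite /x' -tens_actM -trmx_mul mulmxV // trmx1 tens_act1.
  rewrite {1}(sv_qvec hSV hpi x'S) linear_sum; apply: eq_bigr => F _; by rewrite linearZ.
apply: (sum_exchange pi_double0 pi_double_lin).
- exact: (pullback_base c0n0 pE xp).
- exact: (pullback_exch g0u c0n0 pE xd).
- exact: qact_not_exchange.
- exact: qact_near.
Qed.

End DoublePoint.

(** * Failure of equality without consistency *)

Lemma swap_two n h : (1 < h)%N -> (h + 1 < n)%N ->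
  exists s : {perm 'I_n}, (1 < #|(s @: init n h) :\: init n h|)%N /\
    forall h', (h' + 2 <= h)%N || (h + 2 <= h')%N -> s @: init n h' = init n h'.
Proof.
move=> h1 hn.
have l1 : (h.-1 < n)%N by lia.
have l2 : (h < n)%N by lia.
have l3 : (h.-2 < n)%N by lia.
have l4 : (h.+1 < n)%N by lia.
pose o1 := Ordinal l1; pose o2 := Ordinal l2; pose o3 := Ordinal l3; pose o4 := Ordinal l4.
have neq (x y : 'I_n) : (x != y :> nat) -> x != y by [].
have n32 : o3 != o2 by apply: neq => /=; lia.
have n42 : o4 != o2 by apply: neq => /=; lia.
have n13 : o1 != o3 by apply: neq => /=; lia.
have n23 : o2 != o3 by rewrite eq_sym.
(* It exchanges h - 1 with h and h - 2 with h + 1, so it moves [0, h') only for h' among h - 1, h, h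
   + 1; hence the gaps of two. *)
exists (tperm o1 o2 * tperm o3 o4)%g; split.
  apply: (@leq_trans #|[set o2; o4]|).
    by rewrite cards2 eq_sym n42.
  apply: subset_leq_card; apply/subsetP => x; rewrite !inE => /orP[]/eqP->.
    rewrite ltnn /=; apply/imsetP; exists o1; first by rewrite inE /=; lia.
    by rewrite permM tpermL tpermD.
  rewrite /= ltnNge leqnSn /=; apply/imsetP; exists o3; first by rewrite inE /=; lia.
  by rewrite permM (tpermD n13 n23) tpermL.
move=> h' hh'; apply/eqP; rewrite eqEcard card_imset ?leqnn ?andbT; last exact: perm_inj.
apply/subsetP => _ /imsetP[x xh' ->]; move: xh'; rewrite !inE permM.
case: (tpermP o1 o2 x) => [->|->|_ _]; case: tpermP => [e|e|_ _]; move: hh' => //=;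
  try (move: e => /(congr1 val) /=); lia.
Qed.

Section Inconsistent.
Variables (K : numFieldType) (n : nat) (a : part n).
Local Notation T := (tens K n (cols a)).
Local Notation H := (@colh n a).
Local Notation base := (base n H).
Local Notation init := (init n).
Local Notation e0 := (tbas K base).
Local Notation R := (coord_ring K n a).
Local Notation blk := (@blk n a).
Implicit Types F : {ffun 'I_(cols a) -> {set 'I_n}}.

Variables (SV : {vspace T}) (hSV : schur_module SV).
Variable pi : {linear R -> T}.
Hypothesis hpi : cartan_projection SV pi.
Variables (p : T) (g0 : 'M[K]_n) (c0 : K).
Hypotheses (g0u : g0 \in unitmx) (c0n0 : c0 != 0) (pE : p = c0 *: tens_act g0 e0).
Variable W : 'I_(nblocks a) -> {vspace 'cV[K]_n}.
Hypothesis hpW : represents p W.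

(** Every bound lies between 0 and n, which gives the first two claims; monotonicity extends the gap
    from the adjacent blocks to all others. *)
Lemma inconsistent_heights (i : 'I_(nblocks a)) :
  (1 < minn (nth 0 (bounds a) i.+1 - nth 0 (bounds a) i)
            (nth 0 (bounds a) i.+2 - nth 0 (bounds a) i.+1))%N ->
  [/\ (1 < height i)%N, (height i + 1 < n)%N & forall j, j != i ->
      (height j + 2 <= height i)%N || (height i + 2 <= height j)%N].
Proof.
rewrite leq_min bounds_mid => /andP[g1 g2]; split.
- by apply: leq_trans g1 _; apply: leq_subr.
- suff : (nth 0%N (bounds a) i.+2 <= n)%N by lia.
  have [e|ne] := eqVneq i.+1 (nblocks a); first by rewrite (bounds_last e).
  have lt : (i.+1 < nblocks a)%N by rewrite ltn_neqAle ne ltn_ord.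
  by rewrite (@bounds_up _ _ i (Ordinal lt)) // height_le.
move=> j ji; have mono (k l : 'I_(nblocks a)) : (k <= l)%N -> (height k <= height l)%N.
  by rewrite leq_eqVlt => /orP[/eqP/val_inj -> //|/height_lt/ltnW].
have : val j != val i by [].
rewrite neq_ltn => /orP[lt|lt]; apply/orP; [left|right].
  have lt' : (i.-1 < nblocks a)%N by apply: leq_ltn_trans (leq_pred _) (ltn_ord i).
  have ij : i = (Ordinal lt').+1 :> nat by rewrite /= prednK // (leq_trans _ lt).
  move: g1; rewrite (bounds_low ij) => g1.
  have le : (j <= Ordinal lt')%N by move: lt => /=; lia.
  have := mono _ _ le; lia.
have lt' : (i.+1 < nblocks a)%N by apply: leq_ltn_trans lt (ltn_ord j).
move: g2; rewrite (@bounds_up _ _ i (Ordinal lt')) // => g2.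
have := mono (Ordinal lt') j lt; lia.
Qed.

Lemma pl_mul (g : 'M[K]_n) i :
  (forall S, ext_act_basis g (init (height i)) S != 0 -> S = init (height i)) ->
  pl (g0 *m g) i \in ext_power (height i) (W i).
Proof.
move=> h; have e : ext_act_basis g (init (height i)) =
    ext_act_basis g (init (height i)) (init (height i)) *: ebas K (init (height i)).
  apply/ffunP => S; rewrite ffZ ffunE; have [->|ne] := eqVneq S (init (height i)).
    by rewrite mulr1.
  by rewrite mulr0; apply/eqP; apply: contraNT ne => /h ->.
rewrite /pl ext_act_basisM e linearZ /= ext_act_ebas memvZ //.
exact: (pl_in_ext_power pE hpW).
Qed.

(** The witness is v = g e, supported on the single index [F1], and its transport x to P. It
    annihilates the tangent vectors because column [c1] has two new elements. If x came from the
    squared ideal, its pairing with g0 v would be zero, but this pairing is the square of the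
    coordinate of v at [F1]. *)
Lemma pi_double_consistent :
  (forall x, x \in SV -> pairing x p = 0 -> (forall xi, pairing x (tderiv xi p) = 0) ->
     pi_double pi W x) -> consistent n a.
Proof.
move=> all_double bds i multi; rewrite {}/bds -/(bounds a); case: leqP => // /inconsistent_heights.
case=> h1 hn hj; have [s [far fix_s]] := swap_two h1 hn.
have [c1 c1i] := height_ex i.
have uniq c : c != c1 -> blk c != i.
  move=> cc1; apply/eqP => ci; have /card1P[d hd] : #|[pred c | blk c == i]| == 1%N.
    by rewrite card_blk multi.
  have := hd c; have := hd c1; rewrite !inE c1i ci !eqxx => /esym/eqP e1 /esym/eqP e2.
  by rewrite e1 e2 eqxx in cc1.
have fixH c : c != c1 -> s @: init (H c) = init (H c).
  by move=> /uniq cc; rewrite -height_blk fix_s // hj.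
pose g : 'M[K]_n := perm_mx s^-1.
have gu : g \in unitmx by rewrite unitmx_perm.
have colg x : col x g = 1 *: delta_mx (s x) 0.
  rewrite scale1r; apply/matrixP => y z; rewrite !mxE (ord1 z) eqxx andbT.
  by rewrite -(inj_eq (@perm_inj _ s)) permKV.
have gsupp U S : ext_act_basis g U S != 0 -> S = s @: U.
  by move/(ext_act_basis_monomial colg).
pose F1 : {ffun 'I_(cols a) -> {set 'I_n}} := [ffun c => s @: init (H c)].
pose v := tens_act g e0.
have vS : v \in SV by rewrite sv_act // base_sv.
have vF F : v F != 0 -> F = F1.
  rewrite /v tens_act_tbas => nz; apply/ffunP => c; rewrite ffunE -baseE; apply: gsupp.
  by apply: contraNneq nz => z; rewrite /tcoef (bigD1 c) //= z mul0r.
have vF1 : v F1 != 0.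
  apply/eqP => z; have v0 : v = 0.
    apply/ffunP => F; rewrite ff0; apply/eqP; apply/negPn/negP => nz.
    by move: (nz); rewrite (vF _ nz) z eqxx.
  have := e0_neq0 K a; rewrite -[e0]tens_act1 -(mulVmx gu) tens_actM -/v v0 linear0.
  by rewrite eqxx.
have F1c1 : (1 < #|F1 c1 :\: init (H c1)|)%N.
  by rewrite ffunE -height_blk c1i.
have pv (y : T) : pairing v y = v F1 * y F1.
  rewrite pairingE (bigD1 F1) //= big1 ?addr0 // => F ne.
  have [->|/vF e] := eqVneq (v F) 0; first by rewrite mul0r.
  by rewrite e eqxx in ne.
pose x := tens_act (invmx g0)^T v.
have xS : x \in SV by apply: sv_act; rewrite // unitmx_tr unitmx_inv.
have vx : tens_act g0^T x = v.
  by rewrite /x -tens_actM -trmx_mul mulVmx // trmx1 tens_act1.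
have xg (y : T) : pairing x (tens_act g0 y) = pairing v y.
  by rewrite -[g0 in LHS]trmxK -pairing_act vx.
have xp : pairing x p = 0.
  rewrite pE pairingZr xg pv (_ : tbas K base F1 = 0 :> K) ?mulr0 //.
  rewrite ffunE (_ : (F1 == base) = false) //; apply/negbTE; apply: contraTneq F1c1 => ->.
  by rewrite baseE setDv cards0.
have xd xi : pairing x (tderiv xi p) = 0.
  have e : g0 *m (invmx g0 *m xi *m g0) *m invmx g0 = xi.
    by rewrite mulmxA mulmxK // mulKVmx.
  rewrite -[in tderiv xi p]e -(pairing_tderiv_pullback g0u pE) vx pv.
  by rewrite (tderiv_far _ F1c1) !mulr0.
have [f [If mf fx]] := all_double x xS xp xd.
(* In block i a straight line of the ambient exterior power through the Pluecker vector of P, not a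
   curve of flags. In the other blocks g preserves the segments, so the translated vectors still
   represent the subspaces of P. As block i has a single column, the coefficient of t is exactly g0
   g e. *)
pose Z (j : 'I_(nblocks a)) : ext {poly K} n :=
  if j == i then [ffun S => (pl g0 i S)%:P + 'X * (pl (g0 *m g) i S)%:P : {poly K}^o]
  else [ffun S => (pl (g0 *m g) j S)%:P : {poly K}^o].
have plh h' j S : pl h' j S != 0 :> K -> #|S| = height j.
  by move/ext_act_basis_homog ->; rewrite card_init // height_le.
have Zh j S : Z j S != 0 -> #|S| = height j.
  rewrite /Z; have [->|ne] := eqVneq j i; rewrite ffunE; last first.
    by rewrite polyC_eq0; apply: plh.
  have [->|/plh -> //] := eqVneq (pl g0 i S) 0.
  have [->|/plh -> //] := eqVneq (pl (g0 *m g) i S) 0.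
  by rewrite mulr0 addr0 eqxx.
have Z0 j : [ffun S => (Z j S : {poly K})`_0 : K^o] \in ext_power (height j) (W j).
  rewrite /Z; have [->|ne] := eqVneq j i.
    rewrite (_ : [ffun _ => _] = pl g0 i); first exact: (pl_in_ext_power pE hpW).
    by apply/ffunP => S; rewrite !ffunE coefD coefC coefXM addr0.
  rewrite (_ : [ffun _ => _] = pl (g0 *m g) j).
    by apply: pl_mul => S /gsupp ->; rewrite fix_s // hj.
  by apply/ffunP => S; rewrite !ffunE coefC.
pose Y : tens {poly K} n (cols a) := [ffun F => ev Z (pmono K F) : {poly K}^o].
have Y1 : tcoefp 1 Y = tens_act g0 v.
  apply/ffunP => F; rewrite ffunE ffunE ev_pmono // (bigD1 c1) //= /Z c1i eqxx ffunE.
  rewrite -tens_actM tens_act_tbas /tcoef [RHS](bigD1 c1) //= baseE -height_blk c1i.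
  rewrite (eq_bigr (fun c => (ext_act_basis (g0 *m g) (base c) (F c))%:P)) => [|c cc1].
    rewrite -rmorph_prod coefMC coefD coefC coefXM coefC /= add0r.
    by [].
  by rewrite (negbTE (uniq _ cc1)) ffunE /pl height_blk baseE.
have : pairing (pi f) (tcoefp 1 Y) = kappa pi * (ev Z f)`_1.
  by apply: (@pairing_pi_ev K n a Z SV hSV pi hpi) => // [F|]; rewrite ?ffunE // Y1 sv_act.
have [_ ->] := dvdpX2_coef (ev_double_point_ideal Zh Z0 If).
by rewrite Y1 fx xg pv mulr0 => /eqP; rewrite mulf_eq0 (negbTE vF1).
Qed.

End Inconsistent.

From mathcomp Require Import classical_sets reals.
Local Open Scope complex_scope.
Local Open Scope classical_set_scope.

(** Once SV' a is identified with SV, the Schur square in degree a and the annihilator are both the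
    set of x in SV orthogonal to p and to all [tderiv xi p]; the image of the double point is
    compared with this set. *)
Theorem double_point_consistent (K : numFieldType) (n : nat) (a : part n)
    (SV : {vspace tens K n (cols a)}) (hSV : schur_module SV)
    (SV' : forall b : part n, {vspace tens K n (cols b)})
    (hSV' : dual_schur_module (SV' a))
    (pi : {linear coord_ring K n a -> tens K n (cols a)})
    (hpi : cartan_projection (SV' a) pi)
    (p : tens K n (cols a)) (hp : flag_cone SV p)
    (W : 'I_(nblocks a) -> {vspace 'cV[K]_n})
    (hW : is_flag W) (hpW : represents p W) :
  let I2d := double_point_ideal W `&` multidegree K n a in
  let IS2 := graded_part SV' (schur_square SV' p) a in
  [/\ pi @` I2d `<=` IS2,
      IS2 = annihilator (SV' a) (tangent SV p) &
      pi @` I2d = IS2 <-> consistent n a].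
Proof.
have SV'E : SV' a = SV by exact: (dual_schurE hSV hSV').
have pS : p \in SV := flag_cone_sv hSV hp.
have IS2P x := graded_schur_squareP hSV SV'E x pS.
have [g0 [c0 [g0u c0n0 pE]]] := (flag_coneP hSV p).1 hp.
rewrite SV'E in hpi *; move=> I2d IS2.
have sub : pi @` I2d `<=` IS2.
  move=> _ [f [If mf] <-]; apply/IS2P.
  have [e1 e2] := double_point_kills_tangent hSV hpi g0u pE hpW mf If.
  by split=> //; apply: pi_mem mf.
split=> //.
  apply/seteqP; split=> x.
    move/IS2P => [xS e1 e2]; split=> // v; exact: (tangent_perp hSV g0u c0n0 pE e1 e2).
  case=> xS h; apply/IS2P; split=> // [|xi]; apply: h.
    exact: tangent_self.
  exact: tangent_tderiv.
split=> [e | cons].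
  apply: (pi_double_consistent hSV hpi g0u c0n0 pE hpW) => x xS e1 e2.
  have : IS2 x by apply/IS2P.
  by rewrite -e => -[f [If mf] fx]; exists f.
apply/seteqP; split=> // x /IS2P[xS e1 e2].
have [f [If mf fx]] := consistent_pi_double hSV hpi g0u c0n0 pE hW hpW cons xS e1 e2.
by exists f.
Qed.

Theorem theorem4p13 (R : realType) (n : nat) (lam : part n)
    (lam_neq0 : (lam : seq nat) <> [::]) (lam_lt : (size lam < n)%N)
    (SV : {vspace tens R[i] n (cols lam)}) (hSV : schur_module SV)
    (SV' : forall a : part n, {vspace tens R[i] n (cols a)})
    (hSV' : forall a : part n, dual_schur_module (SV' a))
    (pi : {linear coord_ring R[i] n lam -> tens R[i] n (cols lam)})
    (hpi : cartan_projection (SV' lam) pi)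
    (p : tens R[i] n (cols lam)) (hp : flag_cone SV p)
    (W : 'I_(nblocks lam) -> {vspace 'cV[R[i]]_n})
    (hW : is_flag W) (hpW : represents p W) :
  let I2d := double_point_ideal W `&` multidegree R[i] n lam in
  let IS2 := graded_part SV' (schur_square SV' p) lam in
  [/\ pi @` I2d `<=` IS2,
      IS2 = annihilator (SV' lam) (tangent SV p) &
      pi @` I2d = IS2 <-> consistent n lam].
Proof. exact: (double_point_consistent hSV (hSV' lam) hpi hp hW hpW). Qed.
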